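(* Fix $u_m>0$ and $\kappa>5/u_m$. There exists $\eta_0>0$ such that, for every $0<\eta<\eta_0$, there exist constants $\varepsilon_0>0$, $\delta_0>0$ and $c>0$, with $c$ independent of $f$, for which the following holds. Let $T>0$, let $f\in C^3(\mathbb R)$ satisfy $\varepsilon_f\le\varepsilon_0$, let $0<\delta_R/u_m\le\delta_0$, let $\widetilde u$ be the reference composite profile, let $u$ be a strong solution of $u_t+f(u)_x=u_{xx}$ on $[0,T]$, and let $X$ be the solution of the shift equation $\dot X=\kappa\mathcal Y$, $X(0)=0$. Then $$\mathcal G_f(t)\ge c\left(u_m\int_{\mathbb R}\phi_\xi^2\,d\xi+\int_{\mathbb R}\widetilde u_\xi\left(u_m^2\phi^2+\phi^4\right)d\xi+|\dot X(t)|^2\right)$$ for all $t\in[0,T]$.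
   Context: For $f\in C^3(\mathbb R)$ put $q(u):=f(u)-u^3$ and $\varepsilon_f:=\sup_{u\in\mathbb R}\frac{|q''(u)|}{u_m+|u|}+\|q'''\|_{L^\infty(\mathbb R)}$. The constants $\varepsilon_0,\delta_0$ are understood small enough that the following objects are well defined. States and shock profile. $u_-$ is the unique state in $(-5u_m/2,-3u_m/2)$ with $\sigma:=\frac{f(u_m)-f(u_-)}{u_m-u_-}=f'(u_m)$; $u^S\in C^2(\mathbb R)$ is the unique solution of $-\sigma u^S_\xi+f(u^S)_\xi=u^S_{\xi\xi}$ with $u^S(-\infty)=u_-$, $u^S(+\infty)=u_m$, $u^S(0)=(u_-+u_m)/2$. $\delta_R>0$ and $u_+:=u_m+\delta_R$; $f'$ is strictly increasing on $[u_m,u_+]$ and $(f')^{-1}$ is the inverse of this restriction. Approximate rarefaction and composite profile. With $\lambda_m:=f'(u_m)$, $\lambda_+:=f'(u_+)$, let $w^R$ be the unique global smooth solution of $w^R_t+w^Rw^R_x=0$, $w^R(0,x)=\frac{\lambda_m+\lambda_+}2+\frac{\lambda_+-\lambda_m}2\tanh x$; set $\bar u^R:=(f')^{-1}(w^R)$, $u^R(t,\xi):=\bar u^R(1+t,\xi+\sigma(1+t))$, $\widetilde u(t,\xi):=u^S(\xi)+u^R(t,\xi)-u_m$. Strong solution on $[0,T]$: $u-\widetilde u(0,\cdot)\in C([0,T];H^1(\mathbb R))\cap L^2(0,T;H^2(\mathbb R))$, $u_t\in L^2(0,T;L^2(\mathbb R))$, and $u_t+f(u)_x=u_{xx}$ in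 $L^2(\mathbb R)$ for a.e. $t\in(0,T)$. Perturbation, weight, shift. $\phi(t,\xi):=u(t,\xi+\sigma t-X(t))-\widetilde u(t,\xi)$; $\alpha_\eta:=(5-\eta)u_m$; $a_\eta:=\alpha_\eta-\widetilde u$; $\mathcal Y(t):=\int_{\mathbb R}\widetilde u_\xi(a_\eta\phi+\frac12\phi^2)\,d\xi$. The shift equation is an ODE for $X$ with a unique $C^1$ solution on $[0,T]$. Functionals. For a flux $g$ and $v,z\in\mathbb R$, $$\mathcal B_g^\eta(v,z):=(\alpha_\eta-v+z)\bigl(g(v+z)-g(v)\bigr)-\int_0^z\bigl(g(v+s)-g(v)\bigr)ds-(\alpha_\eta-v)g'(v)z,$$ $$\mathcal A_g^\eta(v,z):=\mathcal B_g^\eta(v,z)+\tfrac12g'(v)z^2.$$ For a profile $V$, $\mathcal Y_S^\eta[V;\phi]:=\int_{\mathbb R}V_\xi\left((\alpha_\eta-V)\phi+\frac12\phi^2\right)d\xi$ and $$\mathcal D_{S,g}^\eta[V;\phi]:=\int_{\mathbb R}(\alpha_\eta-V)\phi_\xi^2\,d\xi+\int_{\mathbb R}V_\xi\left[\mathcal B_g^\eta(V,\phi)+\tfrac12\bigl(g'(V)-2g'(u_m)\bigr)\phi^2\right]d\xi+\frac5{u_m}\left(\mathcal Y_S^\eta[V;\phi]\right)^2,$$ $$\mathcal D_{R,g}^\eta[u^R;\phi]:=\int_{\mathbb R}u^R_\xi\left[\mathcal B_g^\eta(u^R,\phi)-\tfrac12g'(u^R)\phi^2\right]d\xi,$$ $$\mathcal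 Z:=-\int_{\mathbb R}(u^R-u_m)u^S_\xi\phi\,d\xi+\int_{\mathbb R}u^R_\xi\left(a_\eta\phi+\tfrac12\phi^2\right)d\xi,$$ $$\begin{aligned}\mathcal G_f(t):={}&\mathcal D_{S,f}^\eta[u^S;\phi]+\mathcal D_{R,f}^\eta[u^R;\phi]-\int_{\mathbb R}(u^R-u_m)\phi_\xi^2\,d\xi+\kappa\left(\mathcal Y_S^\eta[u^S;\phi]+\mathcal Z\right)^2\\&-\frac5{u_m}\left(\mathcal Y_S^\eta[u^S;\phi]\right)^2+\int_{\mathbb R}u^S_\xi\bigl(\mathcal A_f^\eta(\widetilde u,\phi)-\mathcal A_f^\eta(u^S,\phi)\bigr)d\xi.\end{aligned}$$ *)

(* Defs.v *)
(* Functions of time and space are curried, time first. *)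
From HB Require Import structures.
From mathcomp Require Import all_boot all_order all_algebra.
From mathcomp Require Import all_classical all_reals all_analysis.

Set Implicit Arguments.
Unset Strict Implicit.
Unset Printing Implicit Defensive.

Import Order.TTheory GRing.Theory Num.Theory.
Import numFieldNormedType.Exports.

Local Open Scope classical_set_scope.
Local Open Scope ring_scope.

Local Notation mu := lebesgue_measure.
(* These override the formal derivatives of polynomials. *)
Local Notation "f ^` ()" := (derive1 f) : ring_scope.
Local Notation "f ^` ( n )" := (derive1n n f) : ring_scope.

Definition Cn (R : realType) (n : nat) (f : R -> R) : Prop :=
  (forall k x, (k < n)%N -> derivable (f^`(k)) x 1) /\ continuous (f^`(n)).

Definition time_derive (R : realType) (w : R -> R -> R) (t x : R) : R :=
  (w ^~ x)^`() t.

Definition space_derive (R : realType) (w : R -> R -> R) (t x : R) : R :=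
  (w t)^`() x.

(* All iterated partial derivatives of order at most n exist and are jointly
   continuous on the open set D. *)
Fixpoint Cn2 (R : realType) (n : nat) (D : set (R * R)) (w : R -> R -> R) :
    Prop :=
  (forall p, D p -> {for p, continuous (fun q : R * R => w q.1 q.2)}) /\
  if n is m.+1 then
    [/\ forall p, D p -> derivable (w ^~ p.2) p.1 1 /\
                         derivable (w p.1) p.2 1,
        Cn2 m D (time_derive w) & Cn2 m D (space_derive w)]
  else True.

(* C^1 on [0, T] with derivative dX; the limit of difference quotients is taken
   inside [0, T], hence is one-sided at the end points. *)
Definition C1_on (R : realType) (T : R) (X dX : R -> R) : Prop :=
  (forall t, t \in `[0, T] ->
     (X s - X t) / (s - t) @[s --> within `[0, T] t^'] --> dX t) /\
  {within `[0, T], continuous dX}.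

Definition L2 (R : realType) (g : R -> R) : Prop := g \in Lfun (@mu R) 2%:E.

Definition L2norm (R : realType) (g : R -> R) : R :=
  fine ('N[@mu R]_2%:E[EFin \o g])%E.

Definition test_function (R : realType) (I : set R) (psi : R -> R) : Prop :=
  (forall n, Cn n psi) /\
  exists K : set R,
    [/\ compact K, K `<=` I & forall x, ~ K x -> psi x = 0].

Definition weak_derivative (R : realType) (g h : R -> R) : Prop :=
  [/\ locally_integrable setT g, locally_integrable setT h &
      forall psi, test_function setT psi ->
        (\int[mu]_x (g x * psi^`() x)) = - (\int[mu]_x (h x * psi x))].

(* A representative of the weak derivative (which is unique up to a null set);
   the value is meaningless if there is no weak derivative. *)
Definition wderive (R : realType) (g : R -> R) : R -> R :=
  xget (cst 0) [set h | weak_derivative g h].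

Definition H1 (R : realType) (g : R -> R) : Prop :=
  L2 g /\ exists2 h, weak_derivative g h & L2 h.

Definition H1norm (R : realType) (g : R -> R) : R :=
  Num.sqrt (L2norm g ^+ 2 + L2norm (wderive g) ^+ 2).

Definition C_H1 (R : realType) (T : R) (v : R -> R -> R) : Prop :=
  (forall t, t \in `[0, T] -> H1 (v t)) /\
  forall t, t \in `[0, T] ->
    H1norm (fun x => v s x - v t x) @[s --> within `[0, T] (nbhs t)] --> 0.

(* L^2(0,T; L^2(R)), identified with L^2((0,T) x R): the map t |-> [v t] has a
   jointly measurable, square integrable representative G. *)
Definition L2_L2 (R : realType) (T : R) (v : R -> R -> R) : Prop :=
  exists G : R * R -> R,
    G \_ (`]0, T[ `*` setT) \in Lfun (@mu R \x @mu R)%E 2%:E /\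
    {ae mu, forall t, t \in `]0, T[ -> {ae mu, forall x, v t x = G (t, x)}}.

Definition L2_H2 (R : realType) (T : R) (v : R -> R -> R) : Prop :=
  exists v1 v2 : R -> R -> R,
    [/\ {ae mu, forall t, t \in `]0, T[ ->
           weak_derivative (v t) (v1 t) /\ weak_derivative (v1 t) (v2 t)},
        L2_L2 T v, L2_L2 T v1 & L2_L2 T v2].

(* vt is the weak time derivative of v as an L^2(R)-valued map: the identity
   of Bochner integrals int theta' v dt = - int theta vt dt in L^2(R) is tested
   against every zeta in L^2(R). *)
Definition weak_time_derivative (R : realType) (T : R) (v vt : R -> R -> R) :
    Prop :=
  forall theta zeta, test_function `]0, T[ theta -> L2 zeta ->
    (\int[mu]_(t in `]0, T[) (theta^`() t * (\int[mu]_x (v t x * zeta x)))) =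
    - (\int[mu]_(t in `]0, T[) (theta t * (\int[mu]_x (vt t x * zeta x)))).

(* Strong solution of u_t + f(u)_x = u_xx on [0, T], with u - u0 in the energy
   class; u0 does not depend on time, so (u - u0)_t = u_t. *)
Definition strong_solution (R : realType) (T : R) (f u0 : R -> R)
    (u : R -> R -> R) : Prop :=
  let v := fun t x => u t x - u0 x in
  [/\ C_H1 T v, L2_H2 T v &
      exists ut : R -> R -> R,
        [/\ weak_time_derivative T v ut, L2_L2 T ut &
            {ae mu, forall t, t \in `]0, T[ -> exists ux uxx fx : R -> R,
               [/\ weak_derivative (u t) ux, weak_derivative ux uxx,
                   weak_derivative (f \o u t) fx &
                   {ae mu, forall x, ut t x + fx x = uxx x}]}]].

Definition cubic_defect (R : realType) (f : R -> R) (v : R) : R := f v - v ^+ 3.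

Definition eps_flux (R : realType) (um : R) (f : R -> R) : \bar R :=
  let q := cubic_defect f in
  (ereal_sup (range (fun v : R => (`|q^`(2) v| / (um + `|v|))%R%:E)) +
   'N[@mu R]_+oo[EFin \o q^`(3)])%E.

Definition shock_speed (R : realType) (um : R) (f : R -> R) (ul : R) : R :=
  (f um - f ul) / (um - ul).

Definition is_left_state (R : realType) (um : R) (f : R -> R) (ul : R) : Prop :=
  - (5%:R * um / 2%:R) < ul < - (3%:R * um / 2%:R) /\
  shock_speed um f ul = f^`() um.

Definition is_shock_profile (R : realType) (um : R) (f : R -> R) (ul : R)
    (uS : R -> R) : Prop :=
  [/\ Cn 2 uS,
      forall x, - shock_speed um f ul * uS^`() x + (f \o uS)^`() x = uS^`(2) x,
      uS x @[x --> -oo] --> ul,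
      uS x @[x --> +oo] --> um &
      uS 0 = (ul + um) / 2%:R].

Definition tanh (R : realType) (x : R) : R :=
  (expR x - expR (- x)) / (expR x + expR (- x)).

(* Smooth solution, for all t > 0, of the inviscid Burgers equation, continuous
   up to t = 0 where it takes the hyperbolic tangent data. *)
Definition is_burgers_wave (R : realType) (lm lp : R) (w : R -> R -> R) : Prop :=
  [/\ forall n, Cn2 n [set p : R * R | 0 < p.1] w,
      {within [set p : R * R | 0 <= p.1],
         continuous (fun p : R * R => w p.1 p.2)},
      forall t x, 0 < t ->
        time_derive w t x + w t x * space_derive w t x = 0 &
      forall x, w 0 x = (lm + lp) / 2%:R + (lp - lm) / 2%:R * tanh x].

(* u^R(t, xi) = (f')^{-1}(w^R)(1 + t, xi + sigma (1 + t)), where f' is inverted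
   on [um, up]. *)
Definition rarefaction (R : realType) (um up : R) (f : R -> R) (sigma : R)
    (w : R -> R -> R) (t xi : R) : R :=
  pinv `[um, up] (f^`()) (w (1 + t) (xi + sigma * (1 + t))).

Definition composite (R : realType) (um : R) (uS : R -> R) (uR : R -> R -> R)
    (t xi : R) : R :=
  uS xi + uR t xi - um.

Definition perturbation (R : realType) (sigma : R) (utilde u : R -> R -> R)
    (X : R -> R) (t xi : R) : R :=
  u t (xi + sigma * t - X t) - utilde t xi.

Definition alpha (R : realType) (um eta : R) : R := (5%:R - eta) * um.

(* int_0^z h(s) ds with its orientation, z being of either sign *)
Definition int0 (R : realType) (h : R -> R) (z : R) : R :=
  if 0 <= z then (\int[mu]_(s in `[0, z]) h s)
  else - (\int[mu]_(s in `[z, 0]) h s).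

Definition B_fun (R : realType) (um eta : R) (g : R -> R) (v z : R) : R :=
  (alpha um eta - v + z) * (g (v + z) - g v)
  - int0 (fun s => g (v + s) - g v) z
  - (alpha um eta - v) * g^`() v * z.

Definition A_fun (R : realType) (um eta : R) (g : R -> R) (v z : R) : R :=
  B_fun um eta g v z + 2%:R^-1 * g^`() v * z ^+ 2.

(* Y_S[V; phi]; for V = utilde(t, .) this is the functional Y(t) that drives
   the shift. *)
Definition Y_fun (R : realType) (um eta : R) (V phi : R -> R) : R :=
  (\int[mu]_x (V^`() x *
    ((alpha um eta - V x) * phi x + 2%:R^-1 * phi x ^+ 2))).

Definition D_S (R : realType) (um eta : R) (g V phi : R -> R) : R :=
  (\int[mu]_x ((alpha um eta - V x) * wderive phi x ^+ 2))
  + (\int[mu]_x (V^`() x *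
      (B_fun um eta g (V x) (phi x)
       + 2%:R^-1 * (g^`() (V x) - 2%:R * g^`() um) * phi x ^+ 2)))
  + 5%:R / um * Y_fun um eta V phi ^+ 2.

Definition D_R (R : realType) (um eta : R) (g V phi : R -> R) : R :=
  (\int[mu]_x (V^`() x *
    (B_fun um eta g (V x) (phi x) - 2%:R^-1 * g^`() (V x) * phi x ^+ 2))).

(* In Z_fun and G_fun, uS, uR, utilde and phi are the profiles at a fixed time. *)
Definition Z_fun (R : realType) (um eta : R) (uS uR utilde phi : R -> R) : R :=
  - (\int[mu]_x ((uR x - um) * uS^`() x * phi x))
  + (\int[mu]_x (uR^`() x *
      ((alpha um eta - utilde x) * phi x + 2%:R^-1 * phi x ^+ 2))).

Definition G_fun (R : realType) (um kappa eta : R) (f uS uR utilde phi : R -> R) :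
    R :=
  D_S um eta f uS phi + D_R um eta f uR phi
  - (\int[mu]_x ((uR x - um) * wderive phi x ^+ 2))
  + kappa * (Y_fun um eta uS phi + Z_fun um eta uS uR utilde phi) ^+ 2
  - 5%:R / um * Y_fun um eta uS phi ^+ 2
  + (\int[mu]_x (uS^`() x *
      (A_fun um eta f (utilde x) (phi x) - A_fun um eta f (uS x) (phi x)))).

(* Main.v *)
From Stdlib Require Import ZArith.
Require Import Defs.
From HB Require Import structures.
From mathcomp Require Import all_boot all_order all_algebra.
From mathcomp Require Import all_classical all_reals all_analysis.
From mathcomp Require Import measurable_realfun ring lra ssrZ.

(* After the change of variables in which the shock profile [V] itself, rescaled
   to [x] in [0, 1], is the independent variable, the functional attached to the
   shock alone becomes the integral of a form in [(z^2, z, m)] and the derivative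
   [psi] of the rescaled perturbation [z]; here [m] is the primitive of the
   density of [Y_S], so that [5 / um * Y_S ^ 2] is a boundary term. Adding the
   total derivative of a suitable polynomial null Lagrangian in [(x, z, m)], with
   boundary value [5 * m ^ 2] at the right end, makes this form pointwise positive
   definite with a uniform margin, already for [eta = 0] and the cubic flux. The
   margin absorbs the perturbation of the flux, [eta], the interaction terms
   (which are small with the strength of the rarefaction) and the difference
   between [kappa * Y ^ 2] and [5 / um * Y_S ^ 2], controlled by Cauchy-Schwarz.
   On the rarefaction part the density is a quadratic form in [(z, z^2)] whose
   discriminant is [eta ^ 2 - 3 * eta] at the middle state, so it is positive
   precisely because [eta > 0]. *)
Set Implicit Arguments.
Unset Strict Implicit.
Unset Printing Implicit Defensive.

Import Order.TTheory GRing.Theory Num.Theory.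
Import numFieldNormedType.Exports.

Local Open Scope classical_set_scope.
Local Open Scope ring_scope.
Delimit Scope Z_scope with coqZ.

Local Notation mu := lebesgue_measure.

(** * Certified positivity of integer polynomials *)

(** The square of [Y_S] is the square of an integral, so no pointwise inequality can see it; the
    variable [m] makes it local. The perturbation is not assumed small, so the quartic term must be
    kept: [z ^ 2] is treated as a variable independent of [z]. The change of variables is never
    performed on integrals. The null Lagrangian is evaluated along the curve formed by the
    normalised profile, [z] and [m] in the original variable, and differentiated there by the
    product rule for absolutely continuous functions. Its factor [x (1 - x)] kills the boundary
    values of the terms in [A], [B] and [D], since [z] and [m] are bounded. Smallness of the flux
    defect [q] concerns its higher derivatives and not the slope [q'(um)], which may be large; this
    slope has to cancel in each functional separately. Finally [phi] is only a class in [H1] and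
    [wderive] an arbitrary choice of weak derivative, so everything is proved for the continuous
    representative and transferred almost everywhere at the end. *)

Definition Zring (R : pzRingType) (c : Z) : R := (int_of_Z c)%:~R.

(* Integer polynomials as coefficient lists, constant term first, with a
   binary representation so that the sign certificates below compute. *)
Fixpoint zeval (R : pzRingType) (p : seq Z) (x : R) : R :=
  if p is c :: p' then Zring R c + x * zeval p' x else 0.

Fixpoint zadd (p q : seq Z) : seq Z :=
  match p, q with
  | [::], _ => q
  | _, [::] => p
  | c :: p', d :: q' => (Z.add c d) :: zadd p' q'
  end.

Definition zscale (k : Z) (p : seq Z) : seq Z := map (Z.mul k) p.

Fixpoint zmul (p q : seq Z) : seq Z :=
  if p is c :: p' then zadd (zscale c q) (Z0 :: zmul p' q) else [::].

Fixpoint zderiv (p : seq Z) : seq Z :=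
  if p is c :: p' then zadd p' (Z0 :: zderiv p') else [::].

(* [(zhom n i p).1] is the polynomial [u |-> n ^ size p * p ((i + u) / n)]. *)
Fixpoint zhom (n i : Z) (p : seq Z) : seq Z * Z :=
  if p is c :: p' then
    let: (l, w) := zhom n i p' in
    (zadd [:: Z.mul c (Z.mul n w)] (zmul [:: i; Zpos xH] l), Z.mul n w)
  else ([::], Zpos xH).

(** A lower bound on the unit interval: every power of [u] lies between 0 and 1, so only negative
    coefficients can push the value below the constant term. *)
Definition zlower (p : seq Z) : Z :=
  if p is c :: p' then Z.add c (foldr (fun d => Z.add (Z.min Z0 d)) Z0 p') else Z0.

(** On the whole interval [zlower] is too crude. On [n] equal cells, each mapped to [0, 1] by
    [zhom], it becomes sharp as [n] grows. *)
Definition zpos_on01 (n : nat) (p : seq Z) : bool :=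
  all (fun i => Z.ltb Z0 (zlower (zhom (Z.of_nat n) (Z.of_nat i) p).1)) (iota 0 n).

Lemma ZringD (R : pzRingType) c d : Zring R (Z.add c d) = Zring R c + Zring R d.
Proof. by rewrite /Zring -[(Z.add c d)]/(c + d)%R rmorphD intrD. Qed.

Lemma ZringM (R : pzRingType) c d : Zring R (Z.mul c d) = Zring R c * Zring R d.
Proof. by rewrite /Zring -[(Z.mul c d)]/(c * d)%R rmorphM intrM. Qed.

Lemma Zring0 (R : pzRingType) : Zring R Z0 = 0. Proof. by []. Qed.
Lemma Zring1 (R : pzRingType) : Zring R (Zpos xH) = 1. Proof. by []. Qed.

Lemma Zring_nat (R : pzRingType) n : Zring R (Z.of_nat n) = n%:R.
Proof. by rewrite /Zring; case: n => //= n; rewrite SuccNat2Pos.id_succ. Qed.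

Lemma Zring_ge0 (R : numDomainType) c : Z.le Z0 c -> 0 <= Zring R c.
Proof. by case: c => [|p|p] //= _; rewrite /Zring /= ?ler0z. Qed.

Lemma Zring_gt0 (R : numDomainType) c : Z.lt Z0 c -> 0 < Zring R c.
Proof.
case: c => [|p|p] //= _; rewrite /Zring /= ltr0z.
by rewrite ltz_nat; apply/ssrnat.ltP; exact: Pos2Nat.is_pos.
Qed.

Lemma zevalD (R : comPzRingType) p q (x : R) :
  zeval (zadd p q) x = zeval p x + zeval q x.
Proof.
elim: p q => [|c p IH] [|d q] //=; rewrite ?add0r ?addr0 //.
by rewrite IH ZringD mulrDr addrACA.
Qed.

Lemma zevalZ (R : comPzRingType) k p (x : R) :
  zeval (zscale k p) x = Zring R k * zeval p x.
Proof.
by elim: p => [|c p /= ->] /=; [rewrite mulr0|rewrite ZringM mulrDr mulrCA].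
Qed.

Lemma zevalM (R : comPzRingType) p q (x : R) :
  zeval (zmul p q) x = zeval p x * zeval q x.
Proof.
elim: p => [|c p IH] /=; first by rewrite mul0r.
by rewrite zevalD zevalZ /= IH Zring0 add0r mulrDl mulrA.
Qed.

Arguments zmul : simpl never.
Arguments zadd : simpl never.

Lemma zeval_hom (R : fieldType) (n i : Z) p (u : R) : Zring R n != 0 ->
  zeval (zhom n i p).1 u =
    Zring R (zhom n i p).2 * zeval p ((Zring R i + u) / Zring R n).
Proof.
move=> n0; elim: p => [|c p] /=; first by rewrite mulr0.
case: (zhom n i p) => l w /= IH.
by rewrite zevalD zevalM /= IH !ZringM Zring1; field.
Qed.

Lemma zhom_scale_gt0 (n i : Z) p : Z.lt Z0 n -> Z.lt Z0 (zhom n i p).2.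
Proof.
move=> n0; elim: p => [|c p] //=; case: (zhom n i p) => l w /= w0.
exact: Z.mul_pos_pos.
Qed.

Lemma zlower_le (R : realDomainType) p (u : R) : 0 <= u <= 1 ->
  Zring R (zlower p) <= zeval p u.
Proof.
case/andP=> u0 u1; case: p => [|c p] //=; rewrite ZringD lerD2l.
elim: p => [|d p IH] /=; first by rewrite mulr0.
rewrite ZringD mulrDr; set S := Zring R (foldr _ _ _) in IH *.
have dle : Zring R (Z.min Z0 d) <= u * Zring R d.
  case: (Z.le_gt_cases Z0 d) => [d0|/Z.lt_le_incl d0].
    by rewrite Z.min_l // mulr_ge0 // Zring_ge0.
  rewrite Z.min_r // -subr_ge0 -[X in _ - X]mul1r -mulrBl mulr_le0 ?subr_le0 //.
  by rewrite -oppr_ge0 /Zring -intrN -rmorphN (@Zring_ge0 R (Z.opp d)) // Z.opp_nonneg_nonpos.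
apply: lerD => //.
have S0 : S <= 0.
  rewrite /S -oppr_ge0 /Zring -intrN -rmorphN; apply: Zring_ge0.
  rewrite -[(- _)%R]/(Z.opp _) Z.opp_nonneg_nonpos.
  elim: (p) => [|e p' IHp] //=; apply: Z.add_nonpos_nonpos => //.
  exact: Z.le_min_l.
apply: (@le_trans _ _ (u * S)); last by rewrite ler_wpM2l.
by rewrite -subr_ge0 -[X in _ - X]mul1r -mulrBl mulr_le0 ?subr_le0.
Qed.

Lemma zpos_on01P (R : archiRealFieldType) n p (x : R) : (0 < n)%N ->
  zpos_on01 n p -> 0 <= x <= 1 -> 0 < zeval p x.
Proof.
move=> n0 /allP pos /andP[x0 x1].
have nR : 0 < n%:R :> R by rewrite ltr0n.
have [i iltn /andP[ix xi]] : exists2 i, (i < n)%N & i%:R <= x * n%:R <= i.+1%:R.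
  have [xn|xn] := ltP (x * n%:R) n%:R; last first.
    (* The end point [x = 1] belongs to the last cell, with [u = 1]. *)
    exists n.-1; first by rewrite prednK.
    rewrite prednK //; apply/andP; split; last by rewrite ler_piMl // ltW.
    by rewrite (le_trans _ xn) // ler_nat leq_pred.
  have xn0 : 0 <= x * n%:R by rewrite mulr_ge0 // ltW.
  have /andP[h1 h2] := Num.Theory.truncn_itv xn0.
  exists (Num.truncn (x * n%:R)).
    by rewrite -(ltr_nat R) (le_lt_trans h1).
  by rewrite h1 ltW.
have /pos/Z.ltb_lt/(Zring_gt0 R) : i \in iota 0 n by rewrite mem_iota.
set q := zhom _ _ _ => qpos.
have u01 : 0 <= x * n%:R - i%:R <= 1 by rewrite subr_ge0 ix lerBlDl -natr1 in xi *; lra.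
have := lt_le_trans qpos (zlower_le q.1 u01).
rewrite zeval_hom ?Zring_nat ?gt_eqF // addrC subrK mulfK ?gt_eqF //.
rewrite pmulr_rgt0 //; apply/Zring_gt0/zhom_scale_gt0.
by case: (n) n0.
Qed.

(** * The null Lagrangian *)

(* Twice the coefficients of the polynomials [A], [B], [C] of the null
   Lagrangian [9 x (1 - x) (A z^2 + D z^3 + B z m) + C m^2], with [D] = 11/64.
   They were found by semidefinite programming. *)
Definition cA : seq Z := [:: 26; -335; 1390; -2760; 2605; -925]%coqZ.
Definition cB : seq Z := [:: 42; -175; 290; -50; -340; 249]%coqZ.
Definition cC : seq Z := [:: -11; 63; -117; 15; 195; -81; -230; 176]%coqZ.

Lemma ZringP (R : pzRingType) k : Zring R (Zpos k) = (Pos.to_nat k)%:R.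
Proof. by []. Qed.
Lemma ZringN (R : pzRingType) k : Zring R (Zneg k) = - (Pos.to_nat k)%:R.
Proof. by rewrite -ZringP /Zring -intrN -rmorphN. Qed.

Definition bA (R : fieldType) (x : R) := zeval cA x / 2.
Definition bB (R : fieldType) (x : R) := zeval cB x / 2.
Definition bC (R : fieldType) (x : R) := zeval cC x / 2.
Definition dA (R : fieldType) (x : R) := zeval (zderiv cA) x / 2.
Definition dB (R : fieldType) (x : R) := zeval (zderiv cB) x / 2.
Definition dC (R : fieldType) (x : R) := zeval (zderiv cC) x / 2.
Definition bD (R : fieldType) : R := 11 / 64.

(* The partial derivatives of the null Lagrangian, where [x = (y + 2) / 3]
   for the profile variable [y]; [Lz] leaves out the factor [9 x (1 - x)]. *)
Definition Lz (R : fieldType) (x z m : R) :=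
  2 * bA x * z + 3 * bD R * z ^+ 2 + bB x * m.
Definition Ly (R : fieldType) (x z m : R) :=
  3 * ((1 - 2 * x) * (bA x * z ^+ 2 + bD R * z ^+ 3 + bB x * z * m)
       + x * (1 - x) * (dA x * z ^+ 2 + dB x * z * m))
  + dC x / 3 * m ^+ 2.
Definition Lm (R : fieldType) (x z m : R) :=
  9 * x * (1 - x) * bB x * z + 2 * bC x * m.

(** The normalisation that turns the right end value of the null Lagrangian into
    [5 / um * Y_S ^ 2]. *)
Lemma bC1 (R : numFieldType) : bC (1 : R) = 5.
Proof. by rewrite /bC /= !ZringN !ZringP /Pos.to_nat /=; field. Qed.

(** * The positivity certificate of the quadratic form *)

Definition lin2 (a b : Z) : seq Z := [:: a; b].
Definition xx1 : seq Z := [:: 0; 1; -1]%coqZ.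

Definition c12 : seq Z := lin2 1 (-2)%coqZ.
Definition c73 : seq Z := lin2 7 (-3)%coqZ.

(* 38400 times the coefficients of the quadratic form in [(z^2, z, m)],
   reduced by the margin 1/200; below, its Schur complement with respect to
   the gradient variable and then the principal minors of the latter. *)
Definition M_qq : seq Z := [:: 149 * 192]%coqZ.
Definition M_zq : seq Z :=
  zadd (zscale (99 * 100)%coqZ c12) (zadd (zscale (96 * 200 * 3)%coqZ (lin2 1 1)) (zscale (72 * 200 * 3)%coqZ (zmul xx1 cB))).
Definition M_mq : seq Z := zscale (48 * 200)%coqZ cC.
Definition M_zz : seq Z :=
  zadd (zscale (96 * 200 * 3)%coqZ (zadd (zmul c12 cA) (zmul xx1 (zderiv cA))))
  (zadd (zscale (64 * 200 * 3)%coqZ (lin2 (-33) 45)) (zadd [:: -192]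
   (zscale (72 * 200 * 12)%coqZ (zmul xx1 (zmul cB c73)))))%coqZ.
Definition M_mz : seq Z :=
  zadd (zscale (72 * 200 * 2)%coqZ (zadd (zmul c12 cB) (zmul xx1 (zderiv cB))))
       (zscale (96 * 200)%coqZ (zmul cC c73)).
Definition M_mm : seq Z := zadd (zscale (32 * 200)%coqZ (zderiv cC)) [:: -192]%coqZ.

(** The cross term with the gradient carries a factor [3 x], as does the form itself. Completing the
    square therefore lets a common [3 x] factor out; a single [x] remains in front of [v], and the
    result can be tested at [x = 0] too. *)
Definition schur (M v : seq Z) (k : Z) : seq Z :=
  zadd (zscale 4 (zmul (zadd (zscale 200 c73) [:: -1])%coqZ M)) (zscale (- 3 * k)%coqZ (zmul (lin2 0 1) v)).
Definition N_qq := schur M_qq [:: 1]%coqZ (75 * 25 * 33 * 33).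
Definition N_zq := schur M_zq cA (99 * 200 * 200).
Definition N_mq := schur M_mq cB (99 * 100 * 200).
Definition N_zz := schur M_zz (zmul cA cA) (192 * 200 * 200).
Definition N_mz := schur M_mz (zmul cA cB) (96 * 200 * 200).
Definition N_mm := schur M_mm (zmul cB cB) (48 * 200 * 200).

Definition minor (p q r s : seq Z) : seq Z :=
  zadd (zmul p q) (zscale (-1)%coqZ (zmul r s)).
Definition S_zz := minor N_qq N_zz N_zq N_zq.
Definition S_mz := minor N_qq N_mz N_zq N_mq.
Definition S_mm := minor N_qq N_mm N_mq N_mq.
Definition S_det := minor S_zz S_mm S_mz S_mz.

Lemma minors_pos : [&& zpos_on01 4 N_qq, zpos_on01 64 S_zz & zpos_on01 64 S_det].
Proof. by vm_compute. Qed.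

(** Sylvester's criterion by two successive completions of squares; multiplying by [p11] and [s22]
    avoids divisions. The last hypothesis concerns [p11] times the full determinant. *)
Lemma quad_form_ge0 (R : realFieldType) (p11 p12 p13 p22 p23 p33 q z m : R) :
  let s22 := p11 * p22 - p12 * p12 in
  let s23 := p11 * p23 - p12 * p13 in
  let s33 := p11 * p33 - p13 * p13 in
  0 < p11 -> 0 < s22 -> 0 < s22 * s33 - s23 * s23 ->
  0 <= p11 * q ^+ 2 + p22 * z ^+ 2 + p33 * m ^+ 2
       + 2 * (p12 * q * z + p13 * q * m + p23 * z * m).
Proof.
move=> s22 s23 s33 h1 h2 h3.
rewrite -(pmulr_rge0 _ h1) -(pmulr_rge0 _ h2).
have -> : s22 * (p11 * (p11 * q ^+ 2 + p22 * z ^+ 2 + p33 * m ^+ 2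
       + 2 * (p12 * q * z + p13 * q * m + p23 * z * m))) =
  s22 * (p11 * q + p12 * z + p13 * m) ^+ 2 + (s22 * z + s23 * m) ^+ 2
  + (s22 * s33 - s23 * s23) * m ^+ 2 by rewrite /s22 /s23 /s33; ring.
apply: addr_ge0; first apply: addr_ge0.
- exact: mulr_ge0 (ltW h2) (sqr_ge0 _).
- exact: sqr_ge0.
- exact: mulr_ge0 (ltW h3) (sqr_ge0 _).
Qed.

Lemma zeval_cons (R : pzRingType) c p (x : R) :
  zeval (c :: p) x = Zring R c + x * zeval p x.
Proof. by []. Qed.

Lemma zeval_nil (R : pzRingType) (x : R) : zeval [::] x = 0.
Proof. by []. Qed.

Lemma zeval_minor (R : comPzRingType) p q r s (x : R) :
  zeval (minor p q r s) x = zeval p x * zeval q x - zeval r x * zeval s x.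
Proof. by rewrite zevalD zevalZ !zevalM ZringN mulN1r. Qed.

Lemma zeval_schur (R : comPzRingType) M v k (x : R) :
  zeval (schur M v k) x = 4 * ((200 * (7 - 3 * x) - 1) * zeval M x)
                          - 3 * (Zring R k * (x * zeval v x)).
Proof.
by rewrite zevalD !zevalZ !zevalM zevalD zevalZ ZringM !zeval_cons !zeval_nil !ZringN !ZringP /Pos.to_nat /=; ring.
Qed.

(** The coefficient lists are generalised before [ring]: these are identities in arbitrary [A], [B],
    [C], whose actual values enter the positivity only through [minors_pos]. *)
Lemma zeval_M (R : comPzRingType) (x : R) (a := zeval cA x) (b := zeval cB x)
    (c := zeval cC x) (a' := zeval (zderiv cA) x) (b' := zeval (zderiv cB) x) :
  [/\ zeval M_zq x = 99 * 100 * (1 - 2 * x) + 96 * 200 * 3 * (1 + x) + 72 * 200 * 3 * (x * (1 - x) * b),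
     zeval M_mq x = 48 * 200 * c,
     zeval M_zz x = 96 * 200 * 3 * ((1 - 2 * x) * a + x * (1 - x) * a')
       + 64 * 200 * 3 * (45 * x - 33) - 192 + 72 * 200 * 12 * (x * (1 - x) * b * (7 - 3 * x)),
     zeval M_mz x = 72 * 200 * 2 * ((1 - 2 * x) * b + x * (1 - x) * b')
       + 96 * 200 * c * (7 - 3 * x) &
     zeval M_mm x = 32 * 200 * zeval (zderiv cC) x - 192].
Proof.
rewrite /M_zq /M_mq /M_zz /M_mz /M_mm {}/a {}/b {}/c {}/a' {}/b'.
move: (zderiv cA) (zderiv cB) (zderiv cC) (cA) (cB) (cC) => pa' pb' pc' pa pb pc.
rewrite /lin2 /c12 /c73 /xx1.
split; rewrite ?(zevalD, zevalZ, zevalM, zeval_cons, zeval_nil) ?ZringM ?ZringN;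
  rewrite ?ZringP ?Zring0 /Pos.to_nat /=; ring.
Qed.

Lemma zeval_M_qq (R : comPzRingType) (x : R) : zeval M_qq x = 149 * 192.
Proof.
by rewrite zeval_cons zeval_nil ZringM !ZringP mulr0 addr0 /Pos.to_nat.
Qed.

Lemma zeval_N (R : comPzRingType) (x : R) (a := zeval cA x) (b := zeval cB x)
    (S := fun M v : R => 4 * ((200 * (7 - 3 * x) - 1) * M) - 3 * v) :
  [/\ zeval N_qq x = S (zeval M_qq x) (75 * 25 * 33 * 33 * x),
      zeval N_zq x = S (zeval M_zq x) (99 * 200 * 200 * (x * a)) &
      zeval N_mq x = S (zeval M_mq x) (99 * 100 * 200 * (x * b))] /\
  [/\ zeval N_zz x = S (zeval M_zz x) (192 * 200 * 200 * (x * (a * a))),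
      zeval N_mz x = S (zeval M_mz x) (96 * 200 * 200 * (x * (a * b))) &
      zeval N_mm x = S (zeval M_mm x) (48 * 200 * 200 * (x * (b * b)))].
Proof.
rewrite /N_qq /N_zq /N_mq /N_zz /N_mz /N_mm {}/S {}/a {}/b.
move: M_qq M_zq M_mq M_zz M_mz M_mm cA cB => qq zq mq zz mz mm pa pb.
split; split; rewrite zeval_schur ?zevalM ?zeval_cons ?zeval_nil ?ZringM !ZringP;
  rewrite /Pos.to_nat /=; ring.
Qed.

(** The data at [um = 1], [eta = 0] for the pure cubic, with profile value [y = 3 x - 2]: the weight
    [5 - y] is [7 - 3 x], and the density of the shock functional is [(15 y - 3) z ^ 2 + (5 + y) z ^
    3 + 3 / 4 z ^ 4]. The factor of [Lm] is the derivative of [m] with respect to [y]. *)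
Lemma core_positivity (R : archiRealFieldType) (x psi z m : R) : 0 <= x <= 1 ->
  200^-1 * (psi ^+ 2 + 3 * x * (m ^+ 2 + z ^+ 2 + z ^+ 4)) <=
  (7 - 3 * x) * psi ^+ 2 + 3 * x * psi * Lz x z m
  + 3 * x * ((15 * (3 * x - 2) - 3) * z ^+ 2 + (3 + 3 * x) * z ^+ 3
             + 3 / 4 * z ^+ 4 + Ly x z m
             + Lm x z m * ((7 - 3 * x) * z + z ^+ 2 / 2)).
Proof.
move=> x01; have /andP[x0 x1] := x01.
have /and3P[pos_qq pos_zz pos_det] := minors_pos.
have h1 := zpos_on01P (n := 4) isT pos_qq x01; have h2 := zpos_on01P (n := 64) isT pos_zz x01.
have h3 := zpos_on01P (n := 64) isT pos_det x01.
have e_det := zeval_minor S_zz S_mm S_mz S_mz x.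
have e_zz := zeval_minor N_qq N_zz N_zq N_zq x.
have e_mz := zeval_minor N_qq N_mz N_zq N_mq x.
have e_mm := zeval_minor N_qq N_mm N_mq N_mq x.
have [[n1 n2 n3] [n4 n5 n6]] := zeval_N x.
have [m2 m3 m4 m5 m6] := zeval_M x; have m1 := zeval_M_qq x.
rewrite /Lz /Ly /Lm /bA /bB /bC /dA /dB /dC /bD.
rewrite -/S_det in e_det; rewrite -/S_zz in e_zz.
rewrite -/S_mz in e_mz; rewrite -/S_mm in e_mm.
clear pos_qq pos_zz pos_det.
move: h1 h2 h3 e_det e_zz e_mz e_mm n1 n2 n3 n4 n5 n6 m1 m2 m3 m4 m5 m6.
move: (zeval S_det x) (zeval S_zz x) (zeval S_mz x) (zeval S_mm x).
move: (zeval N_qq x) (zeval N_zq x) (zeval N_mq x) (zeval N_zz x) (zeval N_mz x).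
move: (zeval N_mm x) (zeval M_qq x) (zeval M_zq x) (zeval M_mq x) (zeval M_zz x).
move: (zeval M_mz x) (zeval M_mm x) (zeval (zderiv cA) x) (zeval (zderiv cB) x).
move: (zeval (zderiv cC) x) (zeval cA x) (zeval cB x) (zeval cC x).
move=> c' a b c Mmz Mmm a' b' Nmm Mqq Mzq Mmq Mzz Nqq Nzq Nmq Nzz Nmz Sdet Szz Smz Smm.
move=> h1 h2 h3 e_det e_zz e_mz e_mm; rewrite e_det e_mm e_mz e_zz in h3; rewrite e_zz in h2.
have := quad_form_ge0 (z ^+ 2) z m h1 h2 h3 => {h1 h2 h3 e_det e_zz e_mz e_mm}.
set form := (X in 0 <= X) => form_ge0 e1 e2 e3 e4 e5 e6 f1 f2 f3 f4 f5 f6.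
rewrite -subr_ge0; set Delta := (X in 0 <= X).
(* This multiplier clears denominators and completes the square in [psi]; what remains is [3 x]
   times the form treated by [quad_form_ge0]. *)
have at_gt0 : 0 < 4 * 200 * 192 * (200 * (7 - 3 * x) - 1) by lra.
rewrite -(pmulr_rge0 _ at_gt0).
have -> : 4 * 200 * 192 * (200 * (7 - 3 * x) - 1) * Delta =
  200 * 200 * 192 * (2 * (7 - 3 * x - 200^-1) * psi
    + 3 * x * (a * z + 33 / 64 * z ^+ 2 + b / 2 * m)) ^+ 2 + 3 * x * form.
  by rewrite /form /Delta e1 e2 e3 e4 e5 e6 f1 f2 f3 f4 f5 f6; field.
apply: addr_ge0; first by apply: mulr_ge0; [lra|exact: sqr_ge0].
by apply: mulr_ge0 => //; lra.
Qed.

(** * Smooth functions *)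

Lemma dfunD (R : realType) (f g : R -> R) (x a b : R) :
  is_derive x 1 f a -> is_derive x 1 g b -> is_derive x 1 (fun y => f y + g y) (a + b).
Proof. exact: is_deriveD. Qed.

Lemma dfunN (R : realType) (f : R -> R) (x a : R) :
  is_derive x 1 f a -> is_derive x 1 (fun y => - f y) (- a).
Proof. exact: is_deriveN. Qed.

Lemma dfunB (R : realType) (f g : R -> R) (x a b : R) :
  is_derive x 1 f a -> is_derive x 1 g b -> is_derive x 1 (fun y => f y - g y) (a - b).
Proof. exact: is_deriveB. Qed.

Lemma dfunM (R : realType) (f g : R -> R) (x a b : R) :
  is_derive x 1 f a -> is_derive x 1 g b ->
  is_derive x 1 (fun y => f y * g y) (a * g x + f x * b).
Proof.
by move=> df dg; apply: (is_derive_eq (is_deriveM df dg)); rewrite addrC mulrC.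
Qed.

Lemma dfunZ (R : realType) (f : R -> R) (x a k : R) :
  is_derive x 1 f a -> is_derive x 1 (fun y => k * f y) (k * a).
Proof. exact: is_deriveZ. Qed.

Lemma dfunX (R : realType) (f : R -> R) (x a : R) n :
  is_derive x 1 f a -> is_derive x 1 (fun y => f y ^+ n) (n%:R * f x ^+ n.-1 * a).
Proof. by move=> df; have := is_deriveX n df; rewrite exprfctE. Qed.

Lemma dfunid (R : realType) (x : R) : is_derive x 1 (fun y => y) 1.
Proof. exact: is_derive_id. Qed.

Lemma dfuncst (R : realType) (x c : R) : is_derive x 1 (fun=> c) 0.
Proof. exact: is_derive_cst. Qed.

Lemma dfun_comp (R : realType) (f g : R -> R) (x a b : R) :
  is_derive (g x) 1 f a -> is_derive x 1 g b -> is_derive x 1 (fun y => f (g y)) (a * b).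
Proof. exact: is_derive1_comp. Qed.

Lemma is_derive_cont (R : realType) (f : R -> R) (x df : R) :
  is_derive x 1 f df -> {for x, continuous f}.
Proof. by move=> [d _]; exact/differentiable_continuous/derivable1_diffP. Qed.

(** Meant for [flat] at the origin, where its two formulas meet: a quadratic error makes the
    Caratheodory slope continuous. *)
Lemma is_derive_quadratic (R : realType) (f : R -> R) (x l K : R) :
  (forall y, `|f y - f x - l * (y - x)| <= K * (y - x) ^+ 2) ->
  is_derive x 1 f l.
Proof.
move=> fK; apply/is_derive1_caratheodory.
have K0 : 0 <= K.
  have := le_trans (normr_ge0 _) (fK (x + 1)).
  by rewrite addrAC subrr add0r expr1n mulr1.
exists (fun z => if z == x then l else (f z - f x) / (z - x)).
split; last by rewrite eqxx.
  move=> z; case: eqP => [->|/eqP]; first by rewrite !subrr mulr0.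
  by rewrite -subr_eq0 => /divfK->.
apply/cvgrPdist_le => e e0; rewrite eqxx; near=> z.
case: eqP => [_|/eqP zx]; first by rewrite subrr normr0 ltW.
have zx0 : z - x != 0 by rewrite subr_eq0.
have -> : l - (f z - f x) / (z - x) = - ((f z - f x - l * (z - x)) / (z - x)).
  by field.
rewrite normrN normrM normfV ler_pdivrMr ?normr_gt0 //.
apply: (le_trans (fK z)); rewrite -real_normK ?num_real // expr2 mulrA.
rewrite ler_pM2r ?normr_gt0 //.
have zxe : `|z - x| <= e / (K + 1).
  near: z; apply/nbhs_normP; exists (e / (K + 1)) => /=.
      by rewrite divr_gt0 // ltr_wpDl.
    by move=> y /= /ltW; rewrite distrC.
apply: (le_trans (ler_wpM2l K0 zxe)).
rewrite mulrCA; apply: ler_piMr; first exact: ltW.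
by rewrite ler_pdivrMr ?ltr_wpDl // mul1r lerDl.
Unshelve. all: by end_near. Qed.

(** The functions [x ^ (- n) * exp (- 1 / x)] extended by 0. Indexing by [n] makes the linear span
    of the family closed under differentiation, so that smoothness needs no bookkeeping of
    polynomials in [1 / x]. *)
Definition flat (R : realType) (n : nat) (x : R) : R :=
  if 0 < x then x^-1 ^+ n * expR (- x^-1) else 0.

Lemma flat_ge0 (R : realType) n (x : R) : 0 <= flat n x.
Proof.
rewrite /flat; case: ifPn => // x0.
by rewrite mulr_ge0 ?expR_ge0 // exprn_ge0 // invr_ge0 ltW.
Qed.

(** From [exp y >= y ^ p / p!] at [y = 1 / x] with [p = n + k + 1]. *)
Lemma flat_le (R : realType) n k (x : R) :
  `|flat n x| <= (n + k.+1)`!%:R * `|x| ^+ k.+1.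
Proof.
rewrite ger0_norm ?flat_ge0 // /flat; case: ifPn => [x0|_]; last first.
  by rewrite mulr_ge0 // exprn_ge0.
have t0 : 0 < x^-1 by rewrite invr_gt0.
rewrite expRN ler_pdivrMr ?expR_gt0 // gtr0_norm //.
have := expR_ge1Dxn (n + k) (ltW t0); rewrite addnS.
set F := _`!%:R; set E := expR _ => h.
have F0 : 0 < F :> R by rewrite ltr0n fact_gt0.
have {}h : x^-1 ^+ (n + k).+1 / F <= E by apply: le_trans h; rewrite lerDr.
rewrite ler_pdivrMr // in h.
have -> : x^-1 ^+ n = x^-1 ^+ (n + k).+1 * x ^+ k.+1.
  by rewrite -addnS exprD -mulrA exprVn -exprMn mulVf ?expr1n ?mulr1 ?gt_eqF.
by rewrite mulrAC (mulrC F) ler_wpM2r // exprn_ge0 // ltW.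
Qed.

Lemma is_derive_flat (R : realType) n (x : R) :
  is_derive x 1 (flat n) (- n%:R * flat n.+1 x + flat n.+2 x).
Proof.
have [x0|x0|->] := ltrgt0P x.
- apply: (@near_eq_is_derive _ _ _ (fun y : R => y^-1 ^+ n * expR (- y^-1))).
    near=> y; rewrite /flat ifT //; near: y; exact: lt_nbhsr.
  have xN : x != 0 by rewrite gt_eqF.
  have dV : is_derive x 1 (fun y : R => y^-1) (- x ^- 2 *: 1).
    exact: (@is_deriveV _ id).
  have dN : is_derive x 1 (fun y : R => - y^-1) (x ^- 2).
    by apply: (is_derive_eq (dfunN dV)); rewrite /GRing.scale /= mulr1 opprK.
  have dE : is_derive x 1 (fun y : R => expR (- y^-1)) (expR (- x^-1) * x ^- 2).
    exact: (@is_derive1_comp _ expR (fun y : R => - y^-1)).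
  have dX : is_derive x 1 (fun y : R => y^-1 ^+ n) (- n%:R * x^-1 ^+ n.+1).
    apply: (is_derive_eq (dfunX n dV)); rewrite /GRing.scale /=.
    case: n => [|n]; first by rewrite mulr0n !mul0r oppr0 mul0r.
    by rewrite -[n.+1.-1]/n -mulr_natl !exprS; field.
  apply: (is_derive_eq (dfunM dX dE)).
  by rewrite /flat ?x0 /= !exprS; field.
- apply: (@near_eq_is_derive _ _ _ (cst 0)).
    near=> y; rewrite /flat ifF // le_gtF //.
    by apply: ltW; near: y; exact: lt_nbhsl.
  by rewrite /flat le_gtF ?ltW // mulr0 addr0; exact: is_derive_cst.
- rewrite /flat ltxx mulr0 addr0.
  apply: (@is_derive_quadratic _ _ _ _ (n + 2)`!%:R) => y.
  rewrite ltxx !subr0 mul0r subr0 -[(if _ then _ else _)]/(flat n y).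
  by rewrite -[in leRHS]real_normK ?num_real //; exact: flat_le.
Unshelve. all: by end_near. Qed.

(* A class of functions closed under differentiation, hence made of smooth
   functions. *)
Inductive smooth_expr (R : realType) : (R -> R) -> Prop :=
| smooth_flat n : smooth_expr (flat n)
| smooth_cst c : smooth_expr (cst c)
| smooth_add f g : smooth_expr f -> smooth_expr g -> smooth_expr (f \+ g)
| smooth_mul f g : smooth_expr f -> smooth_expr g -> smooth_expr (f \* g)
| smooth_affine c d f : smooth_expr f -> smooth_expr (fun x => f (c * x + d))
| smooth_prim (F f : R -> R) : (forall x : R, is_derive x 1 F (f x)) -> smooth_expr f ->
    smooth_expr F.

Lemma smooth_expr_derive (R : realType) (f : R -> R) : smooth_expr f ->
  exists2 df, smooth_expr df & forall x : R, is_derive x 1 f (df x).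
Proof.
elim => {f} [n|c|f g _ [df sdf Hf] _ [dg sdg Hg]|f g sf [df sdf Hf] sg [dg sdg Hg]
            |c d f _ [df sdf Hf]|F f dF sf _].
- exists (cst (- n%:R) \* flat n.+1 \+ flat n.+2) => [|x].
    do ! constructor.
  exact: is_derive_flat.
- by exists (cst 0) => [|x]; [constructor|exact: is_derive_cst].
- by exists (df \+ dg) => [|x]; [constructor|apply: is_deriveD].
- exists (f \* dg \+ g \* df) => [|x]; first by do ! constructor.
  by apply: (is_derive_eq (dfunM (Hf x) (Hg x))); rewrite addrC /= (mulrC (g x)).
- exists (cst c \* (fun x => df (c * x + d))) => [|x].
    by do ! constructor.
  have h : is_derive x 1 (fun x => c * x + d) c.
    by apply: (is_derive_eq (dfunD (dfunZ c (dfunid x)) (dfuncst x d)));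
      rewrite mulr1 addr0.
  have := @is_derive1_comp _ f (fun x => c * x + d) x _ _ (Hf _) h.
  by rewrite mulrC.
- by exists f.
Qed.

Lemma smooth_expr_Cn (R : realType) (f : R -> R) n : smooth_expr f -> Cn n f.
Proof.
have sk k (g : R -> R) : smooth_expr g -> smooth_expr (derive1n k g).
  move=> sg; elim: k => [|k IH] //=.
  have [dg sdg Hg] := smooth_expr_derive IH.
  suff -> : derive1 (derive1n k g) = dg by [].
  by apply/funext => x; rewrite derive1E derive_val.
move=> sf; split => [k x _|x].
  by have [? _ h] := smooth_expr_derive (sk k f sf); have := h x; case.
by have [? _ h] := smooth_expr_derive (sk n f sf); exact: is_derive_cont (h x).
Qed.

(** * Absolutely continuous functions *)

Lemma integ_meas (R : realType) (D : set (measurableTypeR R)) (f : R -> R) :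
  mu.-integrable D (EFin \o f) -> measurable_fun D f.
Proof. by move=> /integrableP[/measurable_EFinP]. Qed.

Lemma integD (R : realType) (D : set (measurableTypeR R)) (f g : R -> R) : measurable D ->
  mu.-integrable D (EFin \o f) -> mu.-integrable D (EFin \o g) ->
  mu.-integrable D (EFin \o (fun x => f x + g x)).
Proof. by move=> mD hf hg; have := integrableD mD hf hg. Qed.

Lemma integN (R : realType) (D : set (measurableTypeR R)) (f : R -> R) : measurable D ->
  mu.-integrable D (EFin \o f) -> mu.-integrable D (EFin \o (fun x => - f x)).
Proof. by move=> mD hf; have := integrableN hf. Qed.

Lemma integB (R : realType) (D : set (measurableTypeR R)) (f g : R -> R) : measurable D ->
  mu.-integrable D (EFin \o f) -> mu.-integrable D (EFin \o g) ->
  mu.-integrable D (EFin \o (fun x => f x - g x)).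
Proof. by move=> mD hf hg; apply: integD => //; exact: integN. Qed.

Lemma integZ (R : realType) (D : set (measurableTypeR R)) (k : R) (f : R -> R) : measurable D ->
  mu.-integrable D (EFin \o f) -> mu.-integrable D (EFin \o (fun x => k * f x)).
Proof. by move=> mD hf; exact: (integrableZl mD k hf). Qed.

Lemma integ_le (R : realType) (D : set (measurableTypeR R)) (f g : R -> R) : measurable D ->
  measurable_fun D f -> (forall x, D x -> `|f x| <= g x) ->
  mu.-integrable D (EFin \o g) -> mu.-integrable D (EFin \o f).
Proof.
move=> mD mf fg; apply: le_integrable => //; first exact/measurable_EFinP.
by move=> x Dx; rewrite /= lee_fin (le_trans (fg _ Dx)) // ler_norm.
Qed.

Lemma integM (R : realType) (D : set (measurableTypeR R)) (K : R) (f g : R -> R) : measurable D ->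
  mu.-integrable D (EFin \o f) -> measurable_fun D g ->
  (forall x, D x -> `|g x| <= K) -> mu.-integrable D (EFin \o (fun x => f x * g x)).
Proof.
move=> mD hf mg gK; apply: (@integ_le _ _ _ (fun x => K * `|f x|)) => //.
- by apply: measurable_funM => //; exact: integ_meas.
- by move=> x Dx; rewrite normrM mulrC ler_wpM2r // gK.
- by apply: integZ => //; exact: (integrable_norm hf).
Qed.

Definition ind_le (R : realType) (t s : R) : R := (t <= s)%R%:R.

(** Fubini on the half plane [t <= s], cut out by an indicator so that the domain remains a product.
    It is the source of integration by parts for absolutely continuous functions. *)
Lemma Rfubini_triangle (R : realType) (u w : R -> R) :
  mu.-integrable setT (EFin \o u) -> mu.-integrable setT (EFin \o w) ->
  \int[mu]_s (u s * \int[mu]_t (w t * ind_le t s)) =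
  \int[mu]_t (w t * \int[mu]_s (u s * ind_le t s)).
Proof.
move=> iu iw; have mu' := integ_meas iu; have mw := integ_meas iw.
pose TR : measurableType _ := measurableTypeR R.
have mle : measurable_fun (setT : set (TR * TR)) (fun p : R * R => if p.2 <= p.1 then 1 else 0 : R).
  by apply: measurable_fun_ifT => //; exact: measurable_fun_ler.
pose f (p : R * R) := u p.1 * w p.2 * ind_le p.2 p.1.
have mf : measurable_fun (setT : set (TR * TR)) f.
  apply: measurable_funM.
    by apply: measurable_funM; apply: measurableT_comp.
  rewrite (_ : (fun p : R * R => _) = (fun p => if p.2 <= p.1 then 1 else 0)) //.
  by apply/funext => p; rewrite /ind_le; case: (_ <= _).
have iE s (v : R -> R) (c : R -> R) : mu.-integrable setT (EFin \o v) ->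
    measurable_fun (setT : set TR) c -> (forall x, `|c x| <= 1) ->
    (\int[mu]_t (s * (v t * c t))%:E = (s * \int[mu]_t (v t * c t))%:E)%E.
  move=> iv mc c1.
  have ivc : mu.-integrable setT (EFin \o (fun t => v t * c t)).
    by apply: (@integM _ _ 1).
  rewrite -RintegralZl // /Rintegral fineK //; apply: integrable_fin_num => //.
  exact: integZ.
have mle1 s : measurable_fun (setT : set TR) (fun t : R => ind_le t s).
  rewrite (_ : (fun t => _) = (fun t => if t <= s then 1 else 0)).
    by apply: measurable_fun_ifT => //; exact: measurable_fun_ler.
  by apply/funext => p; rewrite /ind_le; case: (_ <= _).
have mle2 s : measurable_fun (setT : set TR) (fun t : R => ind_le s t).
  rewrite (_ : (fun t => _) = (fun t => if s <= t then 1 else 0)).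
    by apply: measurable_fun_ifT => //; exact: measurable_fun_ler.
  by apply/funext => p; rewrite /ind_le; case: (_ <= _).
have b1 (b : bool) : `|b%:R| <= 1 :> R by case: b; rewrite ?normr1 ?normr0.
have iuw s : (\int[mu]_t (f (s, t))%:E = (u s * \int[mu]_t (w t * ind_le t s))%:E)%E.
  rewrite -(iE (u s) w (fun t => ind_le t s) iw (mle1 s) (fun x => b1 _)).
  by apply: eq_integral => t _; rewrite /f mulrA.
have iwu t : (\int[mu]_s (f (s, t))%:E = (w t * \int[mu]_s (u s * ind_le t s))%:E)%E.
  rewrite -(iE (w t) u (fun s => ind_le t s) iu (mle2 t) (fun x => b1 _)).
  by apply: eq_integral => s _; rewrite /f mulrA (mulrC (w t)).
have intf : (mu \x mu)%E.-integrable setT (EFin \o f).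
  apply/integrable12ltyP; first exact/measurable_EFinP.
  apply: (@le_lt_trans _ _ (\int[mu]_x (`|u x| * \int[mu]_t `|w t|)%:E)%E).
    apply: ge0_le_integral => //=.
    - by move=> x _; exact: integral_ge0.
    - apply: (@measurable_fun_fubini_tonelli_F _ _ TR TR R mu (abse \o (EFin \o f))) => //.
        by apply: measurableT_comp => //; exact/measurable_EFinP.
      by move=> x; exact: abse_ge0.
    - by apply/measurable_EFinP/measurable_funM => //; exact: measurableT_comp.
    move=> x _; rewrite EFinM /Rintegral fineK; last first.
      exact: (integrable_fin_num _ (integrable_norm iw)).
    rewrite -ge0_integralZl //=; last first.
      by apply/measurable_EFinP; exact: measurableT_comp.
    apply: ge0_le_integral => //=.
    - apply/measurable_EFinP; apply: measurableT_comp => //.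
      apply: (@measurable_funM _ TR); last exact: mle1. 
      apply: (@measurable_funM _ TR); [exact: (measurable_cst (u x))|exact: mw].
    - apply/measurable_EFinP/measurable_funM => //; exact: measurableT_comp.
    by move=> t _; rewrite -EFinM lee_fin /f /= !normrM ler_piMr ?mulr_ge0 //; exact: b1.
  under eq_integral do rewrite mulrC EFinM.
  rewrite ge0_integralZl //=; last 2 first.
    by apply/measurable_EFinP; exact: measurableT_comp.
    by rewrite lee_fin Rintegral_ge0.
  apply: lte_mul_pinfty; rewrite ?lee_fin ?Rintegral_ge0 //.
  by case/integrableP: iu.
rewrite /Rintegral; congr fine.
have FU := Fubini intf.
transitivity (\int[mu]_s \int[mu]_t ((EFin \o f) (s, t)))%E.
  by apply: eq_integral => s _; rewrite -iuw.
by rewrite FU; apply: eq_integral => t _; rewrite -iwu.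
Qed.

(* [U] is an absolutely continuous function with density [u]. *)
Definition ac (R : realType) (u U : R -> R) : Prop :=
  (forall a b, mu.-integrable `[a, b] (EFin \o u)) /\
  forall a b, a <= b -> U b - U a = \int[mu]_(x in `[a, b]) u x.

Lemma ac_continuous (R : realType) (u U : R -> R) : ac u U -> continuous U.
Proof.
move=> [iu Uu] x.
have ab : x - 1 < x + 1 by lra.
have xab : x \in `](x - 1), (x + 1)[ by rewrite in_itv /=; apply/andP; split; lra.
have h : {for x, continuous (fun y => parameterized_integral mu (x - 1) y u)}.
  apply: within_continuous_continuous xab => //.
  exact: parameterized_integral_continuous (ltW ab) (iu _ _).
pose F y := U (x - 1) + parameterized_integral mu (x - 1) y u.
have FU y : x - 1 <= y -> F y = U y.
  by move=> xy; rewrite /F /parameterized_integral -Uu // addrC subrK.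
have cF : F y @[y --> x] --> F x by apply: cvgD; [exact: cvg_cst|exact: h].
rewrite /continuous_at -FU; last by lra.
apply: cvg_trans cF; apply: near_eq_cvg; near=> y.
by rewrite FU //; apply: ltW; near: y; apply: lt_nbhsr; lra.
Unshelve. all: by end_near. Qed.

Lemma continuous_integ (R : realType) (f : R -> R) a b : continuous f ->
  mu.-integrable `[a, b] (EFin \o f).
Proof.
move=> cf; apply: continuous_compact_integrable; first exact: segment_compact.
exact: continuous_subspaceT.
Qed.

Lemma continuous_meas (R : realType) (f : R -> R) (D : set (measurableTypeR R)) :
  measurable D -> continuous f -> measurable_fun D f.
Proof.
move=> mD cf; apply: (@measurable_funS _ _ _ _ setT) => //.
exact: continuous_measurable_fun.
Qed.

Lemma continuous_bounded_itv (R : realType) (f : R -> R) a b : continuous f ->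
  exists2 K, 0 <= K & forall x, x \in `[a, b] -> `|f x| <= K.
Proof.
move=> cf; have [ba|ab] := ltP b a.
  by exists 0 => // x; rewrite in_itv /= => /andP[h1 h2]; have := le_trans h1 h2; lra.
have [|c cab h] := @EVT_max R (fun x => `|f x|) a b ab.
  by apply: continuous_subspaceT => x; apply: cvg_norm; exact: cf.
by exists `|f c|.
Qed.

Lemma C1_ac (R : realType) (u U : R -> R) : continuous u ->
  (forall x : R, is_derive x 1 U (u x)) -> ac u U.
Proof.
move=> cu dU; split => a b; first exact: continuous_integ.
rewrite le_eqVlt => /predU1P[->|ab]; first by rewrite subrr set_itv1 Rintegral_set1.
have cU x : {for x, continuous U} := is_derive_cont (dU x).
rewrite /Rintegral (@continuous_FTC2 _ u U) //.
- exact: continuous_subspaceT.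
- split => [x _|//|//]; first by have := dU x; case.
  + by apply: cvg_at_right_filter; exact: cU.
  + by apply: cvg_at_left_filter; exact: cU.
- by move=> x _; rewrite derive1E derive_val.
Qed.

Lemma ac_D (R : realType) (u U w W : R -> R) : ac u U -> ac w W ->
  ac (fun x => u x + w x) (fun x => U x + W x).
Proof.
move=> [iu Uu] [iw Ww]; split => a b; first by apply: integD.
by move=> ab; rewrite RintegralD // -Uu // -Ww //; ring.
Qed.

Lemma ac_Z (R : realType) (u U : R -> R) k : ac u U ->
  ac (fun x => k * u x) (fun x => k * U x).
Proof.
move=> [iu Uu]; split => a b; first by apply: integZ.
by move=> ab; rewrite RintegralZl // -Uu //; ring.
Qed.

Lemma ac_B (R : realType) (u U w W : R -> R) : ac u U -> ac w W ->
  ac (fun x => u x - w x) (fun x => U x - W x).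
Proof.
move=> [iu Uu] [iw Ww]; split => a b; first by apply: integB.
by move=> ab; rewrite RintegralB // -Uu // -Ww //; ring.
Qed.

Lemma Rintegral_sub_itv (R : realType) (u : R -> R) a b c d :
  a <= c -> d <= b ->
  \int[mu]_t ((u \_ `[a, b]) t * (if (c <= t) && (t <= d) then 1 else 0)) =
  \int[mu]_(t in `[c, d]) u t.
Proof.
move=> ac db; rewrite [RHS]Rintegral_mkcond; apply: eq_Rintegral => t _.
rewrite !patchE !mem_setE !in_itv /=; case: (boolP (_ && (t <= d))) => [/andP[ct td]|_].
  by rewrite (le_trans ac ct) (le_trans td db) mulr1.
by rewrite mulr0.
Qed.

(** With [W s - W a] and [U b - U s] written as integrals, Fubini on the triangle [a <= t <= s <= b]
    identifies the integral of [u * (W - W a)] with that of [w * (U b - U)]; expanding both gives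
    the product rule. *)
Lemma ac_M (R : realType) (u U w W : R -> R) : ac u U -> ac w W ->
  ac (fun x => u x * W x + U x * w x) (fun x => U x * W x).
Proof.
move=> acu acw; have cU := ac_continuous acu; have cW := ac_continuous acw.
have [iu Uu] := acu; have [iw Ww] := acw.
have iuV v (V : R -> R) a b : continuous V -> mu.-integrable `[a, b] (EFin \o v) ->
    mu.-integrable `[a, b] (EFin \o (fun x => v x * V x)).
  move=> cV iv; have [K K0 VK] := continuous_bounded_itv a b cV.
  by apply: (@integM _ _ K) => //; exact: continuous_meas.
have iUw a b : mu.-integrable `[a, b] (EFin \o (fun x => U x * w x)).
  by rewrite (_ : (fun x => _) = (fun x => w x * U x));
    [exact: iuV|apply/funext => x; rewrite mulrC].
split => a b; first by apply: integD => //; exact: iuV.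
move=> ab.
have mab : measurable (`[a, b] : set (measurableTypeR R)) by [].
have rest v : mu.-integrable `[a, b] (EFin \o v) ->
    mu.-integrable setT (EFin \o (v \_ `[a, b])).
  by move=> iv; rewrite -restrict_EFin; exact: (integrable_mkcond _ mab).1 iv.
have := Rfubini_triangle (rest _ (iu a b)) (rest _ (iw a b)).
have -> : \int[mu]_s ((u \_ `[a, b]) s * \int[mu]_t ((w \_ `[a, b]) t * ind_le t s)) =
    \int[mu]_(s in `[a, b]) (u s * (W s - W a)).
  rewrite [RHS]Rintegral_mkcond; apply: eq_Rintegral => s _.
  rewrite !patchE !mem_setE; case: ifPn => [|_]; last by rewrite mul0r.
  rewrite in_itv /= => /andP[sa sb]; congr (_ * _).
  rewrite Ww // -(@Rintegral_sub_itv _ w a b a s) //; apply: eq_Rintegral => t _.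
  rewrite !patchE !mem_setE /ind_le in_itv /=; case: (leP a t) => //= at_;
    case: (t <= s); rewrite ?mulr1 ?mulr0 ?mul0r //.
have -> : \int[mu]_t ((w \_ `[a, b]) t * \int[mu]_s ((u \_ `[a, b]) s * ind_le t s)) =
    \int[mu]_(s in `[a, b]) (w s * (U b - U s)).
  rewrite [RHS]Rintegral_mkcond; apply: eq_Rintegral => s _.
  rewrite !patchE !mem_setE; case: ifPn => [|_]; last by rewrite mul0r.
  rewrite in_itv /= => /andP[sa sb]; congr (_ * _).
  rewrite Uu // -(@Rintegral_sub_itv _ u a b s b) //; apply: eq_Rintegral => t _.
  rewrite !patchE !mem_setE /ind_le in_itv /=; case: (leP t b) => //= tb;
    rewrite ?andbF ?andbT; case: (s <= t); rewrite ?mulr1 ?mulr0 ?mul0r //.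
under eq_Rintegral do rewrite mulrBr.
under [in X in _ = X]eq_Rintegral do rewrite mulrBr.
have cc (c : R) : continuous (fun _ : R => c) by move=> x; exact: cvg_cst.
rewrite RintegralB ?iuV // RintegralB ?iuV //.
rewrite (RintegralD mab (iuV u W a b cW (iu a b)) (iUw a b)).
rewrite (RintegralZr (W a) mab (iu a b)) (RintegralZr (U b) mab (iw a b)) -Uu // -Ww //.
have -> : \int[mu]_(x in `[a, b]) (U x * w x) = \int[mu]_(x in `[a, b]) (w x * U x).
  by apply: eq_Rintegral => x _; rewrite mulrC.
set X := \int[mu]_(x in _) _; set Y := \int[mu]_(x in _) _ => h.
by rewrite -(subrK ((U b - U a) * W a) X) h; ring.
Qed.

Lemma ac_X (R : realType) (u U : R -> R) n : ac u U ->
  ac (fun x => n%:R * U x ^+ n.-1 * u x) (fun x => U x ^+ n).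
Proof.
move=> acu; elim: n => [|n IH].
  rewrite (_ : (fun x => _) = fun=> 0); last by apply/funext => x; rewrite !mul0r.
  by apply: C1_ac => x; [exact: cvg_cst|exact: dfuncst].
have := ac_M acu IH; congr (ac _ _); apply/funext => x; last by rewrite exprS.
case: n {IH} => [|n]; first by rewrite !expr0; ring.
by rewrite -[n.+2.-1]/n.+1 -[n.+1.-1]/n -[n.+2]addn1 natrD !exprS; ring.
Qed.

(** * Translations of the real line *)

Lemma meas_shift (R : realType) (s : R) :
  measurable_fun (setT : set (measurableTypeR R)) (fun x : R => x + s).
Proof. by apply: measurable_funD => //; exact: measurable_id. Qed.

Lemma pushforward_shift (R : realType) (s : R) (A : set (measurableTypeR R)) :
  measurable A ->
  pushforward mu ((fun x => x + s) : _ -> measurableTypeR R) A = mu A.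
Proof.
move=> mA; apply/esym/(@lebesgue_measure_unique _ (pushforward mu (_ : _ -> measurableTypeR R))) => //=; first exact: meas_shift.
move=> _ _ [[a b] _ <-].
rewrite /pushforward.
have -> : (fun x : R => x + s) @^-1` `](a, b).1, (a, b).2]%classic =
    `](a - s), (b - s)]%classic.
  rewrite predeqE => t /=; rewrite !in_itv /= ltrBlDr lerBrDr; exact: iff_refl.
rewrite !lebesgue_measure_itv /= !lte_fin ltrD2r; case: ifPn => // _.
by congr EFin; ring.
Qed.

Lemma integ_shift (R : realType) (f : R -> R) (s : R) :
  mu.-integrable setT (EFin \o f) ->
  mu.-integrable setT (EFin \o (fun x => f (x + s))) /\
  \int[mu]_x f (x + s) = \int[mu]_x f x.
Proof.
move=> itf; have mf := integ_meas itf.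
have mfs : measurable_fun (setT : set (measurableTypeR R)) (fun x => f (x + s)).
  exact: (measurableT_comp mf (meas_shift s)).
have its : mu.-integrable setT (EFin \o (fun x => f (x + s))).
  apply/integrableP; split; first exact/measurable_EFinP.
  case/integrableP: itf => _; apply: le_lt_trans.
  have -> : (\int[mu]_x `|(EFin \o (fun x : R => f (x + s)%R)) x| =
     \int[pushforward mu ((fun x => x + s)%R : _ -> measurableTypeR R)]_x `|(f x)%:E|)%E.
    rewrite ge0_integral_pushforward //=; first exact: meas_shift.
    by apply/measurable_EFinP; exact: measurableT_comp.
  rewrite le_eqVlt; apply/orP; left; apply/eqP.
  apply: eq_measure_integral; first exact: meas_shift.
  by move=> ? A mA _; exact: pushforward_shift.
split => //.
rewrite /Rintegral; congr fine.
have := @integral_pushforward _ _ (measurableTypeR R) (measurableTypeR R) R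
  (fun x => x + s) (meas_shift s) mu setT (EFin \o f).
rewrite preimage_setT => <- //; last exact/measurable_EFinP.
apply: eq_measure_integral; first exact: meas_shift.
by move=> ? A mA _; exact: pushforward_shift.
Qed.

Lemma ae_shift (R : realType) (s : R) (P : R -> Prop) :
  {ae mu, forall x, P x} -> {ae mu, forall x, P (x + s)}.
Proof.
move=> [N [mN N0 PN]]; exists ((fun x => x + s) @^-1` N); split.
- by rewrite -[X in measurable X]setTI; exact: meas_shift.
- by rewrite -N0 -(pushforward_shift s mN).
- by move=> x /= nP; exact: PN.
Qed.

Lemma ac_shift (R : realType) (u U : R -> R) s : ac u U ->
  ac (fun x => u (x + s)) (fun x => U (x + s)).
Proof.
move=> [iu Uu].
have rest a b : mu.-integrable setT (EFin \o (u \_ `[a, b])).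
  by rewrite -restrict_EFin; exact: (integrable_mkcond _ _).1 (iu a b).
have E a b : (fun x => (u \_ `[a + s, b + s]) (x + s)) = (fun x => u (x + s)) \_ `[a, b].
  by apply/funext => x; rewrite !patchE !mem_setE !in_itv /= !lerD2r.
split => a b.
  apply/(integrable_mkcond _ _).2 => //.
  by rewrite restrict_EFin -E; have [] := integ_shift s (rest (a + s) (b + s)).
move=> ab; rewrite Uu ?lerD2r // Rintegral_mkcond [RHS]Rintegral_mkcond.
by have [_ <-] := integ_shift s (rest (a + s) (b + s)); rewrite E.
Qed.

(** * Weak derivatives *)

Lemma loc_integ (R : realType) (g : R -> R) a b : locally_integrable setT g ->
  mu.-integrable `[a, b] (EFin \o g).
Proof.
move=> [mg _ ig]; apply/integrableP; split.
  by apply/measurable_EFinP; exact: measurable_funS mg.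
by apply: ig => //; exact: segment_compact.
Qed.

Lemma integ_loc (R : realType) (g : R -> R) :
  measurable_fun (setT : set (measurableTypeR R)) g ->
  (forall a b, mu.-integrable `[a, b] (EFin \o g)) -> locally_integrable setT g.
Proof.
move=> mg ig; split; [by []|exact: openT|] => K _ cK.
have [M [_ KM]] := compact_bounded cK.
have KN : K `<=` `[- (M + 1), M + 1]%classic.
  move=> x Kx; have xM : `|x| <= M + 1 by apply: (KM (M + 1)) => //; rewrite ltrDl.
  by rewrite /= in_itv /= -ler_norml.
have /integrableP[_] := ig (- (M + 1)) (M + 1).
apply: le_lt_trans; apply: ge0_subset_integral => //=; first exact: compact_measurable.
apply/measurable_EFinP; apply: measurableT_comp => //; exact: measurable_funS mg.
Qed.

Lemma ac_loc (R : realType) (u U : R -> R) :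
  measurable_fun (setT : set (measurableTypeR R)) u -> ac u U ->
  locally_integrable setT u.
Proof. by move=> mu' [iu _]; exact: integ_loc. Qed.

Lemma continuous_loc (R : realType) (U : R -> R) : continuous U ->
  locally_integrable setT U.
Proof.
move=> cU; apply: integ_loc; first exact: continuous_meas.
by move=> a b; exact: continuous_integ.
Qed.

Lemma Rintegral_supp (R : realType) (f : R -> R) a b :
  (forall x, x \notin `[a, b] -> f x = 0) ->
  \int[mu]_x f x = \int[mu]_(x in `[a, b]) f x.
Proof.
move=> f0; rewrite [RHS]Rintegral_mkcond; apply: eq_Rintegral => x _.
by rewrite patchE mem_setE; case: ifPn => // /f0.
Qed.

Lemma ae_eq_Rintegral (R : realType) (D : set (measurableTypeR R)) (f g : R -> R) :
  measurable D -> measurable_fun D f -> measurable_fun D g ->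
  {ae mu, forall x, f x = g x} -> \int[mu]_(x in D) f x = \int[mu]_(x in D) g x.
Proof.
move=> mD mf mg fg; rewrite /Rintegral; congr fine.
apply: ae_eq_integral => //; try exact/measurable_EFinP.
move: fg; apply: filterS; first exact: (ae_filter_ringOfSetsType mu).
by move=> x fx _; rewrite /= fx.
Qed.

Lemma test_function_supp (R : realType) (psi : R -> R) : test_function setT psi ->
  exists2 M, 0 <= M & forall x, x \notin `[- M, M] -> psi x = 0 /\ derive1 psi x = 0.
Proof.
move=> [_ [K [cK _ K0]]].
have [M [_ KM]] := compact_bounded cK.
exists (`|M| + 1); first by rewrite addr_ge0.
have out x : x \notin `[- (`|M| + 1), `|M| + 1] -> psi x = 0.
  move=> xM; apply: K0 => Kx; move/negP: xM; apply.
  rewrite in_itv /= -ler_norml; apply: (KM _ _ _ Kx).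
  by rewrite (le_lt_trans (ler_norm M)) // ltrDl.
move=> x xM; split; first exact: out.
rewrite derive1E; apply: derive_val; apply: (@near_eq_is_derive _ _ _ (cst 0)).
  set m := `|M| + 1 in out xM *.
  have : \forall y \near x, y \notin `[- m, m].
    move: xM; rewrite in_itv /= negb_and -!ltNge => /orP[xl|xr]; near=> y;
      rewrite in_itv /= negb_and -!ltNge; apply/orP.
      by left; near: y; exact: lt_nbhsl.
    by right; near: y; exact: lt_nbhsr.
  by apply: filterS => y /out ->.
Unshelve. all: by end_near. Qed.

Lemma test_function_ac (R : realType) (psi : R -> R) : test_function setT psi ->
  [/\ continuous psi, continuous (derive1 psi) & ac (derive1 psi) psi].
Proof.
move=> [sm _].
have d (x : R) : is_derive x 1 psi (derive1 psi x).
  by rewrite derive1E; apply: derivableP; exact: (sm 1%N).1 0%N x _.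
have c : continuous (derive1 psi) by case: (sm 1%N).
split => //; last exact: C1_ac.
by move=> x; exact: is_derive_cont (d x).
Qed.

Lemma ac_weak (R : realType) (u U : R -> R) :
  measurable_fun (setT : set (measurableTypeR R)) u -> ac u U ->
  weak_derivative U u.
Proof.
move=> mu' acu; have cU := ac_continuous acu.
split; [exact: continuous_loc|exact: ac_loc acu|] => psi tpsi.
have [M M0 out] := test_function_supp tpsi.
have [cpsi cdpsi acpsi] := test_function_ac tpsi.
(* The interval is enlarged by 1 so that [psi] vanishes at its end points, not merely outside it. *)
rewrite (@Rintegral_supp _ _ (- (M + 1)) (M + 1)); last first.
  move=> x xM; have [|_ ->] := out x; last by rewrite mulr0.
  by apply: contraNN xM; rewrite !in_itv /= => /andP[? ?]; apply/andP; split; lra.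
rewrite [in RHS](@Rintegral_supp _ _ (- (M + 1)) (M + 1)); last first.
  move=> x xM; have [|-> _] := out x; last by rewrite mulr0.
  by apply: contraNN xM; rewrite !in_itv /= => /andP[? ?]; apply/andP; split; lra.
have [_ /(_ (- (M + 1)) (M + 1))] := ac_M acu acpsi.
have [-> _] : psi (M + 1) = 0 /\ True.
  by split => //; apply: (out _ _).1; rewrite in_itv /= negb_and; apply/orP; right; lra.
have [-> _] : psi (- (M + 1)) = 0 /\ True.
  by split => //; apply: (out _ _).1; rewrite in_itv /= negb_and; apply/orP; left; lra.
rewrite !mulr0 subrr => E; have {E} := E ltac:(lra).
have mD : measurable (`[- (M + 1), M + 1] : set (measurableTypeR R)) by [].
have [iu _] := acu.
rewrite RintegralD //.
- by move=> /eqP; rewrite eq_sym addrC addr_eq0 => /eqP.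
- have [K K0 pK] := continuous_bounded_itv (- (M + 1)) (M + 1) cpsi.
  by apply: (@integM _ _ K) => //; exact: continuous_meas.
- apply: continuous_integ => x; apply: cvgM; [exact: cU|exact: cdpsi].
Qed.

(** * Mollifiers and the du Bois-Reymond lemma *)

Definition bump (R : realType) : R -> R :=
  (fun x => flat 0 (1 * x + 1)) \* (fun x => flat 0 (- 1 * x + 1)).

Lemma flat0_le1 (R : realType) (x : R) : flat 0 x <= 1.
Proof.
rewrite /flat; case: ifPn => // x0.
by rewrite expr0 mul1r -expR0 ler_expR oppr_le0 invr_ge0 ltW.
Qed.

Lemma smooth_bump (R : realType) : smooth_expr (@bump R).
Proof. by apply: smooth_mul; apply: smooth_affine; exact: smooth_flat. Qed.

Lemma bump_continuous (R : realType) : continuous (@bump R).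
Proof.
have [df _ h] := smooth_expr_derive (smooth_bump R).
by move=> x; exact: is_derive_cont (h x).
Qed.

Lemma bump_itv (R : realType) (x : R) : 0 <= bump x <= 1.
Proof.
rewrite /bump /= mulr_ge0 ?flat_ge0 //=.
by apply: mulr_ile1; rewrite ?flat_ge0 ?flat0_le1.
Qed.

Lemma bump_out (R : realType) (x : R) : 1 <= `|x| -> bump x = 0.
Proof.
rewrite ler_normr /bump /= /flat => /orP[] h.
  by rewrite [X in _ * X]ifF ?mulr0 // le_gtF //; lra.
by rewrite ifF ?mul0r // le_gtF //; lra.
Qed.

Lemma bump_gt0 (R : realType) (x : R) : `|x| < 1 -> 0 < bump x.
Proof.
rewrite ltr_norml => /andP[h1 h2]; rewrite /bump /= /flat.
have -> : 0 < 1 * x + 1 by lra.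
have -> : 0 < - 1 * x + 1 by lra.
by rewrite !expr0 !mul1r mulr_gt0 // expR_gt0.
Qed.

Lemma ac_int0 (R : realType) (h : R -> R) :
  (forall a b, mu.-integrable `[a, b] (EFin \o h)) -> ac h (int0 h).
Proof.
move=> ih.
pose I a b := \int[mu]_(x in `[a, b]) h x.
have chasles a b c : a <= b -> b <= c -> I a c = I a b + I b c.
  move=> ab bc; apply/eqP; rewrite addrC -subr_eq; apply/eqP.
  rewrite /I Rintegral_itvB ?bnd_simp // Rintegral_itv_obnd_cbnd //.
  by apply: integrableS (ih b c) => //; apply: subset_itvr; rewrite bnd_simp.
split => // a b ab; rewrite /int0.
rewrite -/(I a b); case: (leP 0 a) => a0; case: (leP 0 b) => b0.
- by rewrite -!/(I _ _) (chasles 0 a b) // addrC addKr.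
- by have := lt_le_trans b0 (le_trans a0 ab); rewrite ltxx.
- by rewrite -!/(I _ _) (chasles a 0 b) ?(ltW a0) // opprK addrC.
- by rewrite -!/(I _ _) (chasles a b 0) ?(ltW b0) //; ring.
Qed.

Lemma ac_derive (R : realType) (u U : R -> R) (x : R) :
  continuous u -> ac u U -> is_derive x 1 U (u x).
Proof.
move=> cu [iu eU].
have ax : x - 1 < x by lra.
have xu : x < x + 1 by lra.
have [dI eI] := continuous_FTC1_closed xu (iu _ _) ax (cu x).
apply: (@near_eq_is_derive _ _ _ (fun y => U (x - 1) + \int[mu]_(t in `[x - 1, y]) u t)).
  near=> y; rewrite -eU; first by rewrite addrC subrK.
  by apply: ltW; near: y; exact: lt_nbhsr.
have := dfunD (dfuncst x (U (x - 1))) (derivableP dI).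
by rewrite -derive1E eI add0r.
Unshelve. all: by end_near. Qed.

(** The mass [K] of [bump] is not normalised: the mollifiers carry it along, and it cancels when the
    values at two points are compared. *)
Lemma smooth_step (R : realType) : exists (H : R -> R) (K : R),
  [/\ 0 < K, smooth_expr H, forall x : R, is_derive x 1 H (bump x),
      forall x, x <= - 1 -> H x = 0 & forall x, 1 <= x -> H x = K].
Proof.
have ib a b : mu.-integrable `[a, b] (EFin \o @bump R).
  by apply: continuous_integ; exact: bump_continuous.
pose F := int0 (@bump R); have acF : ac (@bump R) F := ac_int0 ib.
have dF (x : R) : is_derive x 1 F (bump x) := ac_derive x (@bump_continuous R) acF.
have ac_F := C1_ac (@bump_continuous R) dF.
have F_le a b : a <= b -> F a <= F b.
  move=> ab; rewrite -subr_ge0 ac_F.2 //; apply: Rintegral_ge0 => x _.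
  by have /andP[] := bump_itv x.
have F_eq a b : a <= b -> b <= -1 \/ 1 <= a -> F a = F b.
  move=> ab h; apply/eqP; rewrite eq_sym -subr_eq0 ac_F.2 //; apply/eqP.
  rewrite (@eq_Rintegral _ _ _ _ _ (cst 0)) ?Rintegral_cst ?mul0r // => x.
  rewrite inE /= in_itv /= => /andP[ax xb]; apply: bump_out.
  rewrite ler_normr; case: h => h; apply/orP; [right|left]; lra.
exists (fun x => F x - F (- 1)), (F 1 - F (- 1)); split.
- rewrite subr_gt0.
  have h2 : - 2^-1 < 2^-1 :> R by lra.
  have [|c] := @MVT R F (@bump R) (- 2^-1) 2^-1 h2 (fun x _ => dF x).
    by apply: continuous_subspaceT => x; exact: is_derive_cont (dF x).
  rewrite in_itv /= => /andP[c1 c2] e.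
  apply: (@le_lt_trans _ _ (F (- 2^-1))); first by apply: F_le; lra.
  apply: (@lt_le_trans _ _ (F 2^-1)); last by apply: F_le; lra.
  rewrite -subr_gt0 e; apply: mulr_gt0; last by lra.
  by apply: bump_gt0; rewrite ltr_norml; apply/andP; split; lra.
- apply: smooth_add; last exact: smooth_cst.
  by apply: smooth_prim (smooth_bump R).
- by move=> x; have := dfunB (dF x) (dfuncst x (F (- 1))); rewrite subr0.
- by move=> x x1; rewrite (F_eq x (- 1)) ?subrr //; left.
- by move=> x x1; rewrite (F_eq 1 x) //; right.
Unshelve. all: by end_near. Qed.

Lemma lebesgue_pt_near (R : realType) (g : R -> R) a eta : lebesgue_pt g a -> 0 < eta ->
  \forall r \near (0 : R)^'+,
    (\int[mu]_(y in ball a r) `|g y - g a|%:E <= (eta * r)%:E)%E.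
Proof.
move=> ga eta0.
have h : \forall r \near (0 : R)^'+, (davg g a r < (eta / 2)%:E)%E.
  apply: (ga [set y : \bar R | (y < (eta / 2)%:E)%E]); apply: open_nbhs_nbhs; split; first exact: open_ereal_lt_ereal.
  by rewrite /= lte_fin divr_gt0.
near=> r; have r0 : 0 < r by [].
have : (davg g a r < (eta / 2)%:E)%E by near: r.
rewrite /davg /iavg lebesgue_measure_ball ?(ltW r0) // inver mulrn_eq0 /= gt_eqF //.
move=> /ltW; rewrite lee_pdivrMl ?mulrn_wgt0 // -EFinM.
rewrite (_ : r *+ 2 * (eta / 2) = eta * r); last by rewrite -mulr_natr; field.
by [].
Unshelve. all: by end_near. Qed.

Definition mollifier (R : realType) (a e x : R) : R := e^-1 * bump (e^-1 * x + - (a / e)).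

Lemma mollifier_continuous (R : realType) (a e : R) : continuous (mollifier a e).
Proof.
move=> x; apply: cvgM; first exact: cvg_cst.
apply: (@continuous_comp _ _ _ (fun x => e^-1 * x + - (a / e)) (@bump R)).
  by apply: cvgD; [apply: cvgM; [exact: cvg_cst|exact: cvg_id]|exact: cvg_cst].
exact: bump_continuous.
Qed.

Lemma mollifier_out (R : realType) (a e x : R) : 0 < e ->
  x \notin `[a - e, a + e] -> mollifier a e x = 0.
Proof.
move=> e0 xa; rewrite /mollifier bump_out ?mulr0 //.
have -> : e^-1 * x + - (a / e) = (x - a) / e by field; rewrite gt_eqF.
rewrite normrM normfV (gtr0_norm e0) ler_pdivlMr // mul1r ler_normr.
move: xa; rewrite in_itv /= negb_and -!ltNge => /orP[] h; apply/orP; [right|left]; lra.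
Qed.

Lemma is_derive_step (R : realType) (H : R -> R) (a e x : R) :
  (forall x : R, is_derive x 1 H (bump x)) ->
  is_derive x 1 (fun x => H (e^-1 * x + - (a / e))) (mollifier a e x).
Proof.
move=> dH.
have h : is_derive x 1 (fun x => e^-1 * x + - (a / e)) e^-1.
  by apply: (is_derive_eq (dfunD (dfunZ _ (dfunid x)) (dfuncst x _))); rewrite mulr1 addr0.
by apply: (is_derive_eq (dfun_comp (dH _) h)); rewrite mulrC.
Qed.

Lemma mollifier_cvg (R : realType) (H g : R -> R) (K a eta : R) :
  (forall x : R, is_derive x 1 H (bump x)) -> (forall x, x <= - 1 -> H x = 0) ->
  (forall x, 1 <= x -> H x = K) ->
  locally_integrable setT g -> lebesgue_pt g a -> 0 < eta ->
  \forall e \near (0 : R)^'+,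
    `|\int[mu]_x (g x * mollifier a e x) - K * g a| <= eta.
Proof.
move=> dH H0 HK lg ga eta0.
have eta2 : 0 < eta / 2 by rewrite divr_gt0.
have pt := lebesgue_pt_near ga eta2.
have [d d0 hd] : exists2 d, 0 < d & forall r, 0 < r -> r < d ->
    (\int[mu]_(y in ball a r) `|g y - g a|%:E <= (eta / 2 * r)%:E)%E.
  case: pt => d /= d0 hd; exists d => // r r0 rd; apply: (hd r) => //=.
  by rewrite sub0r normrN gtr0_norm.
near=> e; have e0 : 0 < e by [].
(* The radius is [2 * e] because the closed support [[a - e, a + e]] does not fit in the open ball
   of radius [e]. *)
have ed : 2 * e < d.
  by rewrite -ltr_pdivlMl //; near: e; apply: nbhs_right_lt; rewrite mulr_gt0.
have e2 : 0 < 2 * e by rewrite mulr_gt0.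
have {hd}hd := hd (2 * e) e2 ed.
rewrite (@Rintegral_supp _ _ (a - e) (a + e)); last first.
  by move=> x xa; rewrite mollifier_out ?mulr0.
have aea : a - e <= a + e by lra.
have cm := @mollifier_continuous R a e.
have im : \int[mu]_(x in `[a - e, a + e]) mollifier a e x = K.
  rewrite -(C1_ac cm (fun x => @is_derive_step _ H a e x dH)).2 //.
  have -> : e^-1 * (a + e) + - (a / e) = 1 by field; exact: lt0r_neq0.
  have -> : e^-1 * (a - e) + - (a / e) = - 1 by field; exact: lt0r_neq0.
  by rewrite HK // H0 // subr0.
have ig := loc_integ (a - e) (a + e) lg.
have mb x : `|mollifier a e x| <= e^-1.
  have ei : 0 <= e^-1 by rewrite invr_ge0 ltW.
  rewrite /mollifier normrM (ger0_norm ei) ler_piMr //.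
  by have /andP[b0 b1] := bump_itv (e^-1 * x + - (a / e)); rewrite ger0_norm.
have mD : measurable (`[a - e, a + e] : set (measurableTypeR R)) by [].
have igm : mu.-integrable `[a - e, a + e] (EFin \o (fun x => g x * mollifier a e x)).
  by apply: (@integM _ _ e^-1) => //; exact: continuous_meas.
have icm : mu.-integrable `[a - e, a + e] (EFin \o (fun x => g a * mollifier a e x)).
  by apply: integZ => //; exact: continuous_integ.
rewrite -im mulrC -RintegralZl //; last exact: continuous_integ.
rewrite -RintegralB //.
apply: (le_trans (le_normr_Rintegral _ _)) => //; first exact: integB.
have igg : mu.-integrable `[a - e, a + e] (EFin \o (fun x => g x - g a)).
  by apply: integB => //; apply: continuous_integ => x; exact: cvg_cst.
have ign : mu.-integrable `[a - e, a + e] (EFin \o (fun x => `|g x - g a|)).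
  exact: (integrable_norm igg).
apply: (@le_trans _ _ (\int[mu]_(x in `[a - e, a + e]) (e^-1 * `|g x - g a|))).
  apply: le_Rintegral => //.
  - exact: (integrable_norm (integB mD igm icm)).
  - exact: integZ.
  - by move=> x _; rewrite -mulrBl normrM mulrC ler_wpM2r.
rewrite RintegralZl // ler_pdivrMl // -lee_fin /Rintegral fineK; last first.
  exact: integrable_fin_num.
have mg : measurable_fun (setT : set (measurableTypeR R)) g by case: lg.
apply: (@le_trans _ _ (\int[mu]_(y in ball a (2 * e)) `|g y - g a|%:E)%E).
  apply: ge0_subset_integral => //=.
  - exact: measurable_ball.
  - apply/measurable_EFinP; apply: measurableT_comp => //.
    by apply: measurable_funB => //; exact: measurable_funS mg.
  - move=> x /=; rewrite in_itv /= => /andP[h1 h2]; rewrite /ball /= ltr_norml.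
    by apply/andP; split; lra.
apply: (le_trans hd); rewrite lee_fin; lra.
Unshelve. all: by end_near. Qed.

Lemma ae_exists (R : realType) (P : R -> Prop) : {ae mu, forall x, P x} -> exists x, P x.
Proof.
move=> [N [mN N0 PN]]; apply: contrapT => nP.
have NT : N = setT by apply/seteqP; split => // x _; apply: PN => Px; apply: nP; exists x.
have : mu (`]-oo, +oo[ : set R) = +oo%E by rewrite lebesgue_measure_itv.
by rewrite set_itvNyy -NT N0.
Qed.

(** Both steps are 0 far to the left and [K] far to the right, so their difference has compact
    support; its derivative is a difference of mollifiers centred at [a] and [b]. *)
Lemma test_function_step (R : realType) (H : R -> R) (K a b e : R) :
  smooth_expr H -> (forall x, x <= - 1 -> H x = 0) -> (forall x, 1 <= x -> H x = K) ->
  0 < e -> test_function setT (fun x => H (e^-1 * x + - (a / e)) - H (e^-1 * x + - (b / e))).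
Proof.
move=> sH H0 HK e0; split => [n|].
  apply: smooth_expr_Cn.
  rewrite (_ : (fun x => _) = (fun x => H (e^-1 * x + - (a / e))) \+
    (cst (- 1) \* (fun x => H (e^-1 * x + - (b / e))))); last first.
    by apply/funext => x /=; rewrite mulN1r.
  apply: smooth_add; first exact: smooth_affine.
  by apply: smooth_mul; [exact: smooth_cst|exact: smooth_affine].
pose l := Num.min a b - e; pose r := Num.max a b + e.
exists `[l, r]%classic; split => //; first exact: segment_compact.
move=> x /negP xlr.
have E c : e^-1 * x + - (c / e) = (x - c) / e by field; rewrite gt_eqF.
rewrite !E; move: xlr; rewrite in_itv /= negb_and -!ltNge /l /r => /orP[] h.
  have [h1 h2] : x <= a - e /\ x <= b - e.
    by move: h; rewrite ltrBrDr lt_min => /andP[? ?]; split; lra.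
  by rewrite !H0 ?subr0 // ler_pdivrMr //; lra.
have [h1 h2] : a + e <= x /\ b + e <= x.
  by move: h; rewrite -ltrBrDr gt_max => /andP[? ?]; split; lra.
by rewrite !HK ?subrr // ler_pdivlMr //; lra.
Qed.

(** The difference [k] of [g] and a primitive of [h] has zero weak derivative. Tested against a
    difference of two steps, it has equal mollified values at any two points, hence equal values at
    any two Lebesgue points: it is constant almost everywhere. *)
Lemma weak_derivative_ac (R : realType) (g h : R -> R) : weak_derivative g h ->
  exists2 U, ac h U & {ae mu, forall x, g x = U x}.
Proof.
move=> [lg lh gh].
pose U := int0 h; have acU : ac h U := ac_int0 (fun a b => loc_integ a b lh).
have mh : measurable_fun (setT : set (measurableTypeR R)) h by case: lh.
have [lU _ Uh] := ac_weak mh acU.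
pose k := (fun x => g x - U x).
have lk : locally_integrable setT k by exact: locally_integrableB.
have [H [K [K0 sH dH H0 HK]]] := smooth_step R.
have keq a b : lebesgue_pt k a -> lebesgue_pt k b -> k a = k b.
  move=> ka kb; apply: (mulfI (lt0r_neq0 K0)); apply/eqP.
  rewrite -subr_eq0 -normr_le0; apply/ler_addgt0Pl => eta eta0; rewrite addr0.
  have eta2 : 0 < eta / 2 by rewrite divr_gt0.
  have ca := mollifier_cvg dH H0 HK lk ka eta2.
  have cb := mollifier_cvg dH H0 HK lk kb eta2.
  near (0 : R)^'+ => e; have e0 : 0 < e by [].
  have ha : `|\int[mu]_x (k x * mollifier a e x) - K * k a| <= eta / 2 by near: e.
  have hb : `|\int[mu]_x (k x * mollifier b e x) - K * k b| <= eta / 2 by near: e.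
  pose psi x := H (e^-1 * x + - (a / e)) - H (e^-1 * x + - (b / e)).
  have tpsi : test_function setT psi := test_function_step a b sH H0 HK e0.
  have dpsi x : derive1 psi x = mollifier a e x - mollifier b e x.
    rewrite derive1E; apply: derive_val.
    by apply: dfunB; exact: is_derive_step.
  pose l := Num.min a b - e; pose r := Num.max a b + e.
  have mD : measurable (`[l, r] : set (measurableTypeR R)) by [].
  have outa x : x \notin `[l, r] -> mollifier a e x = 0 /\ mollifier b e x = 0.
    move=> xlr; split; apply: mollifier_out => //; apply: contraNN xlr;
      rewrite !in_itv /= /l /r => /andP[h1 h2]; apply/andP; split.
    - by rewrite lerBlDr ge_min; apply/orP; left; lra.
    - by rewrite -lerBlDr le_max; apply/orP; left; lra.
    - by rewrite lerBlDr ge_min; apply/orP; right; lra.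
    - by rewrite -lerBlDr le_max; apply/orP; right; lra.
  have im (f : R -> R) c : locally_integrable setT f -> 
      mu.-integrable `[l, r] (EFin \o (fun x => f x * mollifier c e x)).
    move=> lf; have cm := @mollifier_continuous R c e.
    have [M M0 mM] := continuous_bounded_itv l r cm.
    apply: (@integM _ _ M) => //; first exact: loc_integ.
    exact: continuous_meas.
  have split_int (f : R -> R) : locally_integrable setT f ->
      \int[mu]_x (f x * derive1 psi x) =
      \int[mu]_(x in `[l, r]) (f x * mollifier a e x)
      - \int[mu]_(x in `[l, r]) (f x * mollifier b e x).
    move=> lf; rewrite (@Rintegral_supp _ _ l r); last first.
      by move=> x /outa[ma mb]; rewrite dpsi ma mb subrr mulr0.
    by under eq_Rintegral do rewrite dpsi mulrBr; rewrite RintegralB //; exact: im.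
  have kab : \int[mu]_x (k x * mollifier a e x) = \int[mu]_x (k x * mollifier b e x).
    rewrite (@Rintegral_supp _ _ l r); last by move=> x /outa[-> _]; rewrite mulr0.
    rewrite [RHS](@Rintegral_supp _ _ l r); last by move=> x /outa[_ ->]; rewrite mulr0.
    apply/eqP; rewrite -subr_eq0 /k.
    under eq_Rintegral do rewrite mulrBl.
    under [in X in _ - X]eq_Rintegral do rewrite mulrBl.
    have := gh _ tpsi; rewrite -(Uh _ tpsi) (split_int g lg) (split_int U lU).
    rewrite (RintegralB mD (im g a lg) (im U a lU)) (RintegralB mD (im g b lg) (im U b lU)).
    have lin (p q s t : R) : p - q = s - t -> (p - s) - (q - t) = 0 by lra.
    by move=> /lin E; apply/eqP.
  rewrite (_ : K * k a - K * k b =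
     (\int[mu]_x (k x * mollifier b e x) - K * k b)
     - (\int[mu]_x (k x * mollifier a e x) - K * k a)); last by rewrite kab; ring.
  by rewrite (splitr eta); apply: (le_trans (ler_normB _ _)); exact: lerD.
have aek := lebesgue_differentiation lk.
have [a0 ka0] := ae_exists aek.
exists (fun x => U x + k a0).
  have [iU eU] := acU; split => // a b ab; rewrite -eU //; ring.
move: aek; apply: filterS; first exact: (ae_filter_ringOfSetsType mu).
by move=> x kx; rewrite (keq a0 x) // /k addrC subrK.
Unshelve. all: by end_near. Qed.

Lemma continuous_ae_eq (R : realType) (f g : R -> R) : continuous f -> continuous g ->
  {ae mu, forall x, f x = g x} -> f = g.
Proof.
move=> cf cg [N [mN N0 PN]]; apply/funext => x; apply: contrapT => /eqP fgx.
have : \forall y \near x, f y - g y != 0.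
  have c : (fun y => f y - g y) y @[y --> x] --> f x - g x.
    by apply: cvgB; [exact: cf|exact: cg].
  by apply: (cvgr_neq0 _ c); rewrite subr_eq0.
move=> /nbhs_ballP[d /= d0 hd].
have sub : ball x d `<=` N.
  move=> y /hd; rewrite subr_eq0 => fy; apply: PN => /= e; move/eqP: fy; exact.
have : (mu (ball x d) <= mu N)%E.
  by apply: le_measure => //; rewrite inE //; exact: measurable_ball.
rewrite N0 lebesgue_measure_ball ?(ltW d0) // lee_fin; apply/negP.
by rewrite -ltNge mulrn_wgt0.
Qed.

(** A primitive of [u - v] is constant, while its derivative at a Lebesgue point is the value of
    [u - v] there. *)
Lemma ac_unique (R : realType) (u v U : R -> R) :
  measurable_fun (setT : set (measurableTypeR R)) u ->
  measurable_fun (setT : set (measurableTypeR R)) v ->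
  ac u U -> ac v U -> {ae mu, forall x, u x = v x}.
Proof.
move=> mu' mv acu acv.
have := ac_B acu acv; set d := (fun x => u x - v x) => -[id ed].
have md : measurable_fun (setT : set (measurableTypeR R)) d by exact: measurable_funB.
have ld := integ_loc md id.
have := lebesgue_differentiation ld.
apply: filterS; first exact: (ae_filter_ringOfSetsType mu).
move=> x dx; apply/eqP; rewrite -subr_eq0; apply/eqP.
have xu : x < x + 1 by lra.
have ax : (BLeft (x - 1)%R < BRight x)%E by rewrite /= lte_fin; lra.
have [dF eF] := FTC1_lebesgue_pt xu (id (x - 1) (x + 1)) ax dx.
rewrite -[u x - v x]/(d x) -eF.
rewrite derive1E; apply: derive_val; apply: (@near_eq_is_derive _ _ _ (cst 0)).
near=> y; rewrite /= -ed ?subrr //.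
by apply: ltW; near: y; apply: lt_nbhsr; lra.
Unshelve. all: by end_near. Qed.

(** * Square integrable functions *)

Definition symI (R : realType) (n : nat) : set R := `[- n%:R, n%:R]%classic.

Arguments symI : clear implicits.

Lemma measurable_symI (R : realType) n : measurable (symI R n : set (measurableTypeR R)).
Proof. exact: measurable_itv. Qed.
#[local] Hint Resolve measurable_symI : core.

Lemma ge0_cvg_symI (R : realType) (f : R -> R) :
  measurable_fun (setT : set (measurableTypeR R)) f -> (forall x, 0 <= f x) ->
  (\int[mu]_(x in symI R n) (f x)%:E @[n --> \oo] --> \int[mu]_x (f x)%:E)%E.
Proof.
move=> mf f0.
have -> : (\int[mu]_x (f x)%:E = \int[mu]_(x in \bigcup_n symI R n) (f x)%:E)%E.
  congr integral; apply/seteqP; split => // x _.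
  exists (Num.truncn `|x|).+1 => //; rewrite /symI /= in_itv /= -ler_norml.
  by apply: ltW; apply: truncnS_gt.
apply: ge0_nondecreasing_set_cvg_integral.
- apply/nondecreasing_seqP => n; apply/subsetPset => x; rewrite /symI /= !in_itv /= -!ler_norml.
  by move=> h; apply: (le_trans h); rewrite ler_nat.
- by move=> n; exact: measurable_symI.
- by move=> n; apply/measurable_EFinP; exact: measurable_funS mf.
- by move=> n x _; rewrite lee_fin.
Qed.

Lemma integ_of_bound (R : realType) (f : R -> R) (C : R) :
  measurable_fun (setT : set (measurableTypeR R)) f -> (forall x, 0 <= f x) ->
  (forall n, mu.-integrable (symI R n) (EFin \o f)) ->
  (forall n, \int[mu]_(x in symI R n) f x <= C) ->
  mu.-integrable setT (EFin \o f) /\ \int[mu]_x f x <= C.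
Proof.
move=> mf f0 iF fC.
have h : (\int[mu]_x (f x)%:E <= C%:E)%E.
  rewrite -(cvg_lim _ (ge0_cvg_symI mf f0)) //.
  apply: lime_le; first by apply/cvg_ex; eexists; exact: ge0_cvg_symI.
  apply: nearW => n; have := fC n; rewrite -lee_fin /Rintegral fineK //.
  by apply: integrable_fin_num; [exact: measurable_symI|exact: iF].
have i0 : (0 <= \int[mu]_x (f x)%:E)%E by apply: integral_ge0 => x _; rewrite lee_fin.
have fn : (\int[mu]_x (f x)%:E)%E \is a fin_num.
  by rewrite ge0_fin_numE // (le_lt_trans h) // ltry.
split; last by rewrite -lee_fin /Rintegral fineK.
apply/integrableP; split; first exact/measurable_EFinP.
have -> : (\int[mu]_x `|(EFin \o f) x| = \int[mu]_x (f x)%:E)%E.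
  by apply: eq_integral => x _; rewrite /= ger0_norm.
by rewrite (le_lt_trans h) // ltry.
Qed.

Lemma integ_symI (R : realType) (f : R -> R) n : mu.-integrable setT (EFin \o f) ->
  mu.-integrable (symI R n) (EFin \o f).
Proof. by apply: integrableS => //; exact: measurable_symI. Qed.

(** Monotone convergence, applied to the nonnegative functions [|f|] and [|f| - f]. *)
Lemma cvg_symI (R : realType) (f : R -> R) : mu.-integrable setT (EFin \o f) ->
  \int[mu]_(x in symI R n) f x @[n --> \oo] --> \int[mu]_x f x.
Proof.
move=> iF.
have pos g : mu.-integrable setT (EFin \o g) -> (forall x, 0 <= g x) ->
    \int[mu]_(x in symI R n) g x @[n --> \oo] --> \int[mu]_x g x.
  move=> ig g0; have := ge0_cvg_symI (integ_meas ig) g0.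
  have fn : (\int[mu]_x (g x)%:E)%E \is a fin_num by apply: integrable_fin_num.
  rewrite -(fineK fn) => h.
  exact: (fine_cvg h).
have inf : mu.-integrable setT (EFin \o (fun x => `|f x|)) by exact: (integrable_norm iF).
have ing : mu.-integrable setT (EFin \o (fun x => `|f x| - f x)) by exact: integB.
have c1 := pos _ inf (fun x => normr_ge0 _).
have c2 : \int[mu]_(x in symI R n) (`|f x| - f x) @[n --> \oo] -->
    \int[mu]_x (`|f x| - f x).
  by apply: pos => // x; rewrite subr_ge0 ler_norm.
have E (D : set (measurableTypeR R)) : measurable D -> \int[mu]_(x in D) f x =
    \int[mu]_(x in D) `|f x| - \int[mu]_(x in D) (`|f x| - f x).
  move=> mD; rewrite -RintegralB //; try exact: (integrableS _ mD (@subsetT _ _)).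
  by apply: eq_Rintegral => x _; rewrite opprB addrC subrK.
rewrite E // (_ : (fun n => _) = (fun n => \int[mu]_(x in symI R n) `|f x| -
    \int[mu]_(x in symI R n) (`|f x| - f x))); last first.
  by apply/funext => n; rewrite E //; exact: measurable_symI.
exact: cvgB c1 c2.
Qed.

Lemma L2_integ (R : realType) (g : R -> R) : L2 g ->
  measurable_fun (setT : set (measurableTypeR R)) g /\
  mu.-integrable setT (EFin \o (fun x => g x ^+ 2)).
Proof.
move=> gL; split; last exact: Lfun2_integrable_sqr.
by move: gL; rewrite /L2 inE => /andP[]; rewrite inE.
Qed.

Lemma L2_weaken (R : realType) (f g : R -> R) :
  {ae mu, forall x, f x = g x} -> measurable_fun (setT : set (measurableTypeR R)) f ->
  measurable_fun (setT : set (measurableTypeR R)) g ->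
  mu.-integrable setT (EFin \o f) -> mu.-integrable setT (EFin \o g).
Proof.
move=> fg mf mg /integrableP[_ fi]; apply/integrableP; split; first exact/measurable_EFinP.
rewrite (_ : (\int[mu]_x `|(EFin \o g) x| = \int[mu]_x `|(EFin \o f) x|)%E) //.
apply: ae_eq_integral => //; try by apply: measurableT_comp => //; exact/measurable_EFinP.
move: fg; apply: filterS; first exact: (ae_filter_ringOfSetsType mu).
by move=> x fx _; rewrite /= fx.
Qed.

(* [phi] is the continuous representative of an [H^1] function and [h] its weak
   derivative. *)
Definition h1 (R : realType) (phi h : R -> R) : Prop :=
  [/\ ac h phi, measurable_fun (setT : set (measurableTypeR R)) h,
      mu.-integrable setT (EFin \o (fun x => phi x ^+ 2)) &
      mu.-integrable setT (EFin \o (fun x => h x ^+ 2))].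

(** The density [2 phi h] of [phi ^+ 2] is dominated by the integrable function [phi ^+ 2 + h ^+ 2],
    so [phi ^+ 2] varies by at most the integral [M] of the latter. *)
Lemma h1_bounded (R : realType) (phi h : R -> R) : h1 phi h ->
  exists2 K, 0 < K & forall x, `|phi x| <= K.
Proof.
move=> [acp mh ip ih]; have cp := ac_continuous acp.
have mp := continuous_meas (measurableT) cp.
have iph : mu.-integrable setT (EFin \o (fun x => phi x ^+ 2 + h x ^+ 2)) by exact: integD.
pose M := \int[mu]_x (phi x ^+ 2 + h x ^+ 2).
have [_ e2] := ac_X 2 acp.
have diff a b : a <= b -> `|phi b ^+ 2 - phi a ^+ 2| <= M.
  move=> ab; rewrite e2 //.
  have mD : measurable (`[a, b] : set (measurableTypeR R)) by [].
  have iD f : mu.-integrable setT (EFin \o f) -> mu.-integrable `[a, b] (EFin \o f).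
    exact: (integrableS _ mD (@subsetT _ _)).
  have bd x : `|2%:R * phi x ^+ 2.-1 * h x| <= phi x ^+ 2 + h x ^+ 2.
    have s1 := sqr_ge0 (phi x - h x); have s2 := sqr_ge0 (phi x + h x).
    by rewrite -[2.-1]/1%N expr1 ler_norml; apply/andP; split; nra.
  have i1 : mu.-integrable `[a, b] (EFin \o (fun x => 2%:R * phi x ^+ 2.-1 * h x)).
    apply: (@integ_le _ _ _ (fun x => phi x ^+ 2 + h x ^+ 2)) => //; last exact: iD.
    apply: (@measurable_funS _ _ _ _ setT) => //.
    by apply: measurable_funM => //; apply: measurable_funM => //; rewrite expr1.
  apply: (le_trans (le_normr_Rintegral _ _)) => //.
  apply: (@le_trans _ _ (\int[mu]_(x in `[a, b]) (phi x ^+ 2 + h x ^+ 2))).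
    by apply: le_Rintegral => //; [exact: (integrable_norm i1)|exact: iD].
  rewrite /M -lee_fin /Rintegral !fineK; try exact: integrable_fin_num.
    apply: ge0_subset_integral => //=.
    - by apply/measurable_EFinP; exact: integ_meas iph.
    - by move=> x _; rewrite lee_fin addr_ge0 // sqr_ge0.
  by apply: integrable_fin_num => //; exact: iD.
have M0 : 0 <= M by apply: Rintegral_ge0 => x _; rewrite addr_ge0 // sqr_ge0.
(* From [t ^ 2 <= A] follows [t <= 1 + A], which avoids a square root. *)
exists (1 + phi 0 ^+ 2 + M) => [|x]; first by rewrite ltr_wpDr // ltr_wpDr ?sqr_ge0.
have : `|phi x ^+ 2 - phi 0 ^+ 2| <= M.
  by case: (leP 0 x) => [/diff//|/ltW/diff]; rewrite distrC.
have := sqr_ge0 (phi 0); rewrite ler_norml => p0 /andP[_ h2].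
have p1 : `|phi x| ^+ 2 <= phi 0 ^+ 2 + M by rewrite real_normK ?num_real //; lra.
have := normr_ge0 (phi x); nra.
Qed.

(** * The flux *)

Lemma MVT_le (R : realType) (f df : R -> R) (a b M : R) :
  (forall x : R, is_derive x 1 f (df x)) ->
  (forall x, x \in `[Num.min a b, Num.max a b] -> `|df x| <= M) ->
  `|f b - f a| <= M * `|b - a|.
Proof.
move=> dF; have cf : continuous f by move=> x; exact: is_derive_cont (dF x).
have H u v : u <= v -> (forall x, x \in `[u, v] -> `|df x| <= M) ->
    `|f v - f u| <= M * `|v - u|.
  move=> uv hM; have [|c cuv ->] := @MVT_segment R f df u v uv (fun x _ => dF x).
    exact: continuous_subspaceT.
  by rewrite normrM ler_wpM2r // hM.
case: (leP a b) => [ab|/ltW ba] hM; first exact: H.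
by rewrite distrC [X in _ * X]distrC; exact: H.
Qed.

(** The derivative bound integrates to [a / 2 * z ^+ 2 + b / 4 * z ^+ 4]; the factors 1/2 and 1/4
    are given up. Remainders caused by the flux are estimated in this way, through their derivative
    in [z]. *)
Lemma quartic_bound (R : realType) (r dr : R -> R) (a b z : R) : 0 <= a -> 0 <= b ->
  r 0 = 0 -> (forall s : R, is_derive s 1 r (dr s)) ->
  (forall s, `|dr s| <= `|s| * (a + b * s ^+ 2)) ->
  `|r z| <= a * z ^+ 2 + b * z ^+ 4.
Proof.
move=> a0 b0 r0 drr hb.
have H : forall s (g dg : R -> R), g 0 = 0 -> (forall s : R, is_derive s 1 g (dg s)) ->
    (forall s, `|dg s| <= `|s| * (a + b * s ^+ 2)) -> g s <= a * s ^+ 2 + b * s ^+ 4.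
  move=> s g dg g0 dgg hg.
  pose P t := (a / 2 * t ^+ 2 + b / 4 * t ^+ 4) - g t.
  have dP (t : R) : is_derive t 1 P (t * (a + b * t ^+ 2) - dg t).
    apply: (is_derive_eq (dfunB (dfunD (dfunZ _ (dfunX 2 (dfunid t)))
      (dfunZ _ (dfunX 4 (dfunid t)))) (dgg t))).
    by rewrite /=; field.
  have cP : continuous P by move=> x; exact: is_derive_cont (dP x).
  have P0 : P 0 = 0 by rewrite /P g0 !expr0n /= !mulr0 addr0 subr0.
  have Ps : 0 <= P s.
    case: (leP 0 s) => [s0|/ltW s0].
      have [|c] := @MVT_segment R P _ 0 s s0 (fun x _ => dP x).
        exact: continuous_subspaceT.
      rewrite in_itv /= => /andP[c0 cs] e.
      have := hg c; rewrite (ger0_norm c0) ler_norml => /andP[_ h].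
      by move: e; rewrite P0 !subr0 => ->; rewrite mulr_ge0 // subr_ge0.
    have [|c] := @MVT_segment R P _ s 0 s0 (fun x _ => dP x).
      exact: continuous_subspaceT.
    rewrite in_itv /= => /andP[cs c0] e.
    have := hg c; rewrite (ler0_norm c0) ler_norml => /andP[h _].
    move: e; rewrite P0 sub0r add0r => e.
    rewrite -oppr_le0 e mulr_le0_ge0 ?oppr_ge0 //.
    by rewrite subr_le0 -lerN2 -mulNr; rewrite -mulNr in h; lra.
  have s2 : 0 <= a * s ^+ 2 by rewrite mulr_ge0 // sqr_ge0.
  have s4 : 0 <= b * s ^+ 4 by rewrite mulr_ge0 // exprn_even_ge0.
  by move: Ps; rewrite /P; lra.
rewrite ler_norml; apply/andP; split; last exact: (H z r dr).
rewrite lerNl; apply: (H z (fun s => - r s) (fun s => - dr s)).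
- by rewrite r0 oppr0.
- by move=> s; rewrite normrN.
Qed.

(** The form in which smallness of [eps_flux] enters all estimates: [6 * v] is the second derivative
    of [v ^+ 3], so [flux_eps] bounds that of [cubic_defect f]. *)
Record flux (R : realType) (um eps : R) (f d1 d2 : R -> R) : Prop := Flux {
  flux_d1 : forall v : R, is_derive v 1 f (d1 v);
  flux_d2 : forall v : R, is_derive v 1 d1 (d2 v);
  flux_eps : forall v, `|d2 v - 6 * v| <= eps * (um + `|v|) }.

Lemma flux_of_eps (R : realType) (um eps : R) (f : R -> R) : 0 < um -> Cn 3 f ->
  (eps_flux um f <= eps%:E)%E -> flux um eps f (derive1 f) (derive1 (derive1 f)).
Proof.
move=> um0 [df _] fe.
have d1 (v : R) : is_derive v 1 f (derive1 f v).
  by rewrite derive1E; apply: derivableP; exact: (df 0%N).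
have d2 (v : R) : is_derive v 1 (derive1 f) (derive1 (derive1 f) v).
  by rewrite [X in is_derive _ _ _ X]derive1E; apply: derivableP; exact: (df 1%N).
split => // v.
have q2 : derive1n 2 (cubic_defect f) v = derive1 (derive1 f) v - 6 * v.
  have q1 : derive1 (cubic_defect f) = fun v => derive1 f v - 3 * v ^+ 2.
    apply/funext => y; rewrite derive1E; apply: derive_val.
    apply: (is_derive_eq (dfunB (d1 y) (dfunX 3 (dfunid y)))); rewrite /=; ring.
  rewrite /= q1 derive1E; apply: derive_val.
  by apply: (is_derive_eq (dfunB (d2 v) (dfunZ _ (dfunX 2 (dfunid v))))); rewrite /=; ring.
have uv : 0 < um + `|v| by rewrite ltr_pwDl.
rewrite -ler_pdivrMr // -lee_fin -q2.
apply: le_trans fe; rewrite /eps_flux.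
apply: (@le_trans _ _ (ereal_sup (range (fun v : R =>
    (`|derive1n 2 (cubic_defect f) v| / (um + `|v|))%R%:E)))%E).
  by apply: ereal_sup_ubound; exists v.
by apply: leeDl; exact: Lnorm_ge0.
Qed.

Lemma flux_eps_ge0 (R : realType) (um eps : R) (f d1 d2 : R -> R) : 0 < um ->
  flux um eps f d1 d2 -> 0 <= eps.
Proof.
move=> um0 fl; have := le_trans (normr_ge0 _) (flux_eps fl 0).
by rewrite normr0 addr0 pmulr_lge0.
Qed.

Lemma flux_d1_diff (R : realType) (um eps : R) (f d1 d2 : R -> R) a b :
  0 < um -> flux um eps f d1 d2 ->
  `|(d1 b - 3 * b ^+ 2) - (d1 a - 3 * a ^+ 2)| <= eps * (um + `|a| + `|b|) * `|b - a|.
Proof.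
move=> um0 fl; have e0 := flux_eps_ge0 um0 fl.
apply: (@MVT_le _ (fun v => d1 v - 3 * v ^+ 2) (fun v => d2 v - 6 * v)).
  move=> v; apply: (is_derive_eq (dfunB (flux_d2 fl v) (dfunZ _ (dfunX 2 (dfunid v))))).
  by rewrite /=; ring.
move=> x xab; apply: (le_trans (flux_eps fl x)); rewrite ler_wpM2l // -addrA lerD2l.
move: xab; rewrite in_itv /= ge_min le_max => /andP[h1 h2].
have := normr_ge0 a; have := normr_ge0 b; have := ler_norm a; have := ler_norm b.
have := ler_norm (- a); have := ler_norm (- b); rewrite !normrN => n1 n2 n3 n4 n5 n6.
rewrite ler_norml; apply/andP; split.
  by move: h1 => /orP[] h; lra.
by move: h2 => /orP[] h; lra.
Qed.

(** Both sides vanish at [z = 0] and have the same derivative in [z]. The right side uses a fixed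
    primitive of [f], which makes continuity and measurability in [v] and [z] visible. *)
Lemma int0_shift (R : realType) (f : R -> R) (v z : R) : continuous f ->
  int0 (fun s => f (v + s) - f v) z = int0 f (v + z) - int0 f v - f v * z.
Proof.
move=> cf.
have cg : continuous (fun s => f (v + s) - f v).
  move=> s; apply: cvgB; last exact: cvg_cst.
  apply: (@continuous_comp _ _ _ (fun s => v + s) f); last exact: cf.
  by apply: cvgD; [exact: cvg_cst|exact: cvg_id].
have dl (s : R) := ac_derive s cg (ac_int0 (fun a b => continuous_integ a b cg)).
have dr (s : R) : is_derive s 1
    (fun z => int0 f (v + z) - int0 f v - f v * z) (f (v + s) - f v).
  have h : is_derive s 1 (fun z => v + z) 1.
    by apply: (is_derive_eq (dfunD (dfuncst s v) (dfunid s))); rewrite add0r.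
  have hP := ac_derive (v + s) cf (ac_int0 (fun a b => continuous_integ a b cf)).
  apply: (is_derive_eq (dfunB (dfunB (dfun_comp hP h) (dfuncst s (int0 f v)))
    (dfunZ (f v) (dfunid s)))); ring.
have h : forall x : R, is_derive x 1 (fun z => int0 (fun s => f (v + s) - f v) z -
    (int0 f (v + z) - int0 f v - f v * z)) 0.
  by move=> x; apply: (is_derive_eq (dfunB (dl x) (dr x))); rewrite subrr.
have := is_derive_0_is_cst z 0 h.
have i00 (g : R -> R) : int0 g 0 = 0 by rewrite /int0 lexx set_itv1 Rintegral_set1.
by rewrite i00 addr0 mulr0 !subrr ?subr0 => /eqP; rewrite subr_eq0 => /eqP.
Qed.

(** The polynomial is [B_fun] of the cubic. The slope of the defect at [um], which [eps] does not
    control, is split off as a multiple of [z ^+ 2]; it cancels later against [f'(V) - 2 f'(um)] in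
    [D_S], against [- f'(uR)] in [D_R], and in differences of [A_fun]. The derivative of the
    remainder contains only increments of the slope of the defect, small by [flux_d1_diff]. *)
Lemma B_fun_cubic (R : realType) (um eta eps : R) (f d1 d2 : R -> R) (v z : R) :
  0 < um -> flux um eps f d1 d2 -> d1 = derive1 f ->
  `|v| <= 3 * um -> 0 <= eta <= 1 ->
  `|B_fun um eta f v z - (z ^+ 2 * (3 * alpha um eta * v - 3 / 2 * v ^+ 2)
      + z ^+ 3 * (alpha um eta + v) + 3 / 4 * z ^+ 4)
    - 2^-1 * (d1 um - 3 * um ^+ 2) * z ^+ 2|
  <= eps * (100 * um ^+ 2 * z ^+ 2 + 10 * z ^+ 4).
Proof.
move=> um0 fl d1E v3 eta01; have e0 := flux_eps_ge0 um0 fl.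
have cf : continuous f by move=> x; exact: is_derive_cont (flux_d1 fl x).
have -> : eps * (100 * um ^+ 2 * z ^+ 2 + 10 * z ^+ 4) =
  eps * (100 * um ^+ 2) * z ^+ 2 + eps * 10 * z ^+ 4 by ring.
set al := alpha um eta; set k := d1 um - _.
pose r z := (al - v + z) * (f (v + z) - f v) - (int0 f (v + z) - int0 f v - f v * z)
  - (al - v) * d1 v * z - (z ^+ 2 * (3 * al * v - 3 / 2 * v ^+ 2)
      + z ^+ 3 * (al + v) + 3 / 4 * z ^+ 4) - 2^-1 * k * z ^+ 2.
have -> : B_fun um eta f v z - (z ^+ 2 * (3 * al * v - 3 / 2 * v ^+ 2)
      + z ^+ 3 * (al + v) + 3 / 4 * z ^+ 4) - 2^-1 * k * z ^+ 2 = r z.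
  by rewrite /B_fun int0_shift // /r -d1E.
pose p x := d1 x - 3 * x ^+ 2.
pose dr s := (al - v) * (p (v + s) - p v) + s * (p (v + s) - p um).
apply: (@quartic_bound _ r dr).
- by rewrite mulr_ge0 // mulr_ge0 // sqr_ge0.
- by rewrite mulr_ge0.
- by rewrite /r !addr0; ring.
- move=> s.
  have h : is_derive s 1 (fun z => v + z) 1.
    by apply: (is_derive_eq (dfunD (dfuncst s v) (dfunid s))); rewrite add0r.
  have h' : is_derive s 1 (fun z => al - v + z) 1.
    by apply: (is_derive_eq (dfunD (dfuncst s _) (dfunid s))); rewrite add0r.
  have hf := dfun_comp (flux_d1 fl (v + s)) h.
  have hP := ac_derive (v + s) cf (ac_int0 (fun a b => continuous_integ a b cf)).
  have D1 := dfunM h' (dfunB hf (dfuncst s (f v))).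
  have D2 := dfunB (dfunB (dfun_comp hP h) (dfuncst s (int0 f v))) (dfunZ (f v) (dfunid s)).
  have D3 := dfunZ ((al - v) * d1 v) (dfunid s).
  have D4 := dfunM (dfunX 2 (dfunid s)) (dfuncst s (3 * al * v - 3 / 2 * v ^+ 2)).
  have D5 := dfunM (dfunX 3 (dfunid s)) (dfuncst s (al + v)).
  have D6 := dfunZ (3 / 4) (dfunX 4 (dfunid s)).
  have D7 := dfunZ (2^-1 * k) (dfunX 2 (dfunid s)).
  apply: (is_derive_eq (dfunB (dfunB (dfunB (dfunB D1 D2) D3) (dfunD (dfunD D4 D5) D6)) D7)).
  by rewrite /dr /p /k /=; field.
- move=> s.
  have al5 : al <= 5 * um /\ 4 * um <= al.
    by rewrite /al /alpha; case/andP: eta01 => ? ?; split; nra.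
  have vv : - (3 * um) <= v /\ v <= 3 * um.
    by move: v3; rewrite ler_norml => /andP[].
  have aln : `|al - v| <= 8 * um by rewrite ler_norml; apply/andP; split; lra.
  have vs : `|v + s| <= 3 * um + `|s| by apply: (le_trans (ler_normD _ _)); rewrite lerD2r.
  have h1 := flux_d1_diff v (v + s) um0 fl.
  have h2 := flux_d1_diff um (v + s) um0 fl.
  rewrite -!/(p _) in h1 h2; rewrite [v + s - v]addrAC subrr add0r in h1.
  have s0 := normr_ge0 s.
  have vsm : `|v + s - um| <= 4 * um + `|s|.
    apply: (le_trans (ler_normB _ _)); rewrite (gtr0_norm um0); lra.
  rewrite (gtr0_norm um0) in h2.
  have g1 : `|p (v + s) - p v| <= eps * (7 * um + `|s|) * `|s|.
    apply: (le_trans h1); rewrite ler_wpM2r // ler_wpM2l //; lra.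
  have g2 : `|p (v + s) - p um| <= eps * (5 * um + `|s|) * (4 * um + `|s|).
    have n0 := normr_ge0 (v + s).
    apply: (le_trans h2); apply: ler_pM => //.
      by apply: mulr_ge0 => //; lra.
    by apply: ler_wpM2l => //; lra.
  apply: (le_trans (ler_normD _ _)); rewrite !normrM.
  apply: (@le_trans _ _ (8 * um * (eps * (7 * um + `|s|) * `|s|) +
     `|s| * (eps * (5 * um + `|s|) * (4 * um + `|s|)))).
    by apply: lerD; [apply: ler_pM|rewrite ler_wpM2l].
  rewrite -subr_ge0 -(real_normK (num_real s)).
  set t := `|s| in s0 *.
  have -> : t * (eps * (100 * um ^+ 2) + eps * 10 * t ^+ 2) -
     (8 * um * (eps * (7 * um + t) * t) + t * (eps * (5 * um + t) * (4 * um + t))) =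
     t * eps * (24 * um ^+ 2 - 17 * um * t + 9 * t ^+ 2) by ring.
  rewrite mulr_ge0 //; first by rewrite mulr_ge0.
  (* The quadratic is [(4 um - 3 t) ^ 2 + 8 um ^ 2 + 7 um t]. *)
  have := sqr_ge0 (4 * um - 3 * t); have := sqr_ge0 um; have := mulr_ge0 (ltW um0) s0.
  rewrite -/t; nra.
Qed.

(** * The shock profile *)

(** Uniqueness for the differential equation, by Gronwall: with [K] a Lipschitz bound of [F], the
    square of [V - e] times an exponential of rate [2 K] in the direction of [x] does not decrease
    from 0 to [x]. *)
Lemma equilibrium_not_reached (R : realType) (V F dF : R -> R) (e x : R) :
  (forall t : R, is_derive t 1 V (F (V t))) -> (forall v : R, is_derive v 1 F (dF v)) ->
  continuous dF -> F e = 0 -> V 0 != e -> V x != e.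
Proof.
move=> dV dF' cdF Fe V0.
have cV : continuous V by move=> t; exact: is_derive_cont (dV t).
have [B B0 VB] := continuous_bounded_itv (- `|x|) `|x| cV.
have [K K0 FK] := continuous_bounded_itv (- (B + `|e|)) (B + `|e|) cdF.
have FL t : `|t| <= `|x| -> `|F (V t)| <= K * `|V t - e|.
  move=> tx; rewrite -[F (V t)]subr0 -Fe; apply: (MVT_le (fun v => dF' v)) => v.
  have := VB t; rewrite in_itv /= -!ler_norml tx => /(_ isT) Vt.
  rewrite in_itv /= ge_min le_max => h; apply: FK; rewrite in_itv /= -ler_norml.
  have e0 := ler_norm e; have e1 := ler_norm (- e); rewrite normrN in e1.
  have e2 := normr_ge0 e; have /andP[v1 v2] : - B <= V t <= B by rewrite -ler_norml.
  move: h => /andP[].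
  move=> /orP h1.
  move=> /orP h2.
  rewrite ler_norml.
  by apply/andP; case: h1; case: h2; split; lra.
pose k := if 0 <= x then K else - K.
pose P t := (V t - e) ^+ 2 * expR (2 * k * t).
have dP (t : R) : is_derive t 1 P (2 * ((V t - e) * F (V t) + k * (V t - e) ^+ 2)
    * expR (2 * k * t)).
  have h1 := dfunX 2 (dfunB (dV t) (dfuncst t e)).
  have h2 := dfun_comp (is_derive_expR (2 * k * t)) (dfunZ (2 * k) (dfunid t)).
  by apply: (is_derive_eq (dfunM h1 h2)); rewrite /=; ring.
have cP : {within `[Num.min 0 x, Num.max 0 x], continuous P}.
  by apply: continuous_subspaceT => t; exact: is_derive_cont (dP t).
have P0 : 0 < P 0 by rewrite /P mulr0 expR0 mulr1 exprn_even_gt0 //= subr_eq0.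
suff : P 0 <= P x.
  move=> h; have := lt_le_trans P0 h; apply: contraTneq => Vx.
  by rewrite /P Vx subrr expr0n /= mul0r ltxx.
have b t : `|t| <= `|x| -> `|(V t - e) * F (V t)| <= K * (V t - e) ^+ 2.
  move=> tx; rewrite normrM -(real_normK (num_real (V t - e))) expr2 mulrCA.
  by rewrite ler_wpM2l // FL.
have := cP; case: (leP 0 x) => [x0|xn] {}cP.
  have [c] := MVT_segment x0 (fun t _ => dP t) cP.
  rewrite in_itv /= subr0 -(subr_ge0 (P 0)) => /andP[c0 cx] ->; apply: mulr_ge0 => //.
  apply: mulr_ge0; last exact: expR_ge0.
  apply: mulr_ge0 => //; rewrite /k x0.
  have := b c; rewrite (ger0_norm c0) (ger0_norm x0) => /(_ cx).
  by rewrite ler_norml => /andP[h _]; lra.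
have x0 := ltW xn.
have [c] := MVT_segment x0 (fun t _ => dP t) cP.
rewrite in_itv /= sub0r -(subr_le0 (P x)) => /andP[cx c0] ->.
apply: mulr_le0_ge0; last by rewrite oppr_ge0.
apply: mulr_le0_ge0; last exact: expR_ge0.
apply: mulr_ge0_le0 => //; rewrite /k.
have := b c; rewrite (ler0_norm c0) (ler0_norm x0) lerN2 => /(_ cx).
by rewrite (lt_geF xn) ler_norml => /andP[_ h]; lra.
Qed.

Lemma stay_below (R : realType) (V : R -> R) (e x : R) : continuous V ->
  (forall t, V t != e) -> V 0 < e -> V x < e.
Proof.
move=> cV Ve V0; rewrite ltNge; apply/negP => Vx.
have [c _ /eqP] : exists2 c, c \in `[Num.min 0 x, Num.max 0 x] & V c = e.
  case: (leP 0 x) => [x0|/ltW x0].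
    apply: IVT => //; first exact: continuous_subspaceT.
    by rewrite ge_min le_max (ltW V0) Vx orbT.
  apply: IVT => //; first exact: continuous_subspaceT.
  by rewrite ge_min le_max (ltW V0) Vx !orbT.
by rewrite (negPf (Ve c)).
Qed.

(** Right-hand side of the profile equation integrated once, with the constant fixed by the state
    [um] and the speed written as [d1 um]. *)
Definition shock_rhs (R : realType) (um : R) (f d1 : R -> R) (v : R) : R :=
  f v - f um - d1 um * (v - um).

(** For the cubic this is [(um - v) ^ 2 * (v + 2 um)]. The contribution [g] of the defect vanishes
    to second order at [um], because the shock speed is the characteristic speed there; this gives
    the double factor of the error. The simple factor at [ul] comes from [shock_rhs] vanishing at
    [ul]. *)
Lemma shock_rhs_cubic (R : realType) (um eps ul : R) (f d1 d2 : R -> R) :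
  0 < um -> flux um eps f d1 d2 -> - (5 / 2 * um) < ul < - (3 / 2 * um) ->
  shock_rhs um f d1 ul = 0 ->
  `|ul + 2 * um| <= 5 * eps * um /\
  forall v, ul <= v <= um ->
    `|shock_rhs um f d1 v - (um - v) ^+ 2 * (v - ul)| <=
      20 * eps * ((um - v) ^+ 2 * (v - ul)).
Proof.
move=> um0 fl /andP[l1 l2] Ful; have e0 := flux_eps_ge0 um0 fl.
have eum : 0 <= eps * um by rewrite mulr_ge0 // ltW.
pose g v := f v - v ^+ 3 - (f um - um ^+ 3) - (d1 um - 3 * um ^+ 2) * (v - um).
pose dg v := (d1 v - 3 * v ^+ 2) - (d1 um - 3 * um ^+ 2).
have dgg (v : R) : is_derive v 1 g (dg v).
  apply: (is_derive_eq (dfunB (dfunB (dfunB (flux_d1 fl v) (dfunX 3 (dfunid v)))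
    (dfuncst v _)) (dfunZ _ (dfunB (dfunid v) (dfuncst v um))))).
  by rewrite /dg /=; ring.
have gE v : shock_rhs um f d1 v = (um - v) ^+ 2 * (v + 2 * um) + g v.
  by rewrite /shock_rhs /g; ring.
have dgb v : ul <= v <= um -> `|dg v| <= 9 / 2 * eps * um * (um - v).
  move=> /andP[v1 v2]; apply: (le_trans (flux_d1_diff um v um0 fl)).
  have vm : `|v - um| = um - v by rewrite distrC ger0_norm // subr_ge0.
  have av : `|v| <= 5 / 2 * um by rewrite ler_norml; apply/andP; split; lra.
  rewrite vm (gtr0_norm um0) ler_wpM2r ?subr_ge0 //.
  rewrite (_ : 9 / 2 * eps * um = eps * (9 / 2 * um)); last by ring.
  by rewrite ler_wpM2l //; lra.
have gb v : ul <= v <= um -> `|g v| <= 9 / 2 * eps * um * (um - v) ^+ 2.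
  move=> /andP[v1 v2]; have g0 : g um = 0 by rewrite /g; ring.
  rewrite -[g v]subr0 -g0.
  have -> : (um - v) ^+ 2 = (um - v) * `|v - um| by rewrite distrC ger0_norm ?subr_ge0.
  rewrite mulrA; apply: (MVT_le dgg) => t; rewrite (min_r v2) (max_l v2) in_itv /= => /andP[t1 t2].
  apply: (le_trans (dgb t _)); first by apply/andP; split; lra.
  by rewrite ler_wpM2l ?lerB //; lra.
have ulum : ul <= ul <= um by rewrite lexx /=; lra.
have ul2 : `|ul + 2 * um| <= 9 / 2 * eps * um.
  have := gb ul ulum; have h : g ul = - ((um - ul) ^+ 2 * (ul + 2 * um)).
    by apply/eqP; rewrite -addr_eq0 addrC -gE Ful.
  have p0 : 0 < (um - ul) ^+ 2 by rewrite exprn_gt0 //; lra.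
  by rewrite h normrN normrM (gtr0_norm p0) mulrC ler_pM2r.
split=> [|v /andP[v1 v2]]; first by apply: (le_trans ul2); lra.
pose e v := (um - v) ^+ 2 * (2 * um + ul) + g v.
have -> : shock_rhs um f d1 v - (um - v) ^+ 2 * (v - ul) = e v by rewrite gE /e; ring.
have v12 : ul <= v <= um by apply/andP.
have sq0 := sqr_ge0 (um - v).
(* Away from [ul] the absolute bound on the error suffices. Near [ul] the error must vanish with
   [v - ul]; this follows from [e ul = 0] and the mean value theorem. *)
have [far|near_] := leP (um / 2) (v - ul).
  apply: (@le_trans _ _ ((um - v) ^+ 2 * (9 / 2 * eps * um) + 9 / 2 * eps * um * (um - v) ^+ 2)).
    apply: (le_trans (ler_normD _ _)); apply: lerD; last exact: gb.
    by rewrite normrM ger0_norm // ler_wpM2l // addrC.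
  rewrite -subr_ge0; set d := (X in 0 <= X).
  have -> : d = (um - v) ^+ 2 * (eps * (20 * (v - ul) - 9 * um)) by rewrite /d; field.
  by rewrite mulr_ge0 // mulr_ge0 //; lra.
have eul : e ul = 0 by rewrite /e [2 * um + ul]addrC -gE.
pose de v := - (2 * (um - v)) * (2 * um + ul) + dg v.
have dee (t : R) : is_derive t 1 e (de t).
  have h := dfunX 2 (dfunB (dfuncst t um) (dfunid t)).
  apply: (is_derive_eq (dfunD (dfunM h (dfuncst t (2 * um + ul))) (dgg t))).
  by rewrite /de /=; ring.
have : `|e v - e ul| <= 48 * eps * um ^+ 2 * `|v - ul|.
  apply: (MVT_le dee) => t; rewrite (min_l v1) (max_r v1) in_itv /= => /andP[t1 t2].
  have tt : ul <= t <= um by apply/andP; split; lra.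
  apply: (@le_trans _ _ (2 * (um - t) * (9 / 2 * eps * um) + 9 / 2 * eps * um * (um - t))).
    apply: (le_trans (ler_normD _ _)); apply: lerD; last exact: dgb.
    have t0 : 0 <= 2 * (um - t) by lra.
    by rewrite normrM normrN (ger0_norm t0) ler_wpM2l // addrC.
  rewrite -subr_ge0; set d := (X in 0 <= X).
  have -> : d = eps * um * (48 * um - 27 / 2 * (um - t)) by rewrite /d; field.
  by rewrite mulr_ge0 //; lra.
rewrite eul subr0 => /le_trans; apply; rewrite ger0_norm ?subr_ge0 //.
rewrite -subr_ge0; set d := (X in 0 <= X).
  have -> : d = eps * (v - ul) * (20 * (um - v) ^+ 2 - 48 * um ^+ 2) by rewrite /d; field.
rewrite mulr_ge0 ?mulr_ge0 ?subr_ge0 //.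
(* Near [ul] the other factor is large: [20 (um - v) ^ 2] is at least [80 um ^ 2], above the needed
   48. *)
have h : 2 * um <= um - v by lra.
by nra.
Qed.

(** Integrating the equation once leaves a constant. It is determined at [+oo], since a convergent
    function cannot have a derivative with nonzero limit. The profile then starts strictly between
    two equilibria and cannot reach either. *)
Lemma shock_profile_facts (R : realType) (um ul : R) (f d2 V : R -> R) (eps : R) :
  0 < um -> flux um eps f (derive1 f) d2 -> is_left_state um f ul ->
  is_shock_profile um f ul V ->
  [/\ forall x : R, is_derive x 1 V (derive1 V x), continuous (derive1 V),
      forall x, derive1 V x = shock_rhs um f (derive1 f) (V x),
      shock_rhs um f (derive1 f) ul = 0 & forall x, ul < V x < um].
Proof.
move=> um0 fl [/andP[l1 l2] sE] [[dV2 cV2] ode Vl Vr V0].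
set s := shock_speed um f ul in sE ode.
have ulum : ul < um by lra.
have Ful : shock_rhs um f (derive1 f) ul = 0.
  rewrite /shock_rhs -sE /s /shock_speed; field; rewrite subr_eq0 gt_eqF //.
have dV (x : R) : is_derive x 1 V (derive1 V x).
  by rewrite derive1E; apply: derivableP; exact: (dV2 0%N).
have ddV (x : R) : is_derive x 1 (derive1 V) (derive1n 2 V x).
  by rewrite /= [X in is_derive _ _ _ X]derive1E; apply: derivableP; exact: (dV2 1%N).
have cV : continuous V by move=> x; exact: is_derive_cont (dV x).
have cdV : continuous (derive1 V) by move=> x; exact: is_derive_cont (ddV x).
have dfV (x : R) : is_derive x 1 (f \o V) (derive1 f (V x) * derive1 V x).
  exact: dfun_comp (flux_d1 fl (V x)) (dV x).
pose J x := derive1 V x - f (V x) + s * V x.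
have dJ (x : R) : is_derive x 1 J 0.
  apply: (is_derive_eq (dfunD (dfunB (ddV x) (dfV x)) (dfunZ s (dV x)))).
  by rewrite -ode (derive1E (f \o V)) (@derive_val _ _ _ _ _ _ _ (dfV x)); ring.
have JE x : derive1 V x = f (V x) - s * V x + J 0.
  by have := is_derive_0_is_cst x 0 dJ; rewrite -[LHS]/(J x) /J => <-; ring.
have cf : continuous f by move=> x; exact: is_derive_cont (flux_d1 fl x).
pose c := f um - s * um + J 0.
have c0 : c = 0.
  apply/eqP; apply: contraT => cN0.
  have cp : 0 < `|c| / 4 by rewrite divr_gt0 // normr_gt0.
  have hV : derive1 V x @[x --> +oo] --> c.
    rewrite (_ : derive1 V = fun x => f (V x) - s * V x + J 0); last first.
      by apply/funext => x; exact: JE.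
    apply: cvgD; last exact: cvg_cst.
    apply: cvgB; last by apply: cvgM; [exact: cvg_cst|exact: Vr].
    by apply: continuous_cvg; [exact: cf|exact: Vr].
  have /cvgrPdist_lt/(_ _ cp)[M1 [_ h1]] := hV.
  have /cvgrPdist_lt/(_ _ cp)[M2 [_ h2]] := Vr.
  pose x := Num.max M1 M2 + 1.
  have x1 : M1 < x by rewrite /x ltr_pwDr // le_max lexx.
  have x2 : M2 < x by rewrite /x ltr_pwDr // le_max lexx orbT.
  have xx : x < x + 1 by rewrite ltrDl.
  have [|y] := MVT xx (fun t _ => dV t); first exact: continuous_subspaceT.
  rewrite in_itv /= => /andP[y1 y2] e0; have e : V (x + 1) - V x = derive1 V y by rewrite e0; ring.
  have a1 := h1 y (lt_trans x1 y1); have a2 := h2 x x2; have a3 := h2 _ (lt_trans x2 xx).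
  have : `|c| < `|c| / 4 + (`|c| / 4 + `|c| / 4).
    have {1}-> : c = (c - derive1 V y) + ((um - V x) - (um - V (x + 1))) by rewrite -e; ring.
    apply: (le_lt_trans (ler_normD _ _)); apply: ltrD => //.
    by apply: (le_lt_trans (ler_normB _ _)); exact: ltrD.
  by have := normr_ge0 c; lra.
have odeF x : derive1 V x = shock_rhs um f (derive1 f) (V x).
  have J0 : J 0 = s * um - f um by move: c0; rewrite /c; lra.
  by rewrite JE J0 /shock_rhs -sE; ring.
have dF (v : R) : is_derive v 1 (shock_rhs um f (derive1 f)) (derive1 f v - derive1 f um).
  apply: (is_derive_eq (dfunB (dfunB (flux_d1 fl v) (dfuncst v _))
    (dfunZ _ (dfunB (dfunid v) (dfuncst v um))))); ring.
have cdF : continuous (fun v => derive1 f v - derive1 f um).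
  by move=> v; apply: cvgB; [exact: is_derive_cont (flux_d2 fl v)|exact: cvg_cst].
have dVF (t : R) : is_derive t 1 V (shock_rhs um f (derive1 f) (V t)) by rewrite -odeF.
have Fum : shock_rhs um f (derive1 f) um = 0 by rewrite /shock_rhs; ring.
have V0m : V 0 < um by rewrite V0; lra.
have V0l : ul < V 0 by rewrite V0; lra.
split => // x; apply/andP; split; last first.
  apply: stay_below => // t; apply: equilibrium_not_reached dVF dF cdF Fum _.
  by rewrite lt_eqF.
rewrite -ltrN2; apply: (@stay_below _ (fun x => - V x)) => [t|t|].
- by apply: cvgN; exact: cV.
- rewrite eqr_opp; apply: equilibrium_not_reached dVF dF cdF Ful _.
  by rewrite gt_eqF.
- by rewrite ltrN2.
Qed.

(** * The rarefaction wave *)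

Lemma derive_slope (R : realType) (g : R -> R) (x l M : R) : is_derive x 1 g l ->
  (forall z, 0 <= (g z - g x) * (z - x) <= M * (z - x) ^+ 2) -> 0 <= l <= M.
Proof.
move=> /is_derive1_caratheodory[h [gh ch <-]] gM.
have H e : 0 < e -> - e <= h x <= M + e.
  move=> e0; have /cvgrPdist_lt/(_ _ e0)/nbhs_ballP[d /= d0 hd] := ch.
  have dd : ball x d (x + d / 2).
    by rewrite /ball /= opprD addNKr normrN gtr0_norm ?divr_gt0 // ltr_pdivrMr // ltr_pMr // ltr1n.
  have := hd _ dd; have := gM (x + d / 2); rewrite gh -mulrA -expr2.
  have -> : x + d / 2 - x = d / 2 by rewrite addrAC subrr add0r.
  have p0 : 0 < (d / 2) ^+ 2 by rewrite exprn_gt0 // divr_gt0.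
  rewrite pmulr_lge0 // ler_pM2r // ltr_norml => /andP[a1 a2] /andP[b1 b2].
  by apply/andP; split; lra.
apply/andP; split.
  by apply/ler_addgt0Pl => e e0; have /andP[] := H e e0; lra.
by apply/ler_addgt0Pr => e e0; have /andP[] := H e e0.
Qed.

Lemma tanh_lt1 (R : realType) (x : R) : `|tanh x| < 1.
Proof.
have a := expR_gt0 x; have b := expR_gt0 (- x).
have ab : 0 < expR x + expR (- x) by rewrite addr_gt0.
rewrite /tanh normrM normfV (gtr0_norm ab) ltr_pdivrMr // mul1r ltr_norml.
by apply/andP; split; lra.
Qed.

Lemma is_derive_tanh (R : realType) (x : R) : is_derive x 1 (@tanh R) (1 - tanh x ^+ 2).
Proof.
have ab : expR x + expR (- x) != 0 by rewrite gt_eqF // addr_gt0 ?expR_gt0.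
have dN := dfun_comp (is_derive_expR (- x)) (dfunN (dfunid x)).
have dn := dfunB (is_derive_expR x) dN.
have dd := dfunD (is_derive_expR x) dN.
have dv : is_derive x 1 (fun y => (expR y + expR (- y))^-1) _ := @is_deriveV _ _ x _ 1 ab dd.
apply: (is_derive_eq (dfunM dn dv)); rewrite /tanh /GRing.scale /=; field.
exact: ab.
Qed.

Lemma tanh_incr (R : realType) (x y : R) : x <= y -> 0 <= tanh y - tanh x <= y - x.
Proof.
move=> xy; have [|c _ ->] := MVT_segment xy (fun t _ => is_derive_tanh t).
  by apply: continuous_subspaceT => t; exact: is_derive_cont (is_derive_tanh t).
have := tanh_lt1 c; rewrite ltr_norml => /andP[h1 h2].
have h : 0 <= 1 - tanh c ^+ 2 by nra.
have yx : 0 <= y - x by rewrite subr_ge0.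
by rewrite mulr_ge0 //= ler_piMl // lerBlDr lerDl sqr_ge0.
Qed.

(** The partial derivatives are only known to be continuous, so the increment is split: the change
    in time at the moving abscissa uses the mean value theorem and joint continuity of the time
    derivative, the change in space the chain rule in one variable. *)
Lemma is_derive_line (R : realType) (w : R -> R -> R) (D : set (R * R)) (g c s : R) :
  open D -> Cn2 1 D w -> D (s, g + c * s) ->
  is_derive s 1 (fun s => w s (g + c * s))
    (time_derive w s (g + c * s) + c * space_derive w s (g + c * s)).
Proof.
move=> oD [_ [dw [ct _] [cs _]]] Ds; set y := g + c * s.
have dx : is_derive y 1 (w s) (space_derive w s y).
  by rewrite /space_derive derive1E; apply: derivableP; exact: (dw (s, y) Ds).2.
have dl (r : R) : is_derive r 1 (fun s => g + c * s) c.
  by apply: (is_derive_eq (dfunD (dfuncst r g) (dfunZ c (dfunid r)))); rewrite add0r mulr1.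
have d2 : is_derive s 1 (fun r => w s (g + c * r)) (space_derive w s y * c).
  exact: (@dfun_comp _ (w s) (fun r => g + c * r) s _ _ dx (dl s)).
suff d1 : is_derive s 1 (fun r => w r (g + c * r) - w s (g + c * r)) (time_derive w s y).
  have := dfunD d1 d2; rewrite (mulrC _ c).
  by rewrite (_ : (fun r => _ + _) = (fun r => w r (g + c * r))) //; apply/funext => r; rewrite subrK.
apply/is_derive1_caratheodory.
exists (fun z => if z == s then time_derive w s y
                 else (w z (g + c * z) - w s (g + c * z)) / (z - s)); split.
- move=> z; rewrite subrr subr0; case: eqP => [->|/eqP]; first by rewrite !subrr mulr0.
  by rewrite -subr_eq0 => /divfK->.
- apply/cvgrPdist_lt => e e0; rewrite eqxx.
  have /cvgrPdist_lt/(_ _ e0) := ct _ Ds.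
  have /= nD : nbhs (s, y) D by apply: open_nbhs_nbhs.
  move=> /(filterI nD)/nbhs_ballP[d /= d0 hd].
  have nl : \forall z \near s, `|y - (g + c * z)| < d.
    have cl : (fun r => g + c * r) z @[z --> s] --> y by exact: is_derive_cont (dl s).
    by have /cvgrPdist_lt/(_ _ d0) := cl.
  near=> z.
  have zd : `|s - z| < d.
    by near: z; apply/nbhs_normP; exists d.
  have zl : `|y - (g + c * z)| < d by near: z.
  case: eqP => [_|/eqP zs]; first by rewrite subrr normr0.
  have B r : `|s - r| <= `|s - z| -> (D (r, g + c * z) /\
      `|time_derive w s y - time_derive w r (g + c * z)| < e).
    by move=> rz; apply: hd; split => //=; rewrite /ball /= (le_lt_trans rz).
  have dr r : `|s - r| <= `|s - z| -> is_derive r 1 (w ^~ (g + c * z)) (time_derive w r (g + c * z)).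
    move=> /B[Dr _]; rewrite /time_derive derive1E; apply: derivableP.
    exact: (dw (r, g + c * z) Dr).1.
  have [r rz ->] : exists2 r, `|s - r| <= `|s - z| &
      (w z (g + c * z) - w s (g + c * z)) / (z - s) = time_derive w r (g + c * z).
    have H a b : a < b -> (a = s /\ b = z) \/ (a = z /\ b = s) ->
      exists2 r, `|s - r| <= `|s - z| & w b (g + c * z) - w a (g + c * z) =
        time_derive w r (g + c * z) * (b - a).
      move=> ab h.
      have I r : a <= r -> r <= b -> `|s - r| <= `|s - z|.
        case: h => -[ea eb] h1 h2; subst a b.
          by rewrite !(distrC s) !ger0_norm ?subr_ge0 ?(ltW ab) // lerB.
        by rewrite !ger0_norm ?subr_ge0 ?(ltW ab) // lerB.
      have [||r] := @MVT R (w ^~ (g + c * z)) (fun r => time_derive w r (g + c * z)) a b ab.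
      + by move=> r; rewrite in_itv /= => /andP[/ltW h1 /ltW h2]; apply: dr; exact: I.
      + apply: continuous_in_subspaceT => r; rewrite inE /= in_itv /= => /andP[h1 h2].
        exact: is_derive_cont (dr r (I r h1 h2)).
      + rewrite in_itv /= => /andP[/ltW h1 /ltW h2] E; exists r => //; exact: I.
    have [sz|sz|sz] := ltgtP s z; last by rewrite sz eqxx in zs.
    - have [r h1 h2] := H s z sz (or_introl (conj erefl erefl)).
      by exists r => //; rewrite h2 mulfK // subr_eq0.
    - have [r h1 h2] := H z s sz (or_intror (conj erefl erefl)).
      have sz0 : s - z != 0 by rewrite subr_eq0 eq_sym.
      have flip (a b : R) : (a - b) / (z - s) = (b - a) / (s - z).
        by rewrite -(opprB b a) -(opprB s z) invrN mulrNN.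
      by exists r => //; rewrite flip h2 mulfK.
  by have [_] := B r rz.
- by rewrite eqxx.
Unshelve. all: by end_near. Qed.

(** Characteristics without solving for them: along the straight line through [(t, x)] of speed
    [c = w t x], the difference [z] of [w] and [c] satisfies a linear equation and vanishes at time
    [t], hence at all earlier positive times by Gronwall. *)
Lemma burgers_implicit (R : realType) (lm lp : R) (w : R -> R -> R) (t x : R) :
  is_burgers_wave lm lp w -> 0 < t -> w t x = w 0 (x - t * w t x).
Proof.
move=> [smooth cw eqn _] t0; set c := w t x; set g := x - t * c.
pose D := [set p : R * R | 0 < p.1].
have oD : open D by apply: (@open_comp _ _ fst [set y : R | 0 < y]);
  [move=> p _; exact: cvg_fst|exact: open_gt].
have xE : g + c * t = x by rewrite /g; ring.
pose z s := w s (g + c * s) - c.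
have dz (s : R) : 0 < s -> is_derive s 1 z (- z s * space_derive w s (g + c * s)).
  move=> s0; apply: (is_derive_eq (dfunB (is_derive_line oD (smooth 1%N) _) (dfuncst s c))) => //.
  have := eqn s (g + c * s) s0; set a := time_derive _ _ _; set b := space_derive _ _ _.
  by rewrite /z => /eqP; rewrite addr_eq0 => /eqP ->; rewrite subr0; ring.
have z0 (s : R) : 0 < s -> s <= t -> z s = 0.
  move=> s0 st.
  have pos (r : R) : r \in `[s, t] -> 0 < r by rewrite in_itv /= => /andP[h _]; exact: lt_le_trans h.
  pose b r := space_derive w r (g + c * r).
  have cb : {within `[s, t], continuous (fun r => `|b r|)}.
    apply: continuous_in_subspaceT => r; rewrite inE /= => /pos r0; apply: cvg_norm.
    have [_ [_ _ [cs _]]] := smooth 1%N.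
    have cl : (fun r => g + c * r) y @[y --> r] --> g + c * r.
      by apply: cvgD; [exact: cvg_cst|apply: cvgM; [exact: cvg_cst|exact: cvg_id]].
    have cp : (y, g + c * y) @[y --> r] --> (r, g + c * r) by exact: cvg_pair cvg_id cl.
    exact: cvg_comp cp (cs (r, g + c * r) r0).
  (* The space derivative is not known to be bounded down to time 0, so its maximum is taken on
     [[s, t]] only; time 0 is reached afterwards by continuity of [w]. *)
  have [m _ bm] := EVT_max st cb; pose K : R := `|b m|.
  pose P (r : R) : R := z r ^+ 2 * expR (2 * K * r).
  have dP (r : R) : 0 < r -> is_derive r 1 P (2 * z r ^+ 2 * (K - b r) * expR (2 * K * r)).
    move=> r0.
    have h2 := dfun_comp (is_derive_expR (2 * K * r)) (dfunZ (2 * K) (dfunid r)).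
    by apply: (is_derive_eq (dfunM (dfunX 2 (dz r r0)) h2)); rewrite /b /=; ring.
  have [||r rst e] := @MVT_segment R P (fun r => 2 * z r ^+ 2 * (K - b r) * expR (2 * K * r)) s t st.
  - move=> r; rewrite in_itv /= => /andP[sr _]; apply: dP; exact: lt_trans sr.
  - apply: continuous_in_subspaceT => r; rewrite inE /= => /pos r0.
    exact: is_derive_cont (dP r r0).
  have Pt : P t = 0 by rewrite /P /z xE subrr expr0n /= mul0r.
  have : P s <= 0.
    rewrite -Pt -subr_ge0 e; apply: mulr_ge0; last by rewrite subr_ge0.
    apply: mulr_ge0; last exact: expR_ge0.
    apply: mulr_ge0; first by rewrite mulr_ge0 // sqr_ge0.
    by rewrite subr_ge0 (le_trans (ler_norm _)) // bm.
  rewrite /P pmulr_lle0 ?expR_gt0 // => h; apply/eqP; rewrite -sqrf_eq0.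
  by rewrite eq_le h sqr_ge0.
apply/eqP; rewrite -subr_eq0 -normr_le0; apply/ler_addgt0Pl => e e0; rewrite addr0.
have h : within [set p : R * R | 0 <= p.1] (nbhs (0, g)) (fun p => `|w 0 g - w p.1 p.2| < e).
  have /subspace_continuousP/(_ (0, g)) H := cw.
  by have /cvgrPdist_lt/(_ _ e0) := H (lexx 0).
have [d d0 hd] : exists2 d, 0 < d & forall s, 0 <= s -> `|s| < d -> `|c * s| < d ->
    `|w 0 g - w s (g + c * s)| < e.
  move: h => /nbhs_ballP[d /= d0 hd]; exists d => // s s0 sd cd.
  apply: (hd (s, g + c * s)) => //=; split; rewrite /ball /= ?sub0r ?normrN //.
  by rewrite opprD addNKr normrN.
pose s := Num.min t (d / (2 * (1 + `|c|))).
have c1 : 0 < 1 + `|c| by rewrite ltr_pwDl.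
have s0 : 0 < s by rewrite lt_min t0 divr_gt0 // mulr_gt0.
have sd : (1 + `|c|) * s < d.
  have : s <= d / (2 * (1 + `|c|)) by rewrite ge_min lexx orbT.
  rewrite ler_pdivlMr ?mulr_gt0 // => h1.
  by have : 0 < (1 + `|c|) * s by [rewrite mulr_gt0|]; lra.
have st : s <= t by rewrite ge_min lexx.
have := hd s (ltW s0); rewrite (gtr0_norm s0) normrM (gtr0_norm s0).
have /eqP := z0 s s0 st; rewrite subr_eq0 => /eqP ->.
rewrite distrC => H; apply/ltW/H.
  by apply: le_lt_trans sd; rewrite mulrDl mul1r lerDl mulr_ge0 // ltW.
by apply: le_lt_trans sd; rewrite mulrDl mul1r lerDr ltW.
Qed.

(** The integral over [[- n, n]] telescopes to that of [M] over two windows of length [2 k], whence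
    the bound [4 * k * B] for every [n]. Differences of functions squeezed between two translates of
    [M] are thus integrable. *)
Lemma mono_diff_integ (R : realType) (M : R -> R) (B k : R) : continuous M ->
  {homo M : x y / x <= y} -> (forall x, `|M x| <= B) -> 0 <= k ->
  mu.-integrable setT (EFin \o (fun x => M (x + k) - M (x - k))).
Proof.
move=> cM mM MB k0; pose P := int0 M.
have acP : ac M P by apply: ac_int0 => a b; exact: continuous_integ.
have B0 : 0 <= B by exact: le_trans (MB 0).
have PB a b : `|P b - P a| <= B * `|b - a|.
  by apply: MVT_le => [x|x _]; [exact: ac_derive cM acP|exact: MB].
have acD := ac_B (ac_shift k acP) (ac_shift (- k) acP).
have cD : continuous (fun x => M (x + k) - M (x - k)).
  have cs (s : R) : continuous (fun x => M (x + s)).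
    move=> x; apply: (@continuous_comp _ _ _ (fun x => x + s) M); last exact: cM.
    by apply: cvgD; [exact: cvg_id|exact: cvg_cst].
  by move=> x; apply: cvgB; [exact: (cs k)|exact: (cs (- k))].
have kk (x : R) : x - k <= x + k by lra.
have [||n|n|//] := @integ_of_bound R (fun x => M (x + k) - M (x - k)) (4 * k * B).
- exact: continuous_meas.
- by move=> x; rewrite subr_ge0 mM.
- exact: acD.1.
have nn : - n%:R <= n%:R :> R by have h : 0 <= n%:R :> R by []; move: h; lra.
rewrite -acD.2 //; have := PB (n%:R - k) (n%:R + k); have := PB (- n%:R - k) (- n%:R + k).
have E (x : R) : x + k - (x - k) = 2 * k by ring.
have k2 : 0 <= 2 * k by rewrite mulr_ge0.
rewrite !E (ger0_norm k2) => /ler_normlP[a1 a2] /ler_normlP[b1 b2].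
have -> : 4 * k * B = 2 * (B * (2 * k)) by ring.
lra.
Qed.

(** The properties shared by the shock profile and by the rarefaction wave at a fixed time. *)
Definition profile (R : realType) (lo hi : R) (V : R -> R) : Prop :=
  [/\ forall x : R, is_derive x 1 V (derive1 V x), continuous (derive1 V),
      exists K, forall x, 0 <= derive1 V x <= K & forall x, lo <= V x <= hi].

Lemma profile_ac (R : realType) (lo hi : R) (V : R -> R) : profile lo hi V -> ac (derive1 V) V.
Proof. by case=> dV cV _ _; exact: C1_ac. Qed.

Lemma profile_integ (R : realType) (lo hi : R) (V : R -> R) : profile lo hi V ->
  mu.-integrable setT (EFin \o derive1 V) /\ \int[mu]_x derive1 V x <= hi - lo.
Proof.
move=> pV; have acV := profile_ac pV; have [dV cV [K VK] Vb] := pV.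
apply: integ_of_bound => [|x|n|n]; first exact: continuous_meas.
- by have /andP[] := VK x.
- exact: acV.1.
rewrite -acV.2; last by have := ler0n R n; lra.
have /andP[_ h1] := Vb n%:R; have /andP[h2 _] := Vb (- n%:R); lra.
Qed.

(** A quotient of Caratheodory slopes; the injectivity hypothesis keeps the slope of [F] nonzero
    away from [x], and [a != 0] does so at [x]. *)
Lemma is_derive_implicit (R : realType) (F V W : R -> R) (x a b : R) :
  is_derive (V x) 1 F a -> is_derive x 1 W b -> a != 0 -> {for x, continuous V} ->
  (forall y, F (V y) = F (V x) -> V y = V x) -> (forall y, F (V y) = W y) ->
  is_derive x 1 V (b / a).
Proof.
move=> /is_derive1_caratheodory[h [Fh ch ha]] /is_derive1_caratheodory[k [Wk ck kb]] a0 cV inj FW.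
have h0 y : h (V y) != 0.
  apply/eqP => hy; have := Fh (V y); rewrite hy mul0r => /eqP; rewrite subr_eq0 => /eqP /inj e.
  by move: hy; rewrite e ha => /eqP; rewrite (negPf a0).
apply/is_derive1_caratheodory; exists (fun y => k y / h (V y)); split.
- move=> y; have := Wk y; rewrite -!FW Fh => e.
  by apply: (mulfI (h0 y)); rewrite e; field; exact: h0.
- apply: cvgM => //; apply: cvgV; first exact: h0.
  exact: (@continuous_comp _ _ _ V h).
- by rewrite kb ha.
Qed.

(** All is read off the implicit formula: the data are increasing and Lipschitz, and both properties
    pass to later times with the same constant. The final sandwich between translates of the data
    serves the integrability of differences of rarefaction profiles. *)
Lemma burgers_profile (R : realType) (lm lp : R) (w : R -> R -> R) :
  lm < lp -> is_burgers_wave lm lp w ->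
  [/\ continuous (w 0), forall x y, x <= y -> w 0 x <= w 0 y,
      forall t, 0 < t -> profile lm lp (w t),
      forall t x, 0 <= t -> lm < w t x < lp &
      forall t x, 0 < t -> w 0 (x - t * lp) <= w t x <= w 0 (x - t * lm)].
Proof.
move=> lmp bw; have [smooth _ _ w0E] := bw.
have imp t x : 0 < t -> w t x = w 0 (x - t * w t x) by exact: burgers_implicit bw.
pose M := (lp - lm) / 2; have M0 : 0 < M by rewrite divr_gt0 // subr_gt0.
have w0I x y : x <= y -> 0 <= w 0 y - w 0 x <= M * (y - x).
  move=> /tanh_incr /andP[h1 h2]; rewrite !w0E -/M opprD addrACA subrr add0r -mulrBr.
  by rewrite mulr_ge0 ?(ltW M0) //= ler_pM2l.
have mono x y : x <= y -> w 0 x <= w 0 y.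
  by move=> /w0I /andP[]; rewrite subr_ge0.
have w0b x : lm < w 0 x < lp.
  rewrite w0E; have := tanh_lt1 x; rewrite ltr_norml => /andP[h1 h2].
  have : 0 < M * (tanh x + 1) by rewrite mulr_gt0 //; lra.
  have : 0 < M * (1 - tanh x) by rewrite mulr_gt0 //; lra.
  by rewrite /M => h3 h4; apply/andP; split; lra.
have wb t x : 0 < t -> lm < w t x < lp by move=> t0; rewrite (imp t x t0); exact: w0b.
have wI t x y : 0 < t -> x <= y -> 0 <= w t y - w t x <= M * (y - x).
  move=> t0 xy; have ex := imp t x t0; have ey := imp t y t0.
  set a := w t x in ex *; set b := w t y in ey *.
  have yx : 0 <= M * (y - x) by rewrite mulr_ge0 ?(ltW M0) // subr_ge0.
  have ab : a <= b.
    rewrite leNgt; apply/negP => ba; suff : a <= b by rewrite leNgt ba.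
    rewrite ex ey; apply: mono.
    by have : 0 < t * (a - b) by [rewrite mulr_gt0 // subr_gt0|]; lra.
  have tab : 0 <= t * (b - a) by rewrite mulr_ge0 ?(ltW t0) // subr_ge0.
  rewrite subr_ge0 ab /=.
  (* If the feet of the two characteristics are in reverse order, then [b <= a]. Otherwise they are
     no farther apart than [x] and [y], because [a <= b]. *)
  have [h|h] := lerP (y - t * b) (x - t * a).
    by apply: le_trans yx; rewrite subr_le0 ex ey mono.
  have /andP[_] := w0I _ _ (ltW h); rewrite -ex -ey => h2; apply: le_trans h2 _.
  by rewrite ler_pM2l //; lra.
split => //; last 2 first.
- by move=> t x; rewrite le_eqVlt => /predU1P[<-|/wb//]; exact: w0b.
- move=> t x t0; have /andP[h1 h2] := wb t x t0.
  have a1 : t * lm <= t * w t x by rewrite ler_pM2l // ltW.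
  have a2 : t * w t x <= t * lp by rewrite ler_pM2l // ltW.
  have : w 0 (x - t * lp) <= w 0 (x - t * w t x) <= w 0 (x - t * lm).
    by apply/andP; split; apply: mono; rewrite lerB.
  by rewrite -imp.
- rewrite (_ : w 0 = fun x => (lm + lp) / 2 + M * tanh x); last by apply/funext => x; exact: w0E.
  by move=> x; exact: is_derive_cont (dfunD (dfuncst x _) (dfunZ M (is_derive_tanh x))).
- move=> t t0; have [_ [dw _ [cs _]]] := smooth 1%N.
  have dx (x : R) : is_derive x 1 (w t) (derive1 (w t) x).
    by rewrite derive1E; apply: derivableP; exact: (dw (t, x) t0).2.
  split => //.
  + move=> x; have cp : (t, y) @[y --> x] --> (t, x) by exact: cvg_pair (cvg_cst _) cvg_id.
    exact: cvg_comp cp (cs (t, x) t0).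
  + exists M => x; apply: derive_slope (dx x) _ => z.
    have [xz|/ltW zx] := leP x z.
      have /andP[h1 h2] := wI t x z t0 xz; have xz' : 0 <= z - x by rewrite subr_ge0.
      by rewrite mulr_ge0 //= expr2 mulrA ler_wpM2r.
    have /andP[h1 h2] := wI t z x t0 zx; have xz' : 0 <= x - z by rewrite subr_ge0.
    rewrite -mulrNN -sqrrN !opprB mulr_ge0 //= expr2 mulrA ler_wpM2r //.
  + by move=> x; have /andP[/ltW -> /ltW ->] := wb t x t0.
Qed.

Lemma flux_speed_slope (R : realType) (um eps up : R) (f d1 d2 : R -> R) (a b : R) :
  0 < um -> flux um eps f d1 d2 -> eps <= 1 / 3 -> up <= 2 * um ->
  um <= a -> a <= b -> b <= up -> 5 * um * (b - a) <= d1 b - d1 a.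
Proof.
move=> um0 fl e3 up2 ua ab bu.
have [|c] := MVT_segment ab (fun t _ => flux_d2 fl t).
  by apply: continuous_subspaceT => t; exact: is_derive_cont (flux_d2 fl t).
rewrite in_itv /= => /andP[h1 h2] ->.
rewrite ler_wpM2r ?subr_ge0 //.
have /ler_normlP[h _] := flux_eps fl c.
have c0 : um <= c by lra.
have c0' : 0 <= c by lra.
rewrite (ger0_norm c0') in h.
(* For [c] in [[um, 2 um]] the error is at most [um], so [6 c] loses at most that and stays above
   [5 um]. *)
have h3 : eps * (um + c) <= 1 / 3 * (3 * um) by apply: ler_pM => //; [exact: flux_eps_ge0 fl|lra|lra].
lra.
Qed.

Lemma flux_d2_ge (R : realType) (um eps : R) (f d1 d2 : R -> R) (v : R) :
  0 < um -> flux um eps f d1 d2 -> eps <= 1 / 3 -> um <= v <= 2 * um -> 5 * um <= d2 v.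
Proof.
move=> um0 fl e3 /andP[h1 h2].
have /ler_normlP[h _] := flux_eps fl v.
have c0' : 0 <= v by lra.
rewrite (ger0_norm c0') in h.
have h3 : eps * (um + v) <= 1 / 3 * (3 * um) by apply: ler_pM => //; [exact: flux_eps_ge0 fl|lra|lra].
lra.
Qed.

(** The slope of [f'] is at least [5 um] on [[um, up]], so regularity and monotonicity pass from [w]
    to its inverse image. The second claim serves to compare the profile at time [t] with a
    translate of the initial one: after applying [f'], both lie between two translates of [w 0]. *)
Lemma rarefaction_facts (R : realType) (um up eps sigma : R) (f : R -> R) (w : R -> R -> R) :
  0 < um -> um < up -> up <= 2 * um -> Cn 3 f ->
  flux um eps f (derive1 f) (derive1 (derive1 f)) -> eps <= 1 / 3 ->
  is_burgers_wave (derive1 f um) (derive1 f up) w ->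
  let uR := rarefaction um up f sigma w in
  (forall t, 0 <= t -> profile um up (uR t)) /\
  forall t s, 0 <= t -> mu.-integrable setT (EFin \o (fun x => uR 0 (x + s) - uR t x)).
Proof.
move=> um0 uup up2 cf fl e3 bw uR.
have umup := ltW uup; set F := derive1 f in fl bw *; set F2 := derive1 F in fl *.
have slope a b : um <= a -> a <= b -> b <= up -> 5 * um * (b - a) <= F b - F a.
  exact: (flux_speed_slope um0 fl e3 up2).
have slopeN a b : a \in `[um, up] -> b \in `[um, up] -> 5 * um * `|b - a| <= `|F b - F a|.
  have G c d : um <= c -> c <= d -> d <= up -> 5 * um * `|d - c| <= `|F d - F c|.
    move=> h1 h2 h3; have h := slope c d h1 h2 h3.
    by rewrite ger0_norm ?subr_ge0 // (le_trans h) // ler_norm.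
  rewrite !in_itv /= => /andP[a1 a2] /andP[b1 b2].
  have [ab|/ltW ba] := leP a b; first exact: G.
  by rewrite distrC (distrC (F b)); exact: G.
have um5 : 0 < 5 * um by rewrite mulr_gt0.
have inj : {in `[um, up] &, injective F}.
  move=> a b ha hb e; have := slopeN _ _ ha hb; rewrite e subrr normr0.
  by rewrite pmulr_rle0 // normr_le0 subr_eq0 => /eqP.
have lmp : F um < F up.
  rewrite -subr_gt0; apply: lt_le_trans (slope _ _ (lexx _) umup (lexx _)).
  by rewrite mulr_gt0 // subr_gt0.
have cF : continuous F by move=> t; exact: is_derive_cont (flux_d2 fl t).
have surj y : F um <= y <= F up -> (F @` `[um, up]) y.
  move=> h; have [|c cu e] := @IVT R F um up y umup (continuous_subspaceT cF).
    by rewrite (min_idPl (ltW lmp)) (max_idPr (ltW lmp)).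
  by exists c.
have [cw0 mono prof wb sand] := burgers_profile lmp bw.
pose W t xi := w (1 + t) (xi + sigma * (1 + t)).
have Wb t xi : 0 <= t -> F um <= W t xi <= F up.
  by move=> t0; have /andP[/ltW-> /ltW->] : F um < W t xi < F up by apply: wb; rewrite addr_ge0.
have FV t xi : 0 <= t -> F (uR t xi) = W t xi.
  by move=> t0; rewrite /uR /rarefaction pinvK // inE; exact/surj/Wb.
have Vb t xi : 0 <= t -> uR t xi \in `[um, up].
  move=> t0; have sj : set_surj `[um, up] (F @` `[um, up]) F by [].
  have := surjpinv_image_sub sj; apply; exists (W t xi) => //; exact/surj/Wb.
have cV t : 0 <= t -> continuous (uR t).
  move=> t0 x; apply/cvgrPdist_le => e e0.
  have t1 : 0 < 1 + t by rewrite ltr_pwDl.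
  have [dw _ _ _] := prof _ t1.
  have cW : W t y @[y --> x] --> W t x.
    apply: (@continuous_comp _ _ _ (fun x => x + sigma * (1 + t))); last exact: is_derive_cont (dw _).
    by apply: cvgD; [exact: cvg_id|exact: cvg_cst].
  have e5 : 0 < 5 * um * e by rewrite mulr_gt0.
  have /cvgrPdist_le/(_ _ e5) := cW; apply: filterS => y.
  rewrite -!FV // => h; rewrite -(ler_pM2l um5); apply: le_trans h.
  by apply: slopeN; exact: Vb.
split=> [t t0|t s t0]; last first.
  have t1 : 0 < 1 + t by rewrite ltr_pwDl.
  pose a1 := `|s + sigma - F up|; pose a2 := `|s + sigma - F um|.
  pose a3 := `|sigma * (1 + t) - (1 + t) * F up|; pose a4 := `|sigma * (1 + t) - (1 + t) * F um|.
  (* The sum dominates the four displacements which the sandwich [sand] produces at the two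
     times. *)
  pose k := a1 + a2 + a3 + a4.
  have [p1 p2 p3 p4] : [/\ 0 <= a1, 0 <= a2, 0 <= a3 & 0 <= a4] by split; exact: normr_ge0.
  have k0 : 0 <= k by rewrite !addr_ge0.
  have B x : `|w 0 x| <= `|F um| + `|F up|.
    have /andP[h1 h2] := wb 0 x (lexx 0).
    have /ler_normlP[h3 h4] := lexx `|F um|; have /ler_normlP[h5 h6] := lexx `|F up|.
    by apply/ler_normlP; split; lra.
  have I := integZ (5 * um)^-1 measurableT (mono_diff_integ cw0 mono B k0).
  have arg (c x : R) : `|c| <= k -> w 0 (x - k) <= w 0 (x + c) <= w 0 (x + k).
    by move=> /ler_normlP[h1 h2]; apply/andP; split; apply: mono; lra.
  have W0 x : w 0 (x - k) <= W 0 (x + s) <= w 0 (x + k).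
    have := sand 1 (x + s + sigma) ltr01; rewrite !mul1r => /andP[h1 h2].
    have /andP[h3 _] := arg (s + sigma - F up) x ltac:(rewrite -/a1 /k; lra).
    have /andP[_ h4] := arg (s + sigma - F um) x ltac:(rewrite -/a2 /k; lra).
    rewrite /W addr0 mulr1; apply/andP; split.
      by apply: le_trans h3 _; move: h1; rewrite !addrA.
    by apply: le_trans h4; move: h2; rewrite !addrA.
  have Wt x : w 0 (x - k) <= W t x <= w 0 (x + k).
    have /andP[h1 h2] := sand (1 + t) (x + sigma * (1 + t)) t1.
    have /andP[h3 _] := arg (sigma * (1 + t) - (1 + t) * F up) x ltac:(rewrite -/a3 /k; lra).
    have /andP[_ h4] := arg (sigma * (1 + t) - (1 + t) * F um) x ltac:(rewrite -/a4 /k; lra).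
    rewrite /W; apply/andP; split.
      by apply: le_trans h3 _; move: h1; rewrite !addrA.
    by apply: le_trans h4; move: h2; rewrite !addrA.
  apply: integ_le I => //.
    apply: continuous_meas => //; move=> x; apply: cvgB; last exact: cV.
    apply: (@continuous_comp _ _ _ (fun x => x + s)); last exact: cV.
    by apply: cvgD; [exact: cvg_id|exact: cvg_cst].
  move=> x _; rewrite ler_pdivlMl //.
  apply: le_trans (slopeN _ _ (Vb t x t0) (Vb 0 (x + s) (lexx 0))) _.
  rewrite !FV //; have /andP[h1 h2] := W0 x; have /andP[h3 h4] := Wt x.
  by apply/ler_normlP; split; lra.
have t1 : 0 < 1 + t by rewrite ltr_pwDl.
have [dw cdw [K wK] _] := prof _ t1.
have dW (x : R) : is_derive x 1 (W t) (derive1 (w (1 + t)) (x + sigma * (1 + t))).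
  have h := dfunD (dfunid x) (dfuncst x (sigma * (1 + t))).
  by apply: (is_derive_eq (dfun_comp (dw _) h)); rewrite addr0 mulr1.
have V2 x : um <= uR t x <= 2 * um.
  by have := Vb t x t0; rewrite in_itv /= => /andP[-> h]; exact: le_trans up2.
have F25 x : 5 * um <= F2 (uR t x) := flux_d2_ge um0 fl e3 (V2 x).
have F20 x : F2 (uR t x) != 0 by rewrite gt_eqF // (lt_le_trans um5).
have dV (x : R) : is_derive x 1 (uR t) (derive1 (w (1 + t)) (x + sigma * (1 + t)) / F2 (uR t x)).
  apply: (is_derive_implicit (flux_d2 fl _) (dW x)) => //.
  - exact: cV.
  - by move=> y; apply: inj; exact: Vb.
  - by move=> y; exact: FV.
have dVE x : derive1 (uR t) x = derive1 (w (1 + t)) (x + sigma * (1 + t)) / F2 (uR t x).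
  by rewrite derive1E; have [_ ->] := dV x.
split.
- by move=> x; rewrite dVE; exact: dV.
- rewrite (funext dVE) => x; apply: cvgM.
    apply: (@continuous_comp _ _ _ (fun x => x + sigma * (1 + t))); last exact: cdw.
    by apply: cvgD; [exact: cvg_id|exact: cvg_cst].
  apply: cvgV => //; apply: (@continuous_comp _ _ _ (uR t)); first exact: cV.
  apply: differentiable_continuous; apply/derivable1_diffP; exact: (cf.1 2%N).
- exists (K / (5 * um)) => x; rewrite dVE; have /andP[h1 h2] := wK (x + sigma * (1 + t)).
  have h3 := lt_le_trans um5 (F25 x).
  rewrite divr_ge0 ?(ltW h3) //=; apply: ler_pM => //; first by rewrite invr_ge0 ltW.
  by rewrite lef_pV2 // posrE.
- by move=> x; have := Vb t x t0; rewrite in_itv.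
Qed.

(** * The shock functional *)

Lemma zeval_derive (R : realType) (p : seq Z) (x : R) : is_derive x 1 (zeval p) (zeval (zderiv p) x).
Proof.
elim: p x => [|c p IH] x /=; first exact: dfuncst.
apply: (is_derive_eq (dfunD (dfuncst x (Zring R c)) (dfunM (dfunid x) (IH x)))).
by rewrite zevalD /=; ring.
Qed.

Lemma zeval_bounded (R : realFieldType) (p : seq Z) :
  exists2 K : R, 0 <= K & forall x, 0 <= x <= 1 -> `|zeval p x| <= K.
Proof.
elim: p => [|c p [K K0 IH]]; first by exists 0 => // x _; rewrite normr0.
exists (`|Zring R c| + K) => [|x x01]; first by rewrite addr_ge0.
apply: le_trans (ler_normD _ _) _; rewrite lerD2l normrM.
have /andP[x0 x1] := x01; rewrite (ger0_norm x0); apply: le_trans (IH x x01).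
by rewrite ler_piMl.
Qed.

Lemma coef_bounded (R : realFieldType) : exists2 K : R, 1 <= K & forall x, 0 <= x <= 1 ->
  [/\ `|bA x| <= K, `|bB x| <= K & `|bC x| <= K] /\
  [/\ `|dA x| <= K, `|dB x| <= K & `|dC x| <= K].
Proof.
have H p : exists2 K : R, 0 <= K & forall x, 0 <= x <= 1 -> `|zeval p x / 2| <= K.
  have [K K0 h] := zeval_bounded R p; exists K => // x /h hx.
  by rewrite normrM (gtr0_norm (_ : 0 < 2^-1)) // ler_pdivrMr // (le_trans hx) // ler_peMr // ler1n.
have [k1 p1 h1] := H cA; have [k2 p2 h2] := H cB; have [k3 p3 h3] := H cC.
have [k4 p4 h4] := H (zderiv cA); have [k5 p5 h5] := H (zderiv cB); have [k6 p6 h6] := H (zderiv cC).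
exists (1 + k1 + k2 + k3 + k4 + k5 + k6) => [|x hx]; first by lra.
have := h1 x hx; have := h2 x hx; have := h3 x hx.
have := h4 x hx; have := h5 x hx; have := h6 x hx.
rewrite -/(bA x) -/(bB x) -/(bC x) -/(dA x) -/(dB x) -/(dC x) => *.
by split; split; lra.
Qed.

Lemma mono_bounds (R : realFieldType) (z m : R) (N := m ^+ 2 + z ^+ 2 + z ^+ 4) :
  [/\ `|z ^+ 2| <= N, `|z ^+ 3| <= N & `|z ^+ 4| <= N] /\
  [/\ `|z * m| <= N, `|z ^+ 2 * m| <= N & `|m ^+ 2| <= N].
Proof.
have h1 : 0 <= m ^+ 2 := sqr_ge0 m; have h2 : 0 <= z ^+ 2 := sqr_ge0 z.
have h4 : 0 <= z ^+ 4 by rewrite (exprM z 2 2) sqr_ge0.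
have sq : forall a b : R, 0 <= (a + b) ^+ 2 by move=> a b; exact: sqr_ge0.
have e1 := sq z (z ^+ 2); have e2 := sq z (- z ^+ 2).
have e3 := sq z m; have e4 := sq z (- m).
have e5 := sq (z ^+ 2) m; have e6 := sq (z ^+ 2) (- m).
have t1 : (z + z ^+ 2) ^+ 2 = z ^+ 2 + 2 * z ^+ 3 + z ^+ 4 by ring.
have t2 : (z + - z ^+ 2) ^+ 2 = z ^+ 2 - 2 * z ^+ 3 + z ^+ 4 by ring.
have t3 : (z + m) ^+ 2 = z ^+ 2 + 2 * (z * m) + m ^+ 2 by ring.
have t4 : (z + - m) ^+ 2 = z ^+ 2 - 2 * (z * m) + m ^+ 2 by ring.
have t5 : (z ^+ 2 + m) ^+ 2 = z ^+ 4 + 2 * (z ^+ 2 * m) + m ^+ 2 by ring.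
have t6 : (z ^+ 2 + - m) ^+ 2 = z ^+ 4 - 2 * (z ^+ 2 * m) + m ^+ 2 by ring.
rewrite t1 in e1; rewrite t2 in e2; rewrite t3 in e3; rewrite t4 in e4; rewrite t5 in e5; rewrite t6 in e6.
rewrite /N; move: (z ^+ 2) (z ^+ 3) (z ^+ 4) (z * m) (z ^+ 2 * m) (m ^+ 2) h1 h2 h4 e1 e2 e3 e4 e5 e6 {t1 t2 t3 t4 t5 t6 N sq} => z2 z3 z4 zm z2m m2 *.
split; split; apply/ler_normlP; split; lra.
Qed.

Lemma affine_bounds (R : realFieldType) (x : R) : 0 <= x <= 1 ->
  [/\ `|x * (1 - x)| <= 1, `|1 - 2 * x| <= 1, `|15 * (3 * x - 2) - 3| <= 33,
      `|3 + 3 * x| <= 6 & `|7 - 3 * x| <= 7].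
Proof.
move=> /andP[x0 x1]; have xx : 0 <= x * x := mulr_ge0 x0 x0.
have xy : 0 <= x * (1 - x) by rewrite mulr_ge0 // subr_ge0.
by split; apply/ler_normlP; split; lra.
Qed.

(** Here [a], [Q], [r] and [l] are the perturbed weight, the perturbed density, the ratio of the
    derivative of the profile to that of the cubic one, and the ratio of amplitudes. The inequality
    is [core_positivity] times [9 (1 - x) ^ 2], with [p = 3 (1 - x) psi]. The margin in [m ^+ 2]
    absorbs the errors in front of [Ly] and [Lm], which contain [m], and is then discarded. *)
Lemma core_perturb (R : archiRealFieldType) : exists2 rho : R, 0 < rho <= 1 &
  forall (x p z m a Q r l : R) (v := 27 * x * (1 - x) ^+ 2), 0 <= x < 1 -> `|a - (7 - 3 * x)| <= rho ->
  `|Q - ((15 * (3 * x - 2) - 3) * z ^+ 2 + (3 + 3 * x) * z ^+ 3 + 3 / 4 * z ^+ 4)|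
     <= rho * (z ^+ 2 + z ^+ 4) ->
  `|r - 1| <= rho -> `|l - 1| <= rho ->
  800^-1 * (p ^+ 2 + r * v * (z ^+ 2 + z ^+ 4)) <=
  a * p ^+ 2 + 9 * x * (1 - x) * Lz x z m * p
  + r * v * (Q + l * Ly x z m + Lm x z m * (a * z + z ^+ 2 / 2)).
Proof.
have [K K1 HK] := coef_bounded R.
have K0 : 0 < K by lra.
have K195 : 0 < 400 * (195 * K) by lra.
(* Here [195 = 139 + 2 * 28], from the bounds [aS] and [aT] below; the error then amounts to
   [1 / 400], half of the margin. *)
exists (400 * (195 * K))^-1; set rho := (_^-1).
  by rewrite invr_gt0 K195 /= (invf_le1 K195); lra.
have rho0 : 0 < rho by rewrite invr_gt0.
have rhoE : rho * (195 * K) = 400^-1 by rewrite /rho; field; rewrite gt_eqF //; lra.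
have rho400 : rho <= 800^-1.
  have h : rho <= rho * K by rewrite ler_peMr // ltW.
  have e : rho * (195 * K) = 195 * (rho * K) by ring.
  by move: rhoE h; rewrite e; move: (rho * K) => t; lra.
move=> x p z m a Q r l v /andP[x0 x1] ha hQ hr hl.
have x01 : 0 <= x <= 1 by rewrite x0 ltW.
pose q0 := (15 * (3 * x - 2) - 3) * z ^+ 2 + (3 + 3 * x) * z ^+ 3 + 3 / 4 * z ^+ 4.
rewrite -/q0 in hQ.
have y0 : 0 < 1 - x by rewrite subr_gt0.
have := core_positivity (p / (3 * (1 - x))) z m x01.
set ly := Ly x z m; set lm := Lm x z m; set lz := Lz x z m; set N := m ^+ 2 + z ^+ 2 + z ^+ 4.
have v0 : 0 <= v by rewrite /v; apply: mulr_ge0; [lra|exact: sqr_ge0].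
set psi := p / _; rewrite -/ly -/lm -/lz -/N => core.
have pE : p = 3 * (1 - x) * psi by rewrite /psi mulrC divfK // mulf_neq0 // gt_eqF.
have core' : 200^-1 * (p ^+ 2 + v * N) <= (7 - 3 * x) * p ^+ 2 + 9 * x * (1 - x) * lz * p
    + v * (q0 + ly + lm * ((7 - 3 * x) * z + z ^+ 2 / 2)).
  have c9 : 0 <= 9 * (1 - x) ^+ 2 by apply: mulr_ge0 => //; exact: sqr_ge0.
  have := ler_wpM2l c9 core; rewrite -subr_ge0 => h; rewrite -subr_ge0; apply: le_trans h _.
  by rewrite le_eqVlt; apply/orP; left; apply/eqP; rewrite pE /v /N /q0; field.
have [[b1 b2 b3] [b4 b5 b6]] := HK x x01.
have [[m1 m2 m3] [m4 m5 m6]] := mono_bounds z m; rewrite -/N in m1 m2 m3 m4 m5 m6.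
have N0 : 0 <= N := le_trans (normr_ge0 _) m1.
have [xx x2 g33 g6 g7] := affine_bounds x01.
have bD1 : `|bD R| <= 1 by rewrite /bD ger0_norm; clear; lra.
have mm (c e ce ee : R) : `|c| <= ce -> `|e| <= ee -> `|c * e| <= ce * ee.
  by move=> h1 h2; rewrite normrM ler_pM.
have aLy : `|ly| <= 16 * K * N.
  have t1 := mm _ _ _ _ x2 (mm _ _ _ _ b1 m1).
  have t2 : `|bD R * z ^+ 3| <= 1 * N by exact: mm.
  have t2' := mm _ _ _ _ x2 t2.
  have t3 := mm _ _ _ _ x2 (mm _ _ _ _ b2 m4).
  have t4 := mm _ _ _ _ xx (mm _ _ _ _ b4 m1).
  have t5 := mm _ _ _ _ xx (mm _ _ _ _ b5 m4).
  have t6 := mm _ _ _ _ b6 m6.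
  have KN : 1 * N <= K * N by rewrite ler_wpM2r.
  have -> : ly = 3 * ((1 - 2 * x) * (bA x * z ^+ 2) + (1 - 2 * x) * (bD R * z ^+ 3)
     + (1 - 2 * x) * (bB x * (z * m)) + x * (1 - x) * (dA x * z ^+ 2)
     + x * (1 - x) * (dB x * (z * m))) + dC x * m ^+ 2 / 3 by rewrite /ly /Ly; field.
  move: t1 t2' t3 t4 t5 t6 KN; clear.
  move: ((1 - 2 * x) * (bA x * z ^+ 2)) ((1 - 2 * x) * (bD R * z ^+ 3)) ((1 - 2 * x) * (bB x * (z * m)))
   (x * (1 - x) * (dA x * z ^+ 2)) (x * (1 - x) * (dB x * (z * m))) (dC x * m ^+ 2) => u1 u2 u3 u4 u5 u6.
  rewrite !mul1r => /ler_normlP[? ?] /ler_normlP[? ?] /ler_normlP[? ?] /ler_normlP[? ?] /ler_normlP[? ?] /ler_normlP[? ?] ?.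
  by apply/ler_normlP; split; lra.
have aLmz : `|lm * z| <= 11 * K * N.
  have t1 := mm _ _ _ _ xx (mm _ _ _ _ b2 m1).
  have t2 := mm _ _ _ _ b3 m4.
  have -> : lm * z = 9 * (x * (1 - x) * (bB x * z ^+ 2)) + 2 * (bC x * (z * m)) by rewrite /lm /Lm; ring.
  move: t1 t2; clear.
  move: (x * (1 - x) * (bB x * z ^+ 2)) (bC x * (z * m)) => u1 u2.
  by rewrite !mul1r => /ler_normlP[? ?] /ler_normlP[? ?]; apply/ler_normlP; split; lra.
have aLmz2 : `|lm * z ^+ 2| <= 11 * K * N.
  have t1 := mm _ _ _ _ xx (mm _ _ _ _ b2 m2).
  have t2 := mm _ _ _ _ b3 m5.
  have -> : lm * z ^+ 2 = 9 * (x * (1 - x) * (bB x * z ^+ 3)) + 2 * (bC x * (z ^+ 2 * m)) by rewrite /lm /Lm; ring.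
  move: t1 t2; clear.
  move: (x * (1 - x) * (bB x * z ^+ 3)) (bC x * (z ^+ 2 * m)) => u1 u2.
  by rewrite !mul1r => /ler_normlP[? ?] /ler_normlP[? ?]; apply/ler_normlP; split; lra.
have aq0 : `|q0| <= 40 * K * N.
  have t1 : `|(15 * (3 * x - 2) - 3) * z ^+ 2| <= 33 * N by exact: mm.
  have t2 : `|(3 + 3 * x) * z ^+ 3| <= 6 * N by exact: mm.
  have KN : 1 * N <= K * N by rewrite ler_wpM2r.
  move: t1 t2 m3 KN; rewrite /q0; clear.
  move: ((15 * (3 * x - 2) - 3) * z ^+ 2) ((3 + 3 * x) * z ^+ 3) (z ^+ 4) => u1 u2 u3.
  by rewrite mul1r => /ler_normlP[? ?] /ler_normlP[? ?] /ler_normlP[? ?] ?; apply/ler_normlP; split; lra.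
pose S := q0 + ly + lm * ((7 - 3 * x) * z + z ^+ 2 / 2); rewrite -/S in core'.
have aS : `|S| <= 139 * K * N.
  have t : `|(7 - 3 * x) * (lm * z)| <= 7 * (11 * K * N) by exact: mm.
  have -> : S = q0 + ly + ((7 - 3 * x) * (lm * z) + lm * z ^+ 2 / 2) by rewrite /S; ring.
  have KN : 0 <= K * N by rewrite mulr_ge0 // ltW.
  move: aq0 aLy aLmz2 t KN; clear.
  move: ((7 - 3 * x) * (lm * z)) (lm * z ^+ 2) => u1 u2.
  by move=> /ler_normlP[? ?] /ler_normlP[? ?] /ler_normlP[? ?] /ler_normlP[? ?] ?; apply/ler_normlP; split; lra.
set T := (Q - q0) + (l - 1) * ly + (a - (7 - 3 * x)) * (lm * z).
have rN : rho * N <= rho * (K * N).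
  by rewrite ler_pM2l // -[leLHS]mul1r ler_wpM2r.
have aT : `|T| <= 28 * (rho * (K * N)).
  have t1 := mm _ _ _ _ hl aLy; have t2 := mm _ _ _ _ ha aLmz.
  have zz : z ^+ 2 + z ^+ 4 <= N by rewrite /N -addrA lerDr sqr_ge0.
  have t3 : `|Q - q0| <= rho * (K * N) by apply: le_trans hQ _; apply: le_trans rN; rewrite ler_pM2l.
  move: t1 t2 t3; rewrite /T; clear.
  move: ((l - 1) * ly) ((a - (7 - 3 * x)) * (lm * z)) (Q - q0) => u1 u2 u3.
  by move=> /ler_normlP[? ?] /ler_normlP[? ?] /ler_normlP[? ?]; apply/ler_normlP; split; lra.
have /andP[r0 r2] : 0 <= r <= 2.
  by have /ler_normlP[] := hr; move: rho400; clear; move=> *; apply/andP; split; lra.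
have aE : `|(r - 1) * S + r * T| <= 400^-1 * N.
  have t1 := mm _ _ _ _ hr aS; have t2 : `|r * T| <= 2 * (28 * (rho * (K * N))).
    by apply: mm => //; rewrite ger0_norm.
  have -> : 400^-1 * N = 195 * (rho * (K * N)) by rewrite -rhoE; ring.
  move: t1 t2; clear; move: ((r - 1) * S) (r * T) => u1 u2.
  by move=> /ler_normlP[? ?] /ler_normlP[? ?]; apply/ler_normlP; split; lra.
have -> : a * p ^+ 2 + 9 * x * (1 - x) * lz * p + r * v * (Q + l * ly + lm * (a * z + z ^+ 2 / 2)) =
  ((7 - 3 * x) * p ^+ 2 + 9 * x * (1 - x) * lz * p + v * S) + (a - (7 - 3 * x)) * p ^+ 2
  + v * ((r - 1) * S + r * T) by rewrite /S /T; ring.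
have p0 : 0 <= p ^+ 2 := sqr_ge0 p.
have f1 : - (800^-1 * p ^+ 2) <= (a - (7 - 3 * x)) * p ^+ 2.
  by rewrite -mulNr ler_wpM2r //; have /ler_normlP[] := ha; move: rho400; clear; lra.
have f2 : - (v * (400^-1 * N)) <= v * ((r - 1) * S + r * T).
  by rewrite -mulrN ler_wpM2l //; have /ler_normlP[h _] := aE; rewrite lerNl.
have f3 : r * v * (z ^+ 2 + z ^+ 4) <= 2 * (v * N).
  have zz : z ^+ 2 + z ^+ 4 <= N by rewrite /N -addrA lerDr sqr_ge0.
  have zz0 : 0 <= z ^+ 2 + z ^+ 4 by rewrite addr_ge0 ?sqr_ge0 // (exprM z 2 2) sqr_ge0.
  rewrite -(mulrA r); apply: ler_pM; [by []|exact: (mulr_ge0 v0 zz0)|by []|exact: (ler_wpM2l v0 zz)].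
have vN : 0 <= v * N by rewrite mulr_ge0.
move: core' f1 f2 f3 vN p0; clear.
have -> : v * (400^-1 * N) = 400^-1 * (v * N) by ring.
move: ((a - (7 - 3 * x)) * p ^+ 2) (v * ((r - 1) * S + r * T)) ((7 - 3 * x) * p ^+ 2 + 9 * x * (1 - x) * lz * p + v * S) (r * v * (z ^+ 2 + z ^+ 4)) (v * N) (p ^+ 2) => u1 u2 u3 u4 u5 u6 *; lra.
Qed.

(** [L] is the amplitude of the shock in units of [um], equal to 3 for the cubic. Normalising [x] by
    the true end states makes it fill (0, 1); the price is [y = 1 - L * (1 - x)] instead of
    [3 x - 2], and the factor [3 / L]. *)
Lemma shock_pointwise1 (R : archiRealFieldType) : exists2 rho : R, 0 < rho <= 1 &
  forall (eta eps L x d Q p z m : R) (y := 1 - L * (1 - x)),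
  0 <= eta -> 0 <= eps -> 200 * (eta + eps) <= rho ->
  `|L - 3| <= 5 * eps -> 0 < x < 1 ->
  `|d - L ^+ 3 * ((1 - x) ^+ 2 * x)| <= 20 * eps * (L ^+ 3 * ((1 - x) ^+ 2 * x)) ->
  `|Q - ((3 * (5 - eta) * y - 3) * z ^+ 2 + (5 - eta + y) * z ^+ 3 + 3 / 4 * z ^+ 4)|
    <= eps * (108 * z ^+ 2 + 10 * z ^+ 4) ->
  800^-1 * (p ^+ 2 + d * (z ^+ 2 + z ^+ 4)) <=
  (5 - eta - y) * p ^+ 2 + 9 * x * (1 - x) * Lz x z m * p
  + d * (Q + 3 / L * Ly x z m + Lm x z m * ((5 - eta - y) * z + z ^+ 2 / 2)).
Proof.
have [rho /andP[rho0 rho1] core] := core_perturb R.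
exists rho; first by rewrite rho0.
move=> eta eps L x d Q p z m y eta0 eps0 small hL /andP[x0 x1] hd hQ.
have eta1 : 200 * eta <= rho by move: small eps0 eta0; clear; lra.
have eps1 : 200 * eps <= rho by move: small eps0 eta0; clear; lra.
have epsS : 200 * eps <= 1 by exact: le_trans rho1.
have etaS : 200 * eta <= 1 by exact: le_trans rho1.
have xy : 0 < 1 - x by rewrite subr_gt0.
have s0 : 0 < (1 - x) ^+ 2 * x by rewrite mulr_gt0 // exprn_gt0.
set s := _ * x in s0 hd.
have [L1 L2] : L - 3 <= 5 * eps /\ 3 - L <= 5 * eps.
  by move: hL => /ler_normlP[]; rewrite opprB.
have L0 : 2 <= L <= 4 by move: L1 L2 epsS; clear => *; apply/andP; split; lra.
have /andP[L2' L4] := L0; have Lp : 0 < L by exact: lt_le_trans L2'.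
pose k := L / 3; pose r := d / (27 * s).
have k1 : `|k - 1| <= 2 * eps.
  by move: L1 L2 eps0; rewrite /k; clear => *; apply/ler_normlP; split; lra.
have k3 : `|k ^+ 3 - 1| <= 7 * eps.
  have -> : k ^+ 3 - 1 = (k - 1) * (k ^+ 2 + k + 1) by ring.
  have kk : `|k ^+ 2 + k + 1| <= 31 / 10.
    have /ler_normlP[a1 a2] := k1.
    have a3 : `|k - 1| <= 1 / 100 by apply: le_trans k1 _; move: epsS; clear; lra.
    have -> : k ^+ 2 + k + 1 = (k - 1) * (k - 1) + 3 * (k - 1) + 3 by ring.
    have a4 : `|(k - 1) * (k - 1)| <= 1 / 100 * (1 / 100) by rewrite normrM ler_pM.
    move: a3 a4; move: (k - 1) ((k - 1) * (k - 1)) => u w; clear.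
    by move=> /ler_normlP[? ?] /ler_normlP[? ?]; apply/ler_normlP; split; lra.
  have h : `|k - 1| * `|k ^+ 2 + k + 1| <= 2 * eps * (31 / 10) by rewrite ler_pM.
  by rewrite normrM; move: h eps0; clear; move: (`|_| * `|_|) => t; lra.
have rk : `|r - k ^+ 3| <= 20 * eps * k ^+ 3.
  have s27 : 0 < (27 * s)^-1 by rewrite invr_gt0 mulr_gt0.
  have := ler_wpM2r (ltW s27) hd.
  rewrite -{1}(gtr0_norm s27) -normrM.
  have -> : (d - L ^+ 3 * s) / (27 * s) = r - k ^+ 3 by rewrite /r /k; field; rewrite gt_eqF.
  by have -> : 20 * eps * (L ^+ 3 * s) / (27 * s) = 20 * eps * k ^+ 3
    by rewrite /k; field; rewrite gt_eqF.
have hr : `|r - 1| <= rho.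
  have k2 : k ^+ 3 <= 2.
    by have /ler_normlP[_] := k3; move: epsS; clear; move: (k ^+ 3) => t; lra.
  have h : 20 * eps * k ^+ 3 <= 20 * eps * 2 by rewrite ler_wpM2l // mulr_ge0.
  move: rk k3 h eps1 eps0; clear; move: (k ^+ 3) => t.
  move=> /ler_normlP[? ?] /ler_normlP[? ?] *; apply/ler_normlP; split; lra.
have hl : `|3 / L - 1| <= rho.
  have -> : 3 / L - 1 = (3 - L) / L by rewrite mulrBl divff // gt_eqF.
  rewrite normrM normfV (gtr0_norm Lp) ler_pdivrMr // distrC; apply: le_trans hL _.
  have : rho * 2 <= rho * L by rewrite ler_pM2l.
  by move: eps1 eps0; clear; move: (rho * L) => t; lra.
have yE : y - (3 * x - 2) = (3 - L) * (1 - x) by rewrite /y; ring.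
have yd : `|y - (3 * x - 2)| <= 5 * eps.
  rewrite yE normrM distrC; apply: le_trans hL.
  by rewrite -[leRHS]mulr1 ler_wpM2l // gtr0_norm //; move: x0; clear; lra.
have ha : `|5 - eta - y - (7 - 3 * x)| <= rho.
  move: yd eps1 eta1 eta0 eps0; clear; move: y => y /ler_normlP[? ?] *.
  by apply/ler_normlP; split; lra.
have y3 : `|y| <= 3.
  move: yd epsS x0 x1; clear; move: y => y /ler_normlP[? ?] *.
  by apply/ler_normlP; split; lra.
have hQ' : `|Q - ((15 * (3 * x - 2) - 3) * z ^+ 2 + (3 + 3 * x) * z ^+ 3 + 3 / 4 * z ^+ 4)|
     <= rho * (z ^+ 2 + z ^+ 4).
  have z2 : 0 <= z ^+ 2 := sqr_ge0 z; have z4 : 0 <= z ^+ 4 by rewrite (exprM z 2 2) sqr_ge0.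
  have z3 : `|z ^+ 3| <= z ^+ 2 + z ^+ 4.
    by have [[_ + _] _] := mono_bounds z 0; rewrite expr0n /= add0r.
  have c1 : `|3 * (5 - eta) * y - 15 * (3 * x - 2)| <= 9 * eta + 75 * eps.
    have ey : `|eta * y| <= eta * 3 by rewrite normrM (ger0_norm eta0) ler_wpM2l.
    have -> : 3 * (5 - eta) * y - 15 * (3 * x - 2) = 15 * (y - (3 * x - 2)) - 3 * (eta * y) by ring.
    move: ey yd; clear; move: (eta * y) (y - (3 * x - 2)) => u w.
    by move=> /ler_normlP[? ?] /ler_normlP[? ?]; apply/ler_normlP; split; lra.
  have c2 : `|5 - eta + y - (3 + 3 * x)| <= eta + 5 * eps.
    move: yd eta0; clear; move: y => y /ler_normlP[? ?] *.
    by apply/ler_normlP; split; lra.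
  have t1 : `|(3 * (5 - eta) * y - 15 * (3 * x - 2)) * z ^+ 2| <= (9 * eta + 75 * eps) * z ^+ 2.
    by rewrite normrM (ger0_norm z2) ler_wpM2r.
  have t2 : `|(5 - eta + y - (3 + 3 * x)) * z ^+ 3| <= (eta + 5 * eps) * (z ^+ 2 + z ^+ 4).
    by rewrite normrM ler_pM.
  have t3 : 200 * (eta + eps) * (z ^+ 2 + z ^+ 4) <= rho * (z ^+ 2 + z ^+ 4).
    by rewrite ler_wpM2r // addr_ge0.
  apply: le_trans t3.
  have -> : Q - ((15 * (3 * x - 2) - 3) * z ^+ 2 + (3 + 3 * x) * z ^+ 3 + 3 / 4 * z ^+ 4) =
    (Q - ((3 * (5 - eta) * y - 3) * z ^+ 2 + (5 - eta + y) * z ^+ 3 + 3 / 4 * z ^+ 4))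
    + (3 * (5 - eta) * y - 15 * (3 * x - 2)) * z ^+ 2 + (5 - eta + y - (3 + 3 * x)) * z ^+ 3 by ring.
  have e2 : 0 <= eta * z ^+ 2 by rewrite mulr_ge0.
  have e4 : 0 <= eta * z ^+ 4 by rewrite mulr_ge0.
  have p2 : 0 <= eps * z ^+ 2 by rewrite mulr_ge0.
  have p4 : 0 <= eps * z ^+ 4 by rewrite mulr_ge0.
  have -> : 200 * (eta + eps) * (z ^+ 2 + z ^+ 4) = 200 * (eta * z ^+ 2 + eta * z ^+ 4 + eps * z ^+ 2 + eps * z ^+ 4) by ring.
  have E1 : (9 * eta + 75 * eps) * z ^+ 2 = 9 * (eta * z ^+ 2) + 75 * (eps * z ^+ 2) by ring.
  have E2 : (eta + 5 * eps) * (z ^+ 2 + z ^+ 4) = eta * z ^+ 2 + eta * z ^+ 4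
    + 5 * (eps * z ^+ 2) + 5 * (eps * z ^+ 4) by ring.
  have E3 : eps * (108 * z ^+ 2 + 10 * z ^+ 4) = 108 * (eps * z ^+ 2) + 10 * (eps * z ^+ 4) by ring.
  rewrite E1 in t1; rewrite E2 in t2; rewrite E3 in hQ.
  move: hQ t1 t2 e2 e4 p2 p4; clear.
  move: (Q - (_ + _ + _)) ((_ - 15 * _) * z ^+ 2) ((_ - (3 + 3 * x)) * z ^+ 3) => u1 u2 u3.
  move: (eta * z ^+ 2) (eta * z ^+ 4) (eps * z ^+ 2) (eps * z ^+ 4) => w1 w2 w3 w4.
  by move=> /ler_normlP[? ?] /ler_normlP[? ?] /ler_normlP[? ?] *; apply/ler_normlP; split; lra.
have dE : d = r * (27 * x * (1 - x) ^+ 2).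
  by rewrite /r /s; field; rewrite ?gt_eqF.
rewrite dE; apply: core => //.
by rewrite (ltW x0).
Qed.

Lemma shock_pointwise (R : archiRealFieldType) : exists2 rho : R, 0 < rho <= 1 &
  forall (um eta eps ul V d F H Phi M : R) (x := (V - ul) / (um - ul))
    (z := Phi / um) (m := M / um ^+ 3) (w := ((5 - eta) * um - V) * Phi + Phi ^+ 2 / 2),
  0 < um -> 0 <= eta -> 0 <= eps -> 200 * (eta + eps) <= rho ->
  `|ul + 2 * um| <= 5 * eps * um -> ul < V < um ->
  `|d - (um - V) ^+ 2 * (V - ul)| <= 20 * eps * ((um - V) ^+ 2 * (V - ul)) ->
  `|F - ((3 * ((5 - eta) * um) * V - 3 * um ^+ 2) * Phi ^+ 2 + ((5 - eta) * um + V) * Phi ^+ 3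
     + 3 / 4 * Phi ^+ 4)| <= eps * (108 * um ^+ 2 * Phi ^+ 2 + 10 * Phi ^+ 4) ->
  800^-1 * (um * H ^+ 2 + d * (um ^+ 2 * Phi ^+ 2 + Phi ^+ 4)) <=
  ((5 - eta) * um - V) * H ^+ 2 + d * F
  + um ^+ 5 * (3 * Ly x z m * (d / (um - ul)) + 9 * x * (1 - x) * Lz x z m * (H / um)
               + Lm x z m * (d * w / um ^+ 3)).
Proof.
have [rho rho01 core] := shock_pointwise1 R.
exists rho => // um eta eps ul V d F H Phi M x z m w um0 eta0 eps0 small hul /andP[uV Vu] hd hF.
have un : um != 0 by rewrite gt_eqF.
have ulu : 0 < um - ul by rewrite subr_gt0 (lt_trans uV).
pose L := (um - ul) / um; pose p := H / um ^+ 3; pose D := d / um ^+ 3; pose Q := F / um ^+ 4.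
have L0 : 0 < L by rewrite divr_gt0.
have hL : `|L - 3| <= 5 * eps.
  have -> : L - 3 = - ((ul + 2 * um) / um) by rewrite /L; field.
  by rewrite normrN normrM normfV (gtr0_norm um0) ler_pdivrMr.
have x01 : 0 < x < 1.
  have x0 : 0 < x by rewrite divr_gt0 // subr_gt0.
  have x1 : x < 1 by rewrite /x ltr_pdivrMr // mul1r ltrD2r.
  by rewrite x0.
have VE : V / um = 1 - L * (1 - x) by rewrite /L /x; field; rewrite un /= gt_eqF.
have u3 : 0 < um ^+ 3 by rewrite exprn_gt0.
have u4 : 0 < um ^+ 4 by rewrite exprn_gt0.
have hD : `|D - L ^+ 3 * ((1 - x) ^+ 2 * x)| <= 20 * eps * (L ^+ 3 * ((1 - x) ^+ 2 * x)).
  have E : L ^+ 3 * ((1 - x) ^+ 2 * x) = (um - V) ^+ 2 * (V - ul) / um ^+ 3.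
    by rewrite /L /x; field; rewrite un /= gt_eqF.
  rewrite E /D -mulrBl mulrA normrM normfV (gtr0_norm u3) ler_wpM2r // invr_ge0 ltW //.
have hQ : `|Q - ((3 * (5 - eta) * (1 - L * (1 - x)) - 3) * z ^+ 2 + (5 - eta + (1 - L * (1 - x))) * z ^+ 3 + 3 / 4 * z ^+ 4)|
    <= eps * (108 * z ^+ 2 + 10 * z ^+ 4).
  rewrite -VE.
  set A := (X in `|X|); set B := (X in _ <= X).
  have -> : A = (F - ((3 * ((5 - eta) * um) * V - 3 * um ^+ 2) * Phi ^+ 2 + ((5 - eta) * um + V) * Phi ^+ 3
     + 3 / 4 * Phi ^+ 4)) / um ^+ 4 by rewrite /A /Q /z; field.
  have -> : B = eps * (108 * um ^+ 2 * Phi ^+ 2 + 10 * Phi ^+ 4) / um ^+ 4 by rewrite /B /z; field.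
  by rewrite normrM normfV (gtr0_norm u4) ler_wpM2r // invr_ge0 ltW.
have u7 : 0 <= um ^+ 7 by rewrite exprn_ge0 // ltW.
have := ler_wpM2l u7 (core eta eps L x D Q p z m eta0 eps0 small hL x01 hD hQ).
rewrite -VE; set A := (X in X <= _); set B := (X in _ <= X).
set A' := (X in _ -> X <= _); set B' := (X in _ -> _ <= X).
have -> : A = A' by rewrite /A /A' /p /D /z; field.
suff -> : B = B' by [].
rewrite /B /B' /Q /D /p /w.
have -> : 3 / L = 3 * um / (um - ul) by rewrite /L; field; rewrite un /= gt_eqF.
move: (Lz x z m) (Ly x z m) (Lm x z m) => lz ly lm; rewrite /z.
field; rewrite un /= gt_eqF //.
Qed.

Lemma ac_ext (R : realType) (u v U W : R -> R) : ac u U ->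
  (forall x, u x = v x) -> (forall x, U x = W x) -> ac v W.
Proof. by move=> acu uv UW; rewrite -(funext uv) -(funext UW). Qed.

Lemma ac_cst (R : realType) (k : R) : ac (fun=> 0) (fun=> k).
Proof.
have c : continuous (fun _ : R => 0 : R) by move=> x; exact: cvg_cst.
exact: C1_ac c (fun x => dfuncst x k).
Qed.

Lemma ac_zeval (R : realType) (p : seq Z) (X dX : R -> R) : continuous dX ->
  (forall x : R, is_derive x 1 X (dX x)) ->
  ac (fun x => zeval (zderiv p) (X x) / 2 * dX x) (fun x => zeval p (X x) / 2).
Proof.
move=> cdX hX.
have d (x : R) : is_derive x 1 (fun x => 2^-1 * zeval p (X x)) (2^-1 * (zeval (zderiv p) (X x) * dX x)).
  exact: dfunZ (dfun_comp (zeval_derive p (X x)) (hX x)).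
have cd : continuous (fun x => 2^-1 * (zeval (zderiv p) (X x) * dX x)).
  move=> x; apply: cvgM; first exact: cvg_cst.
  apply: cvgM; last exact: cdX.
  exact: is_derive_cont (dfun_comp (zeval_derive (zderiv p) (X x)) (hX x)).
by apply: ac_ext (C1_ac cd d) _ _ => x; [rewrite mulrA (mulrC 2^-1)|rewrite mulrC].
Qed.

(** The total derivative is taken along a curve parametrised by the original variable, so the shock
    coordinate [X] is composed with and never inverted. The factor 3 before [Ly] converts the
    derivative in [y = 3 x - 2] into one in [x]. *)
Lemma ac_null_lagrangian (R : realType) (X dX z h m q : R -> R) : continuous dX ->
  (forall x : R, is_derive x 1 X (dX x)) -> ac h z -> ac q m ->
  ac (fun x => 3 * Ly (X x) (z x) (m x) * dX x
        + 9 * X x * (1 - X x) * Lz (X x) (z x) (m x) * h x + Lm (X x) (z x) (m x) * q x)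
     (fun x => 9 * X x * (1 - X x) * (bA (X x) * z x ^+ 2 + bD R * z x ^+ 3 + bB (X x) * z x * m x)
        + bC (X x) * m x ^+ 2).
Proof.
move=> cdX hX az am; have aX := C1_ac cdX hX.
have aXX := ac_Z 9 (ac_M aX (ac_B (ac_cst 1) aX)).
have aA := ac_M (ac_zeval cA cdX hX) (ac_X 2 az).
have aB := ac_M (ac_zeval cB cdX hX) (ac_M az am).
have aD := ac_Z (bD R) (ac_X 3 az).
have aC := ac_M (ac_zeval cC cdX hX) (ac_X 2 am).
apply: ac_ext (ac_D (ac_M aXX (ac_D (ac_D aA aD) aB)) aC) _ _ => x.
  rewrite /Ly /Lz /Lm /bA /bB /bC /dA /dB /dC.
  move: (zeval cA _) (zeval cB _) (zeval cC _) (zeval (zderiv cA) _) (zeval (zderiv cB) _) (zeval (zderiv cC) _).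
  by move=> a b c a' b' c'; rewrite /=; field.
rewrite /bA /bB /bC; move: (zeval cA _) (zeval cB _) (zeval cC _) => a b c; ring.
Qed.

Lemma fun_contD (R : realType) (f g : R -> R) : continuous f -> continuous g -> continuous (fun x => f x + g x).
Proof. by move=> cf cg x; apply: cvgD; [exact: cf|exact: cg]. Qed.

Lemma fun_contB (R : realType) (f g : R -> R) : continuous f -> continuous g -> continuous (fun x => f x - g x).
Proof. by move=> cf cg x; apply: cvgB; [exact: cf|exact: cg]. Qed.

Lemma fun_contM (R : realType) (f g : R -> R) : continuous f -> continuous g -> continuous (fun x => f x * g x).
Proof. by move=> cf cg x; apply: cvgM; [exact: cf|exact: cg]. Qed.

Lemma fun_cont_cst (R : realType) (k : R) : continuous (fun _ : R => k).
Proof. by move=> x; exact: cvg_cst. Qed.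

Lemma fun_contX (R : realType) (f : R -> R) n : continuous f -> continuous (fun x => f x ^+ n).
Proof.
move=> cf; elim: n => [|n IH].
  by rewrite (_ : (fun x => _) = fun=> 1); [exact: fun_cont_cst|apply/funext => x; rewrite expr0].
rewrite (_ : (fun x => _) = fun x => f x * f x ^+ n); first exact: fun_contM.
by apply/funext => x; rewrite exprS.
Qed.

Lemma fun_cont_comp (R : realType) (f g : R -> R) : continuous f -> continuous g -> continuous (fun x => f (g x)).
Proof. by move=> cf cg x; apply: (@continuous_comp _ _ _ g f); [exact: cg|exact: cf]. Qed.

Lemma B_fun_continuous (R : realType) (um eta : R) (f V phi : R -> R) :
  continuous f -> continuous (derive1 f) -> continuous V -> continuous phi ->
  continuous (fun x => B_fun um eta f (V x) (phi x)).
Proof.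
move=> cf cf1 cV cp.
have ci : continuous (int0 f).
  by apply: ac_continuous (ac_int0 _) => a b; exact: continuous_integ.
rewrite /B_fun.
rewrite (_ : (fun x => _) = (fun x => (alpha um eta - V x + phi x) * (f (V x + phi x) - f (V x))
  - (int0 f (V x + phi x) - int0 f (V x) - f (V x) * phi x)
  - (alpha um eta - V x) * derive1 f (V x) * phi x)); last first.
  by apply/funext => x; rewrite int0_shift.
have cs := fun_contD cV cp; have cfV := fun_cont_comp cf cV.
have ca := fun_contB (@fun_cont_cst R (alpha um eta)) cV.
apply: fun_contB; last exact: fun_contM (fun_contM ca (fun_cont_comp cf1 cV)) cp.
apply: fun_contB; first exact: fun_contM (fun_contD ca cp) (fun_contB (fun_cont_comp cf cs) cfV).
by apply: fun_contB; [exact: fun_contB (fun_cont_comp ci cs) (fun_cont_comp ci cV)|exact: fun_contM].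
Qed.

Lemma B_fun_bounded (R : realType) (um eta eps : R) (f d1 d2 : R -> R) :
  0 < um -> flux um eps f d1 d2 -> d1 = derive1 f -> 0 <= eta <= 1 ->
  exists2 C, 0 <= C & forall v z, `|v| <= 3 * um -> `|B_fun um eta f v z| <= C * (z ^+ 2 + z ^+ 4).
Proof.
move=> um0 fl dE e01; have eps0 := flux_eps_ge0 um0 fl.
set c := 2^-1 * (d1 um - 3 * um ^+ 2).
have u2 : 0 <= um ^+ 2 := sqr_ge0 um.
have eu : 0 <= eps * um ^+ 2 by rewrite mulr_ge0.
exists (60 * um ^+ 2 + 8 * um + 1 + `|c| + 100 * (eps * um ^+ 2) + 10 * eps) => [|v z vu].
  by have := normr_ge0 c; lra.
have := B_fun_cubic z um0 fl dE vu e01; rewrite -/c.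
have z2 : 0 <= z ^+ 2 := sqr_ge0 z; have z4 : 0 <= z ^+ 4 by rewrite (exprM z 2 2) sqr_ge0.
have z3 : `|z ^+ 3| <= z ^+ 2 + z ^+ 4.
  by have [[_ + _] _] := mono_bounds z 0; rewrite expr0n /= add0r.
have /andP[e0 e1] := e01.
have al : `|alpha um eta| <= 5 * um.
  have h : 0 <= eta * um by rewrite mulr_ge0 // ltW.
  have h' : eta * um <= 1 * um by rewrite ler_pM2r.
  by rewrite /alpha mulrBl; apply/ler_normlP; split; lra.
have c1 : `|3 * alpha um eta * v - 3 / 2 * v ^+ 2| <= 60 * um ^+ 2.
  have h1 : `|alpha um eta * v| <= 5 * um * (3 * um) by rewrite normrM ler_pM.
  have h2 : `|v * v| <= 3 * um * (3 * um) by rewrite normrM ler_pM.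
  have -> : 3 * alpha um eta * v - 3 / 2 * v ^+ 2 = 3 * (alpha um eta * v) - 3 / 2 * (v * v) by ring.
  have -> : 60 * um ^+ 2 = 60 * (um * um) by rewrite expr2.
  have E1 : 5 * um * (3 * um) = 15 * (um * um) by ring.
  have E2 : 3 * um * (3 * um) = 9 * (um * um) by ring.
  have p : 0 <= um * um by rewrite -expr2.
  rewrite E1 in h1; rewrite E2 in h2; move: h1 h2 p; clear.
  move: (alpha um eta * v) (v * v) (um * um) => a b d /ler_normlP[? ?] /ler_normlP[? ?] ?.
  by apply/ler_normlP; split; lra.
have c2 : `|alpha um eta + v| <= 8 * um.
  by move: al vu; clear; move=> /ler_normlP[? ?] /ler_normlP[? ?]; apply/ler_normlP; split; lra.
have t1 : `|z ^+ 2 * (3 * alpha um eta * v - 3 / 2 * v ^+ 2)| <= z ^+ 2 * (60 * um ^+ 2).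
  by rewrite normrM (ger0_norm z2) ler_wpM2l.
have t2 : `|z ^+ 3 * (alpha um eta + v)| <= (z ^+ 2 + z ^+ 4) * (8 * um).
  by rewrite normrM ler_pM.
have t3 : `|c * z ^+ 2| <= `|c| * z ^+ 2 by rewrite normrM (ger0_norm z2).
have q1 : 0 <= um ^+ 2 * z ^+ 4 by rewrite mulr_ge0.
have q2 : 0 <= `|c| * z ^+ 4 by rewrite mulr_ge0.
have q3 : 0 <= eps * um ^+ 2 * z ^+ 4 by rewrite mulr_ge0.
have q4 : 0 <= eps * z ^+ 2 by rewrite mulr_ge0.
have E1 : z ^+ 2 * (60 * um ^+ 2) = 60 * (um ^+ 2 * z ^+ 2) by ring.
have E2 : (z ^+ 2 + z ^+ 4) * (8 * um) = 8 * (um * z ^+ 2) + 8 * (um * z ^+ 4) by ring.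
have E3 : eps * (100 * um ^+ 2 * z ^+ 2 + 10 * z ^+ 4) = 100 * (eps * um ^+ 2 * z ^+ 2) + 10 * (eps * z ^+ 4) by ring.
rewrite E1 in t1; rewrite E2 in t2; rewrite E3.
have -> : (60 * um ^+ 2 + 8 * um + 1 + `|c| + 100 * (eps * um ^+ 2) + 10 * eps) * (z ^+ 2 + z ^+ 4)
  = 60 * (um ^+ 2 * z ^+ 2) + 60 * (um ^+ 2 * z ^+ 4) + 8 * (um * z ^+ 2) + 8 * (um * z ^+ 4)
    + z ^+ 2 + z ^+ 4 + `|c| * z ^+ 2 + `|c| * z ^+ 4 + 100 * (eps * um ^+ 2 * z ^+ 2)
    + 100 * (eps * um ^+ 2 * z ^+ 4) + 10 * (eps * z ^+ 2) + 10 * (eps * z ^+ 4) by ring.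
move: t1 t2 t3 q1 q2 q3 q4 z2 z4; clear.
move: (z ^+ 2 * _) (z ^+ 3 * _) (c * z ^+ 2) (um ^+ 2 * z ^+ 2) (um ^+ 2 * z ^+ 4) (um * z ^+ 2) (um * z ^+ 4).
move: (`|c| * z ^+ 2) (`|c| * z ^+ 4) (eps * um ^+ 2 * z ^+ 2) (eps * um ^+ 2 * z ^+ 4) (eps * z ^+ 2) (eps * z ^+ 4).
move: (z ^+ 2) (z ^+ 4) (B_fun um eta f v z) => z2 z4 B w1 w2 w3 w4 w5 w6 w7 w8 w9 w10 w11 w12 w13.
by move=> /ler_normlP[? ?] /ler_normlP[? ?] /ler_normlP[? ?] ? ? ? ? ? ? /ler_normlP[? ?];
  apply/ler_normlP; split; lra.
Qed.

Lemma cvg_nat_pinfty (R : realType) (f : R -> R) (l : R) : f x @[x --> +oo] --> l ->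
  f n%:R @[n --> \oo] --> l.
Proof.
move=> h; apply/cvgrPdist_lt => e e0.
have /cvgrPdist_lt/(_ _ e0)[M [_ hM]] := h.
by apply: filterS (nbhs_infty_gtr M) => n nM; exact: hM.
Qed.

Lemma cvg_nat_ninfty (R : realType) (f : R -> R) (l : R) : f x @[x --> -oo] --> l ->
  f (- n%:R) @[n --> \oo] --> l.
Proof.
move=> h; apply/cvgrPdist_lt => e e0.
have /cvgrPdist_lt/(_ _ e0)[M [_ hM]] := h.
by apply: filterS (nbhs_infty_gtr (- M)) => n nM; apply: hM; rewrite ltrNl.
Qed.

Lemma integ_weight (R : realType) (lo hi K : R) (V g : R -> R) : profile lo hi V ->
  measurable_fun (setT : set (measurableTypeR R)) g -> (forall x, `|g x| <= K) ->
  mu.-integrable setT (EFin \o (fun x => derive1 V x * g x)).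
Proof. by move=> pV mg gK; apply: (@integM _ _ K) => //; exact: (profile_integ pV).1. Qed.

(** Bounds on [z] and [m] suffice for these terms to disappear at both ends of the shock, thanks to
    the factor [x (1 - x)]. *)
Lemma null_boundary (R : realType) (K : R) : 0 <= K -> exists2 C, 0 <= C &
  forall x z m : R, 0 <= x <= 1 -> `|z| <= K -> `|m| <= K ->
  `|9 * x * (1 - x) * (bA x * z ^+ 2 + bD R * z ^+ 3 + bB x * z * m)| <= C * (x * (1 - x)).
Proof.
move=> K0; have [k k1 hk] := coef_bounded R; have k0 : 0 <= k by lra.
exists (9 * (k * K ^+ 2 + K ^+ 3 + k * K * K)) => [|x z m x01 zK mK].
  by rewrite mulr_ge0 // !addr_ge0 ?mulr_ge0 ?exprn_ge0.
have [[bAk bBk _] _] := hk x x01; have /andP[x0 x1] := x01.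
have xx : 0 <= x * (1 - x) by rewrite mulr_ge0 // subr_ge0.
have bD1 : `|bD R| <= 1 by rewrite /bD ger0_norm; clear; lra.
have t1 : `|bA x * z ^+ 2| <= k * K ^+ 2 by rewrite normrM normrX ler_pM // ?exprn_ge0 // lerXn2r ?nnegrE.
have t2 : `|bD R * z ^+ 3| <= 1 * K ^+ 3 by rewrite normrM normrX ler_pM // ?exprn_ge0 // lerXn2r ?nnegrE.
have t3 : `|bB x * z * m| <= k * K * K by rewrite normrM ler_pM // normrM ler_pM.
set S := (bA x * _ + _ + _).
have -> : 9 * x * (1 - x) * S = x * (1 - x) * (9 * S) by ring.
rewrite normrM (ger0_norm xx) [leRHS]mulrC ler_wpM2l //.
rewrite normrM (ger0_norm (_ : 0 <= 9)) // ler_pM2l //.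
apply: le_trans (ler_normD _ _) _; apply: lerD => //.
by apply: le_trans (ler_normD _ _) _; apply: lerD => //; rewrite -[leRHS]mul1r.
Qed.

(** The pointwise inequality is integrated over [[- n, n]], where the total derivative contributes
    only end values; the limit in [n] is taken afterwards. *)
Lemma shock_estimate (R : realType) : exists2 rho : R, 0 < rho <= 1 &
  forall (um eta eps ul : R) (f V phi h : R -> R),
  0 < um -> 0 <= eta -> flux um eps f (derive1 f) (derive1 (derive1 f)) ->
  200 * (eta + eps) <= rho -> `|ul + 2 * um| <= 5 * eps * um ->
  profile ul um V -> (forall x, ul < V x < um) ->
  (forall x, `|derive1 V x - (um - V x) ^+ 2 * (V x - ul)|
     <= 20 * eps * ((um - V x) ^+ 2 * (V x - ul))) ->
  V x @[x --> -oo] --> ul -> V x @[x --> +oo] --> um -> h1 phi h ->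
  800^-1 * (um * (\int[mu]_x (h x ^+ 2))
     + \int[mu]_x (derive1 V x * (um ^+ 2 * phi x ^+ 2 + phi x ^+ 4))) <=
  (\int[mu]_x ((alpha um eta - V x) * h x ^+ 2))
  + (\int[mu]_x (derive1 V x * (B_fun um eta f (V x) (phi x)
       + 2^-1 * (derive1 f (V x) - 2 * derive1 f um) * phi x ^+ 2)))
  + 5 / um * Y_fun um eta V phi ^+ 2.
Proof.
have [rho rho01 pw] := shock_pointwise R; exists rho => //.
move=> um eta eps ul f V phi h um0 eta0 fl small hul pV Vb hV Vl Vr hphi.
have eps0 := flux_eps_ge0 um0 fl.
have [eta1 eps1] : eta <= 1 /\ 200 * eps <= 1.
  by move: rho01 => /andP[_ r1]; split; move: small r1 eta0 eps0; clear; lra.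
have um52 x : - (5 / 2 * um) <= V x <= um.
  have ee : 5 * eps * um <= 1 / 2 * um by rewrite ler_pM2r //; move: eps1; clear; lra.
  move: hul => /ler_normlP[u1 u2]; have /andP[v1 v2] := Vb x.
  by move: u1 u2 v1 v2 ee um0; clear => *; apply/andP; split; lra.
have um3 x : `|V x| <= 3 * um.
  by have /andP[] := um52 x; move: um0; clear => *; apply/ler_normlP; split; lra.
have [K K0 phiK] := h1_bounded hphi; have [acp mh ip ih] := hphi.
have cp := ac_continuous acp; have acV := profile_ac pV; have cV := ac_continuous acV.
have [dV cdV [KV VK] _] := pV.
have V0 x : 0 <= derive1 V x by have /andP[] := VK x.
have un : um != 0 by rewrite gt_eqF.
have ulum : 0 < um - ul by have /andP[h1 h2] := Vb 0; rewrite subr_gt0 (lt_trans h1).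
have ulum0 : um - ul != 0 by rewrite gt_eqF.
pose al := alpha um eta.
pose W x := (al - V x) * phi x + phi x ^+ 2 / 2.
have cW : continuous W.
  by apply: fun_contD; [exact: fun_contM (fun_contB (@fun_cont_cst R al) cV) cp|exact: fun_contM (fun_contX cp) (@fun_cont_cst R _)].
have cVW := fun_contM cdV cW.
have alb : `|al| <= 5 * um.
  have a1 : 0 <= eta * um by rewrite mulr_ge0 // ltW.
  have a2 : eta * um <= 1 * um by rewrite ler_pM2r.
  by move: a1 a2; rewrite /al /alpha; clear => *; apply/ler_normlP; split; lra.
have Wb x : `|W x| <= 8 * um * K + K ^+ 2 / 2.
  apply: le_trans (ler_normD _ _) _; apply: lerD.
    rewrite normrM ler_pM //; apply: le_trans (ler_normB _ _) _.
    by move: alb (um3 x); clear; lra.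
  by rewrite normrM normrX (gtr0_norm (_ : 0 < 2^-1)) // ler_pM2r // lerXn2r ?nnegrE // ltW.
have iVW : mu.-integrable setT (EFin \o (fun x => derive1 V x * W x)).
  exact: integ_weight pV (continuous_meas measurableT cW) Wb.
have acP : ac (fun x => derive1 V x * W x) (int0 (fun x => derive1 V x * W x)).
  by apply: ac_int0 => a b; exact: continuous_integ.
set P := int0 _ in acP.
(* Normalised to vanish at [- n], so that the term [C m ^ 2] contributes nothing at the left end. *)
pose M n x := P x - P (- n%:R).
have acM n : ac (fun x => derive1 V x * W x) (M n).
  by apply: ac_ext (ac_B acP (ac_cst _)) _ _ => x //; rewrite subr0.
pose X (x : R) : R := (V x - ul) / (um - ul); pose dX (x : R) : R := derive1 V x / (um - ul).
have hX (x : R) : is_derive x 1 X (dX x).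
  have d := dfunZ (um - ul)^-1 (dfunB (dV x) (dfuncst x ul)).
  rewrite (_ : X = fun x => (um - ul)^-1 * (V x - ul)); last by apply/funext => y; exact: mulrC.
  by apply: (is_derive_eq d); rewrite subr0 mulrC.
have cdX : continuous dX := fun_contM cdV (@fun_cont_cst R _).
have X01 x : 0 <= X x <= 1.
  have /andP[v1 v2] := Vb x.
  have x0 : 0 <= X x by apply: divr_ge0; [rewrite subr_ge0 ltW|exact: ltW].
  have x1 : X x <= 1 by rewrite /X ler_pdivrMr // mul1r lerD2r ltW.
  by rewrite x0.
have scal (k : R) (u U : R -> R) : ac u U -> ac (fun x => u x / k) (fun x => U x / k).
  by move=> a; apply: ac_ext (ac_Z k^-1 a) _ _ => x; exact: mulrC.
pose z (x : R) : R := phi x / um; pose m (n : nat) (x : R) : R := M n x / um ^+ 3.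
have acG (n : nat) := ac_Z (um ^+ 5) (ac_null_lagrangian cdX hX (scal um _ _ acp) (scal (um ^+ 3) _ _ (acM n))).
pose G (n : nat) (x : R) : R := ( um ^+ 5 * (9 * X x * (1 - X x) * (bA (X x) * z x ^+ 2 + bD R * z x ^+ 3
   + bB (X x) * z x * m n x) + bC (X x) * m n x ^+ 2)).
pose Dn (n : nat) (x : R) : R := ( um ^+ 5 * (3 * Ly (X x) (z x) (m n x) * dX x
        + 9 * X x * (1 - X x) * Lz (X x) (z x) (m n x) * (h x / um)
        + Lm (X x) (z x) (m n x) * (derive1 V x * W x / um ^+ 3))).
have {}acG n : ac (Dn n) (G n) by exact: acG.
pose F x := B_fun um eta f (V x) (phi x)
       + 2^-1 * (derive1 f (V x) - 2 * derive1 f um) * phi x ^+ 2.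
have hF x : `|F x - ((3 * ((5 - eta) * um) * V x - 3 * um ^+ 2) * phi x ^+ 2
     + ((5 - eta) * um + V x) * phi x ^+ 3 + 3 / 4 * phi x ^+ 4)|
     <= eps * (108 * um ^+ 2 * phi x ^+ 2 + 10 * phi x ^+ 4).
  have e01 : 0 <= eta <= 1 by rewrite eta0.
  have := B_fun_cubic (phi x) um0 fl erefl (um3 x) e01.
  have := flux_d1_diff um (V x) um0 fl.
  have /andP[v1 v2] := um52 x.
  have hh : `|V x - um| * (um + `|um| + `|V x|) <= 7 / 2 * um * (9 / 2 * um).
    have vb : `|V x| <= 5 / 2 * um by move: v1 v2 um0; clear => *; apply/ler_normlP; split; lra.
    have vu : `|V x - um| <= 7 / 2 * um by move: v1 v2 um0; clear => *; apply/ler_normlP; split; lra.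
    rewrite (gtr0_norm um0) ler_pM //; first by rewrite !addr_ge0 // ltW.
    by move: vb; clear; lra.
  have {}hh := ler_wpM2l eps0 hh.
  have E0 : eps * (um + `|um| + `|V x|) * `|V x - um| = eps * (`|V x - um| * (um + `|um| + `|V x|)) by ring.
  have E1 : eps * (7 / 2 * um * (9 / 2 * um)) = 63 / 4 * (eps * um ^+ 2) by field.
  rewrite E0 => hd; rewrite E1 in hh; have {hd}hh := le_trans hd hh.
  have p2 : 0 <= phi x ^+ 2 := sqr_ge0 _.
  have {}hh := ler_wpM2r p2 hh; rewrite -{1}(ger0_norm p2) -normrM in hh.
  rewrite /F -/al /alpha => hB.
  set A := (X in `|X|).
  set u1 := (X in `|X| <= _) in hB; set u2 := (X in `|X| <= _) in hh.
  have -> : A = u1 + 2^-1 * u2 by rewrite /A /u1 /u2 /al /alpha; field.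
  (* [108 = 100 + 8]: half of the constant [63 / 4] for the increment of the slope is below 8. *)
  have -> : eps * (108 * um ^+ 2 * phi x ^+ 2 + 10 * phi x ^+ 4)
    = eps * (100 * um ^+ 2 * phi x ^+ 2 + 10 * phi x ^+ 4) + 8 * (eps * um ^+ 2 * phi x ^+ 2) by ring.
  have hp : 0 <= eps * um ^+ 2 * phi x ^+ 2.
    by apply: mulr_ge0 => //; apply: mulr_ge0 => //; exact: sqr_ge0.
  have E2 : 63 / 4 * (eps * um ^+ 2) * phi x ^+ 2 = 63 / 4 * (eps * um ^+ 2 * phi x ^+ 2) by field.
  rewrite E2 in hh; move: hh hB hp.
  move: (u1) (u2) (eps * um ^+ 2 * phi x ^+ 2) (eps * (100 * um ^+ 2 * _ + _)); clear => u1 u2 w e.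
  by move=> /ler_normlP[? ?] /ler_normlP[? ?] ?; apply/ler_normlP; split; lra.
pose J x := um * h x ^+ 2 + derive1 V x * (um ^+ 2 * phi x ^+ 2 + phi x ^+ 4).
pose I x := (al - V x) * h x ^+ 2 + derive1 V x * F x.
have JI n x : 800^-1 * J x <= I x + Dn n x.
  exact: (pw um eta eps ul (V x) (derive1 V x) (F x) (h x) (phi x) (M n x)).
have mal : measurable_fun (setT : set (measurableTypeR R)) (fun x => al - V x).
  exact: continuous_meas measurableT (fun_contB (@fun_cont_cst R al) cV).
have alVb x : `|al - V x| <= 8 * um.
  by apply: le_trans (ler_normB _ _) _; move: alb (um3 x); clear; lra.
have ih1 : mu.-integrable setT (EFin \o (fun x => (al - V x) * h x ^+ 2)).
  rewrite (_ : (fun x => _) = fun x => h x ^+ 2 * (al - V x)); last by apply/funext => x; exact: mulrC.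
  exact: (@integM _ _ (8 * um)).
have cfl : continuous f by move=> v; exact: is_derive_cont (flux_d1 fl v).
have cf1 : continuous (derive1 f) by move=> v; exact: is_derive_cont (flux_d2 fl v).
have cF : continuous F.
  apply: fun_contD; first exact: B_fun_continuous.
  by apply: fun_contM (fun_contX cp); apply: fun_contM (@fun_cont_cst R _) _; apply: fun_contB (fun_cont_comp cf1 cV) (@fun_cont_cst R _).
have polyK x : um ^+ 2 * phi x ^+ 2 + phi x ^+ 4 <= um ^+ 2 * K ^+ 2 + K ^+ 4.
  have p2 n : (phi x ^+ (2 * n)) <= K ^+ (2 * n).
    apply: le_trans (ler_norm _) _; rewrite normrX lerXn2r ?nnegrE //; exact: ltW.
  by apply: lerD; [apply: ler_wpM2l (p2 1%N); exact: sqr_ge0|exact: (p2 2%N)].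
have poly0 x : 0 <= um ^+ 2 * phi x ^+ 2 + phi x ^+ 4.
  by apply: addr_ge0; [apply: mulr_ge0; exact: sqr_ge0|rewrite (exprM (phi x) 2 2); exact: sqr_ge0].
have Fb : exists C, forall x, `|F x| <= C.
  pose c x := (3 * ((5 - eta) * um) * V x - 3 * um ^+ 2) * phi x ^+ 2
     + ((5 - eta) * um + V x) * phi x ^+ 3 + 3 / 4 * phi x ^+ 4.
  have Kp n x : `|phi x ^+ n| <= K ^+ n by rewrite normrX lerXn2r ?nnegrE // ltW.
  have aV x : `|(5 - eta) * um + V x| <= 8 * um.
    by apply: le_trans (ler_normD _ _) _; rewrite -/al; move: alb (um3 x); rewrite /al /alpha; clear; lra.
  have aV' x : `|3 * ((5 - eta) * um) * V x - 3 * um ^+ 2| <= 3 * (5 * um) * (3 * um) + 3 * um ^+ 2.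
    apply: le_trans (ler_normB _ _) _; apply: lerD.
      rewrite normrM; apply: ler_pM => //.
      by rewrite normrM (ger0_norm (_ : 0 <= 3)) //; apply: ler_wpM2l => //; exact: alb.
    by rewrite normrM ger0_norm // ger0_norm // sqr_ge0.
  have cb x : `|c x| <= (3 * (5 * um) * (3 * um) + 3 * um ^+ 2) * K ^+ 2 + 8 * um * K ^+ 3 + 3 / 4 * K ^+ 4.
    apply: le_trans (ler_normD _ _) _; apply: lerD; last first.
      by rewrite normrM ger0_norm // ler_wpM2l.
    apply: le_trans (ler_normD _ _) _; apply: lerD; rewrite normrM ler_pM //.
  exists ((3 * (5 * um) * (3 * um) + 3 * um ^+ 2) * K ^+ 2 + 8 * um * K ^+ 3 + 3 / 4 * K ^+ 4
    + eps * (108 * um ^+ 2 * K ^+ 2 + 10 * K ^+ 4)) => x.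
  rewrite -(subrK (c x) (F x)) addrC; apply: le_trans (ler_normD _ _) _; apply: lerD => //.
  apply: le_trans (hF x) _; apply: ler_wpM2l => //; apply: lerD.
    apply: ler_wpM2l; first by rewrite mulr_ge0 // sqr_ge0.
    by apply: le_trans (ler_norm _) (Kp 2%N x).
  by apply: ler_wpM2l => //; apply: le_trans (ler_norm _) (Kp 4%N x).
have [CF FC] := Fb.
have iVF : mu.-integrable setT (EFin \o (fun x => derive1 V x * F x)).
  exact: integ_weight pV (continuous_meas measurableT cF) FC.
have cpoly : continuous (fun x => um ^+ 2 * phi x ^+ 2 + phi x ^+ 4).
  by apply: fun_contD (fun_contX cp); apply: fun_contM (@fun_cont_cst R _) (fun_contX cp).
have iVp : mu.-integrable setT (EFin \o (fun x => derive1 V x * (um ^+ 2 * phi x ^+ 2 + phi x ^+ 4))).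
  apply: (@integ_weight _ _ _ (um ^+ 2 * K ^+ 2 + K ^+ 4) _ _ pV).
    exact: continuous_meas measurableT cpoly.
  by move=> x; rewrite ger0_norm.
have iJ : mu.-integrable setT (EFin \o J).
  exact: integD (integZ um measurableT ih) iVp.
have iI : mu.-integrable setT (EFin \o I) by exact: integD.
have iJ8 := integZ 800^-1 measurableT iJ.
have key n : \int[mu]_(x in symI R n) (800^-1 * J x) <=
    \int[mu]_(x in symI R n) I x + (G n n%:R - G n (- n%:R)).
  have nn : - n%:R <= n%:R :> R.
    by have p : 0 <= n%:R :> R by []; move: p; clear; lra.
  have mS : measurable (symI R n : set (measurableTypeR R)) := measurable_symI n.
  have iG : mu.-integrable (symI R n) (EFin \o Dn n) := (acG n).1 _ _.
  have iIn := integ_symI n iI; have iJn := integ_symI n iJ8.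
  rewrite (acG n).2 // -RintegralD //.
  by apply: le_Rintegral => //; exact: integD.
set Jint := (X in X <= _); have -> : Jint = \int[mu]_x (800^-1 * J x).
  rewrite /Jint RintegralZl // RintegralD //; last exact: integZ.
  by rewrite RintegralZl.
have -> : (\int[mu]_x ((alpha um eta - V x) * h x ^+ 2)) + \int[mu]_x (derive1 V x * F x) = \int[mu]_x I x.
  by rewrite RintegralD.
set Y := Y_fun _ _ _ _.
have YE : Y = \int[mu]_x (derive1 V x * W x).
  by apply: eq_Rintegral => x _; rewrite /W (mulrC _ 2^-1).
apply: (@ler_cvg_to _ \oo%classic _ R (fun n => \int[mu]_(x in symI R n) (800^-1 * J x))
  (fun n => \int[mu]_(x in symI R n) I x + (G n n%:R - G n (- n%:R)))).
- exact: (cvg_symI iJ8).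
- apply: cvgD; first exact: (cvg_symI iI).
  have mM n : m n (- n%:R) = 0 by rewrite /m /M subrr mul0r.
  have mY : m n n%:R @[n --> \oo] --> Y / um ^+ 3.
    apply: cvgM; last exact: cvg_cst.
    have := cvg_symI iVW; rewrite -YE.
    apply: cvg_trans; apply: near_eq_cvg; near=> n.
    rewrite /M acP.2 //; have p : 0 <= n%:R :> R by []. by move: p; clear; lra.
  pose BW := 8 * um * K + K ^+ 2 / 2; pose Km := BW * (um - ul) / um ^+ 3.
  have u3 : 0 < um ^+ 3 by rewrite exprn_gt0.
  have BW0 : 0 <= BW := le_trans (normr_ge0 _) (Wb 0).
  have Km0 : 0 <= Km by apply: divr_ge0; [apply: mulr_ge0 => //|]; exact: ltW.
  have mK n : `|m n n%:R| <= Km.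
    have nn : - n%:R <= n%:R :> R by have p : 0 <= n%:R :> R by []; move: p; clear; lra.
    have mS : measurable (`[- n%:R, n%:R] : set (measurableTypeR R)) := measurable_itv _.
    have iS := acP.1 (- n%:R) n%:R; have iV := acV.1 (- n%:R) n%:R.
    rewrite /m normrM normfV (gtr0_norm u3) ler_pM2r ?invr_gt0 // /M acP.2 //.
    apply: le_trans (le_normr_Rintegral mS iS) _.
    apply: (@le_trans _ _ (\int[mu]_(x in `[- n%:R, n%:R]) (BW * derive1 V x))).
      apply: le_Rintegral => //; first exact: (integrable_norm iS).
        exact: integZ.
      move=> x _; rewrite normrM (ger0_norm (V0 x)) mulrC ler_wpM2r //; exact: Wb.
    rewrite RintegralZl // -acV.2 // ler_wpM2l //.
    have /andP[_ /ltW h1] := Vb n%:R; have /andP[/ltW h2 _] := Vb (- n%:R).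
    exact: lerB.
  have Kz x : `|z x| <= K / um.
    by rewrite /z normrM normfV (gtr0_norm um0) ler_pM2r // invr_gt0.
  have [C C0 nb] := null_boundary (addr_ge0 Km0 (divr_ge0 (ltW K0) (ltW um0))).
  have Ku : K / um <= Km + K / um by rewrite lerDr.
  have Kmu : Km <= Km + K / um by rewrite lerDl divr_ge0 // ltW.
  pose N n x := 9 * X x * (1 - X x) * (bA (X x) * z x ^+ 2 + bD R * z x ^+ 3 + bB (X x) * z x * m n x).
  have cX_ l (u : R -> R) : V (u n%:R) @[n --> \oo] --> l -> X (u n%:R) @[n --> \oo] --> (l - ul) / (um - ul).
    by move=> h0; apply: cvgM; [apply: cvgB => //; exact: cvg_cst|exact: cvg_cst].
  have Xr : X n%:R @[n --> \oo] --> (1 : R).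
    by rewrite -[X in _ --> X](divff ulum0); apply: (cX_ _ id); exact: cvg_nat_pinfty.
  have Xl : X (- n%:R) @[n --> \oo] --> (0 : R).
    by rewrite -[X in _ --> X](mul0r (um - ul)^-1) -(subrr ul); apply: (cX_ _ -%R); exact: cvg_nat_ninfty.
  have N0 (u : nat -> R) (l : R) : X (u n) @[n --> \oo] --> l -> l * (1 - l) = 0 ->
      (forall n, `|m n (u n)| <= Km) -> N n (u n) @[n --> \oo] --> (0 : R).
    move=> h0 l0 hm; apply/norm_cvg0P.
    have hc : C * (X (u n) * (1 - X (u n))) @[n --> \oo] --> (0 : R).
      rewrite -(mulr0 C) -l0; apply: cvgM; first exact: cvg_cst.
      by apply: cvgM => //; apply: cvgB => //; exact: cvg_cst.
    apply: squeeze_cvgr (cvg_cst 0) hc; near=> n; rewrite normr_ge0 /=.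
    by apply: nb => //; [exact: le_trans (Kz _) Ku|exact: le_trans Kmu].
  have Nr : N n n%:R @[n --> \oo] --> (0 : R).
    by apply: (N0 (fun n => n%:R) 1) => //; rewrite subrr mulr0.
  have Nl : N n (- n%:R) @[n --> \oo] --> (0 : R).
    by apply: (N0 (fun n => - n%:R) 0) => //; [rewrite mul0r|move=> n; rewrite mM normr0].
  have GE n x : G n x = um ^+ 5 * (N n x + bC (X x) * m n x ^+ 2) by [].
  (* Only the right end value of [C m ^ 2] survives: [C] tends to 5 and [m] to [Y / um ^+ 3]. *)
  have -> : 5 / um * Y ^+ 2 = um ^+ 5 * (0 + bC (1 : R) * (Y / um ^+ 3) ^+ 2) - um ^+ 5 * 0.
    by rewrite bC1; field.
  apply: cvgB.
    apply: cvgM; first exact: cvg_cst.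
    apply: cvgD => //; apply: cvgM; last by rewrite expr2; apply: cvgM.
    apply: cvgM; last exact: cvg_cst.
    have := is_derive_cont (zeval_derive cC (1 : R)) => hc.
    exact: (cvg_comp _ _ Xr hc).
  rewrite (_ : (fun n => G n (- n%:R)) = fun n => um ^+ 5 * N n (- n%:R)).
    by apply: cvgM => //; exact: cvg_cst.
  by apply/funext => n; rewrite GE mM expr0n /= mulr0 addr0.
- by near=> n; exact: key.
Unshelve. all: by end_near. Qed.

(** * The composite profile *)

Lemma alpha_bound (R : realFieldType) (um eta : R) : 0 < um -> 0 <= eta <= 1 ->
  4 * um <= (5 - eta) * um <= 5 * um.
Proof. by move=> um0 /andP[e0 e1]; rewrite !ler_pM2r //; apply/andP; split; lra. Qed.

Lemma quad_pos (R : realFieldType) (a b c l z : R) : l < c -> b ^+ 2 <= 4 * (a - l) * (c - l) ->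
  l * (z ^+ 2 + z ^+ 4) <= a * z ^+ 2 + b * z ^+ 3 + c * z ^+ 4.
Proof.
move=> lc disc; rewrite -subr_ge0; set D := (X in 0 <= X).
have cl : 0 < c - l by rewrite subr_gt0.
rewrite -(pmulr_rge0 _ cl).
have -> : (c - l) * D = z ^+ 2 * (((c - l) * z + b / 2) ^+ 2 + (4 * (a - l) * (c - l) - b ^+ 2) / 4).
  by rewrite /D; field.
apply: mulr_ge0; first exact: sqr_ge0.
apply: addr_ge0; first exact: sqr_ge0.
by rewrite divr_ge0 // subr_ge0.
Qed.

(* The discriminant at [s = 0] is [eta ^ 2 - 3 * eta]: it vanishes at [eta = 0],
   whence the dependence on [eta] of the constant. *)
Lemma rarefaction_cubic (R : realFieldType) (eta s z : R) : 0 < eta <= 1 -> 0 <= s <= 1 / 2 ->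
  eta / 45 * (z ^+ 2 + z ^+ 4) <=
  3 * (1 + s) * (5 - eta - (1 + s)) * z ^+ 2 + (5 - eta + (1 + s)) * z ^+ 3 + 3 / 4 * z ^+ 4.
Proof.
move=> /andP[e0 e1] /andP[s0 s1]; apply: quad_pos; first by lra.
have h1 : 0 <= eta * s by rewrite mulr_ge0 // ltW.
have h2 : eta * s <= 1 * s by rewrite ler_wpM2r.
have h3 : s * s <= 1 / 2 * s by rewrite ler_wpM2r.
have h4 : eta * eta <= 1 * eta by rewrite ler_wpM2r // ltW.
have h5 : 0 <= s * s by rewrite mulr_ge0.
have h6 : 0 <= eta * (s * s) by rewrite mulr_ge0 // ltW.
have h7 : 0 <= eta * (eta * s) by rewrite mulr_ge0 // ltW.
have h8 : eta * (eta * s) <= 1 * (eta * s) by rewrite ler_wpM2r.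
have h9 : eta * (s * s) <= 1 * (s * s) by rewrite ler_wpM2r.
have h10 : 0 <= eta * eta by rewrite mulr_ge0 // ltW.
have h11 : eta * s <= eta * (1 / 2) by rewrite ler_wpM2l // ltW.
rewrite -subr_ge0; set D := (X in 0 <= X).
have -> : D = (3 + 4 / 45 * 12 * 0) * eta - eta * eta + 15 * s - 7 * (eta * s) - 10 * (s * s)
  - 3 / 45 * eta - 12 / 45 * (4 * eta - eta * eta + 3 * (eta * s) - eta * (eta * s) - eta * (s * s)) + 4 / 2025 * (eta * eta).
  by rewrite /D; field.
lra.
Qed.

(** Half of the constant [eta / 45] of [rarefaction_cubic] is spent on the flux error. The
    uncontrolled slope of the defect at [um], contained in [B_fun], is cancelled by [- f'(v) / 2] up
    to a small increment. *)
Lemma rarefaction_pointwise (R : realType) (um eta eps : R) (f d2 : R -> R) (v z : R) :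
  0 < um -> flux um eps f (derive1 f) d2 -> 0 < eta <= 1 -> um <= v <= 3 / 2 * um ->
  102 * eps <= eta / 90 ->
  eta / 90 * (um ^+ 2 * z ^+ 2 + z ^+ 4) <=
  B_fun um eta f v z - 2^-1 * derive1 f v * z ^+ 2.
Proof.
move=> um0 fl eta01 /andP[v1 v2] small; have eps0 := flux_eps_ge0 um0 fl.
have /andP[e0 e1] := eta01.
have un : um != 0 by rewrite gt_eqF.
have v0 : 0 < v by exact: lt_le_trans v1.
have vb : `|v| <= 3 * um by rewrite gtr0_norm //; move: v2 um0; clear; lra.
have e01 : 0 <= eta <= 1 by rewrite (ltW e0).
have hB := B_fun_cubic z um0 fl erefl vb e01.
have hd := flux_d1_diff um v um0 fl.
have p2 : 0 <= z ^+ 2 := sqr_ge0 z; have p4 : 0 <= z ^+ 4 by rewrite (exprM z 2 2) sqr_ge0.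
have u2 : 0 <= um ^+ 2 := sqr_ge0 um.
have hh : `|v - um| * (um + `|um| + `|v|) <= 1 / 2 * um * (7 / 2 * um).
  rewrite (gtr0_norm um0) (gtr0_norm v0) ger0_norm ?subr_ge0 //; apply: ler_pM.
  - by rewrite subr_ge0.
  - by rewrite !addr_ge0 // ltW.
  - by move: v2; clear; lra.
  - by move: v2; clear; lra.
have {}hh := ler_wpM2l eps0 hh.
have E0 : eps * (um + `|um| + `|v|) * `|v - um| = eps * (`|v - um| * (um + `|um| + `|v|)) by ring.
have E1 : eps * (1 / 2 * um * (7 / 2 * um)) = 7 / 4 * (eps * um ^+ 2) by field.
rewrite E0 in hd; rewrite E1 in hh; have {hd}hh := le_trans hd hh.
have {}hh := ler_wpM2r p2 hh; rewrite -{1}(ger0_norm p2) -normrM in hh.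
have E2 : 7 / 4 * (eps * um ^+ 2) * z ^+ 2 = 7 / 4 * (eps * um ^+ 2 * z ^+ 2) by field.
rewrite E2 in hh.
have s01 : 0 <= (v - um) / um <= 1 / 2.
  rewrite divr_ge0 ?subr_ge0 ?(ltW um0) //= ler_pdivrMr //; move: v2; clear; lra.
have core := rarefaction_cubic (z / um) eta01 s01.
have u4 : 0 <= um ^+ 4 by rewrite exprn_ge0 // ltW.
have {core} := ler_wpM2l u4 core.
have -> : um ^+ 4 * (eta / 45 * ((z / um) ^+ 2 + (z / um) ^+ 4)) = eta / 45 * (um ^+ 2 * z ^+ 2 + z ^+ 4) by field.
set C := (X in _ <= X -> _).
have -> : C = (3 * alpha um eta * v - 3 * v ^+ 2) * z ^+ 2 + (alpha um eta + v) * z ^+ 3 + 3 / 4 * z ^+ 4.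
  by rewrite /C /alpha; field.
move: hB hh; set u1 := (X in `|X| <= _); set w2 := (X in _ -> `|X| <= _ -> _) => hB hh core.
have -> : B_fun um eta f v z - 2^-1 * derive1 f v * z ^+ 2 =
  ((3 * alpha um eta * v - 3 * v ^+ 2) * z ^+ 2 + (alpha um eta + v) * z ^+ 3 + 3 / 4 * z ^+ 4)
  + u1 - 2^-1 * w2 by rewrite /u1 /w2; field.
have w1 : 0 <= eps * um ^+ 2 * z ^+ 2 by apply: mulr_ge0 => //; exact: mulr_ge0.
have w4 : 0 <= eps * z ^+ 4 by exact: mulr_ge0.
have E3 : eps * (100 * um ^+ 2 * z ^+ 2 + 10 * z ^+ 4) = 100 * (eps * um ^+ 2 * z ^+ 2) + 10 * (eps * z ^+ 4) by ring.
rewrite E3 in hB.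
have pN : 0 <= um ^+ 2 * z ^+ 2 + z ^+ 4 by apply: addr_ge0 => //; exact: mulr_ge0.
have := ler_wpM2r pN small.
have -> : 102 * eps * (um ^+ 2 * z ^+ 2 + z ^+ 4) = 102 * (eps * um ^+ 2 * z ^+ 2) + 102 * (eps * z ^+ 4) by ring.
have E4 : eta / 45 * (um ^+ 2 * z ^+ 2 + z ^+ 4) = 2 * (eta / 90 * (um ^+ 2 * z ^+ 2 + z ^+ 4)) by field.
rewrite E4 in core; move: core hB hh w1 w4.
move: (u1) (w2) (eps * um ^+ 2 * z ^+ 2) (eps * z ^+ 4) (eta / 90 * _) (_ + _ + _); clear.
move=> a b c d e g ? /ler_normlP[? ?] /ler_normlP[? ?] *; lra.
Qed.

(** The term that [A_fun] adds to [B_fun] cancels, for the cubic, the square of [v]: [A_fun] is then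
    affine in [v], with increment [3 alpha s z ^ 2 + s z ^ 3], whence [16 = 15 + 1]. The constant
    204 covers two flux errors and the increment of the slope. *)
Lemma A_fun_diff (R : realType) (um eta eps d : R) (f d2 : R -> R) (v s z : R) :
  0 < um -> flux um eps f (derive1 f) d2 -> 0 <= eta <= 1 ->
  - (5 / 2 * um) <= v <= um -> 0 <= s <= d * um -> d <= 1 / 2 ->
  `|A_fun um eta f (v + s) z - A_fun um eta f v z| <=
  (16 * d + 204 * eps) * (um ^+ 2 * z ^+ 2 + z ^+ 4).
Proof.
move=> um0 fl e01 /andP[v1 v2] /andP[s0 s1] d2'; have eps0 := flux_eps_ge0 um0 fl.
have un : um != 0 by rewrite gt_eqF.
have sd : s <= 1 / 2 * um by apply: le_trans s1 _; rewrite ler_pM2r.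
have vb : `|v| <= 3 * um by move: v1 v2 um0; clear => *; apply/ler_normlP; split; lra.
have vs : `|v + s| <= 3 * um by move: v1 v2 s0 sd um0; clear => *; apply/ler_normlP; split; lra.
have hB := B_fun_cubic z um0 fl erefl vb e01.
have hC := B_fun_cubic z um0 fl erefl vs e01.
have hd := flux_d1_diff v (v + s) um0 fl.
have p2 : 0 <= z ^+ 2 := sqr_ge0 z; have p4 : 0 <= z ^+ 4 by rewrite (exprM z 2 2) sqr_ge0.
have u2 : 0 <= um ^+ 2 := sqr_ge0 um.
have hh : `|v + s - v| * (um + `|v| + `|v + s|) <= 1 / 2 * um * (7 * um).
  have -> : v + s - v = s by ring.
  rewrite (ger0_norm s0); apply: ler_pM => //; first by rewrite !addr_ge0 // ltW.
  by move: vb vs; clear; lra.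
have {}hh := ler_wpM2l eps0 hh.
have E0 : eps * (um + `|v| + `|v + s|) * `|v + s - v| = eps * (`|v + s - v| * (um + `|v| + `|v + s|)) by ring.
have E1 : eps * (1 / 2 * um * (7 * um)) = 7 / 2 * (eps * um ^+ 2) by field.
rewrite E0 in hd; rewrite E1 in hh; have {hd}hh := le_trans hd hh.
have {}hh := ler_wpM2r p2 hh; rewrite -{1}(ger0_norm p2) -normrM in hh.
have E2 : 7 / 2 * (eps * um ^+ 2) * z ^+ 2 = 7 / 2 * (eps * um ^+ 2 * z ^+ 2) by field.
rewrite E2 in hh.
have /andP[al1 al2] := alpha_bound um0 e01.
have pN : 0 <= um ^+ 2 * z ^+ 2 + z ^+ 4 by apply: addr_ge0 => //; exact: mulr_ge0.
have t1 : `|3 * alpha um eta * s * z ^+ 2| <= 15 * (d * (um ^+ 2 * z ^+ 2)).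
  have a0 : 0 <= alpha um eta by apply: le_trans al1; apply: mulr_ge0 => //; exact: ltW.
  rewrite ger0_norm; last by apply: mulr_ge0 => //; apply: mulr_ge0 => //; apply: mulr_ge0.
  have -> : 15 * (d * (um ^+ 2 * z ^+ 2)) = 3 * (5 * um) * (d * um) * z ^+ 2 by ring.
  apply: ler_wpM2r => //; apply: ler_pM => //; first exact: mulr_ge0.
  by apply: ler_wpM2l.
have t2 : `|s * z ^+ 3| <= d * (um ^+ 2 * z ^+ 2 + z ^+ 4).
  have [[_ + _] _] := mono_bounds (z / um) 0; rewrite expr0n /= add0r => h3.
  have u3 : 0 < um ^+ 3 by rewrite exprn_gt0.
  have h4 : um * `|z ^+ 3| <= um ^+ 2 * z ^+ 2 + z ^+ 4.
    have u4 : 0 <= um ^+ 4 by rewrite exprn_ge0 // ltW.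
    have := ler_wpM2l u4 h3; rewrite -{1}(ger0_norm u4) -normrM.
    have -> : um ^+ 4 * (z / um) ^+ 3 = um * z ^+ 3 by field.
    have -> : um ^+ 4 * ((z / um) ^+ 2 + (z / um) ^+ 4) = um ^+ 2 * z ^+ 2 + z ^+ 4 by field.
    by rewrite normrM (gtr0_norm um0).
  have d0 : 0 <= d by have := le_trans s0 s1; rewrite pmulr_lge0.
  rewrite normrM (ger0_norm s0); apply: le_trans (ler_wpM2l d0 h4).
  by rewrite mulrA; apply: ler_wpM2r.
rewrite /A_fun; move: hB hC hh; set u1 := (X in `|X| <= _); set w2 := (X in _ -> `|X| <= _ -> _).
set w3 := (X in _ -> _ -> `|X| <= _ -> _) => hB hC hh.
set D := (X in `|X|).
have -> : D = w2 - u1 + 2^-1 * w3 + 3 * alpha um eta * s * z ^+ 2 + s * z ^+ 3.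
  by rewrite /D /u1 /w2 /w3; field.
have w1 : 0 <= eps * um ^+ 2 * z ^+ 2 by apply: mulr_ge0 => //; exact: mulr_ge0.
have w4 : 0 <= eps * z ^+ 4 by exact: mulr_ge0.
have d0 : 0 <= d by have := le_trans s0 s1; rewrite pmulr_lge0.
have w5 : 0 <= d * z ^+ 4 by exact: mulr_ge0.
have E3 : eps * (100 * um ^+ 2 * z ^+ 2 + 10 * z ^+ 4) = 100 * (eps * um ^+ 2 * z ^+ 2) + 10 * (eps * z ^+ 4) by ring.
rewrite E3 in hB hC; rewrite mulrDr in t2.
have -> : (16 * d + 204 * eps) * (um ^+ 2 * z ^+ 2 + z ^+ 4) = 16 * (d * (um ^+ 2 * z ^+ 2)) + 16 * (d * z ^+ 4)
  + 204 * (eps * um ^+ 2 * z ^+ 2) + 204 * (eps * z ^+ 4) by ring.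
move: hB hC hh t1 t2 w1 w4 w5.
move: (u1) (w2) (w3) (eps * um ^+ 2 * z ^+ 2) (eps * z ^+ 4) (d * (um ^+ 2 * z ^+ 2)) (d * z ^+ 4)
  (3 * alpha um eta * s * z ^+ 2) (s * z ^+ 3); clear.
move=> a b c e g i j k l /ler_normlP[? ?] /ler_normlP[? ?] /ler_normlP[? ?] /ler_normlP[? ?] /ler_normlP[? ?] *.
by apply/ler_normlP; split; lra.
Qed.

(** Nonnegativity of the integral of [p * (g - a / t) ^ 2], where [a] is the integral of [p * g];
    the mass of [p] enters through its upper bound [t]. *)
Lemma weighted_cauchy_schwarz (R : realType) (p g : R -> R) (t : R) : 0 < t ->
  (forall x, 0 <= p x) -> mu.-integrable setT (EFin \o p) -> \int[mu]_x p x <= t ->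
  mu.-integrable setT (EFin \o (fun x => p x * g x)) ->
  mu.-integrable setT (EFin \o (fun x => p x * g x ^+ 2)) ->
  (\int[mu]_x (p x * g x)) ^+ 2 <= t * (\int[mu]_x (p x * g x ^+ 2)).
Proof.
move=> t0 p0 ip pt ig ig2; set a := \int[mu]_x (p x * g x); set b := \int[mu]_x (p x * g x ^+ 2).
have h : 0 <= \int[mu]_x (p x * g x ^+ 2 - 2 * (a / t) * (p x * g x) + (a / t) ^+ 2 * p x).
  apply: Rintegral_ge0 => x _.
  have -> : p x * g x ^+ 2 - 2 * (a / t) * (p x * g x) + (a / t) ^+ 2 * p x = p x * (g x - a / t) ^+ 2 by ring.
  by rewrite mulr_ge0 // sqr_ge0.
have i1 := integZ (2 * (a / t)) measurableT ig; have i2 := integZ ((a / t) ^+ 2) measurableT ip.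
rewrite RintegralD // in h; last exact: integB.
rewrite RintegralB // RintegralZl // RintegralZl // -/a -/b in h.
have h2 : (a / t) ^+ 2 * (\int[mu]_x p x) <= (a / t) ^+ 2 * t by rewrite ler_wpM2l // sqr_ge0.
have h3 : 0 <= b - a ^+ 2 / t.
  have -> : b - a ^+ 2 / t = b - 2 * (a / t) * a + (a / t) ^+ 2 * t by field; rewrite gt_eqF.
  by apply: le_trans h _; rewrite lerD2l.
by rewrite subr_ge0 ler_pdivrMr // mulrC in h3.
Qed.

(** Where the strict inequality [kappa > 5 / um] pays: the negative square of [S] is absorbed, part
    of the total square is kept, and the loss is in [Z] alone, which is small with the rarefaction.
    The difference of the two sides is a multiple of a perfect square. *)
Lemma square_split (R : realFieldType) (k0 k S Z : R) : 0 < k0 -> k0 < k ->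
  (k - k0) / 2 * (S + Z) ^+ 2 - (k0 + 2 * k0 ^+ 2 / (k - k0)) * Z ^+ 2 <=
  k * (S + Z) ^+ 2 - k0 * S ^+ 2.
Proof.
move=> k00 kk; have d : 0 < k - k0 by rewrite subr_gt0.
rewrite -subr_ge0; set D := (X in 0 <= X).
have -> : D = ((k - k0) * (S + Z) + 2 * k0 * Z) ^+ 2 / (2 * (k - k0)).
  by rewrite /D; field; rewrite gt_eqF.
by apply: divr_ge0; [exact: sqr_ge0|rewrite mulr_ge0 // ltW].
Qed.

Lemma small_param (R : realFieldType) (A b : R) : 0 < b -> exists2 d : R, 0 < d &
  forall x, 0 <= x <= d -> A * x <= b.
Proof.
move=> b0; have a1 : 0 < `|A| + 1 by rewrite ltr_wpDl.
exists (b / (`|A| + 1)) => [|x /andP[x0]]; first by rewrite divr_gt0.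
rewrite ler_pdivlMr // => h; apply: le_trans h; rewrite mulrC ler_wpM2l //.
by apply: le_trans (ler_norm A) _; rewrite lerDl.
Qed.

(** Time has disappeared: [V], [U] and the continuous representative [phi] are functions of space.
    The order of choices matters: [eta] comes first because the rarefaction margin is [eta / 90],
    and the flux error and the strength are small relative to it. *)
Lemma composite_estimate (R : realType) (um kappa : R) : 0 < um -> 5 / um < kappa ->
  exists2 eta0 : R, 0 < eta0 & forall eta : R, 0 < eta < eta0 ->
  exists eps0 delta0 c : R, [/\ 0 < eps0, 0 < delta0, 0 < c, eps0 <= 1 / 20 & delta0 <= 1 / 2 /\
  forall (f V U phi h : R -> R) (ul up : R),
  flux um eps0 f (derive1 f) (derive1 (derive1 f)) ->
  `|ul + 2 * um| <= 5 * eps0 * um ->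
  profile ul um V -> (forall x, ul < V x < um) ->
  (forall x, `|derive1 V x - (um - V x) ^+ 2 * (V x - ul)|
     <= 20 * eps0 * ((um - V x) ^+ 2 * (V x - ul))) ->
  V x @[x --> -oo] --> ul -> V x @[x --> +oo] --> um ->
  profile um up U -> 0 < up - um -> (up - um) / um <= delta0 -> h1 phi h ->
  let ut := fun x => V x + U x - um in
  let N := fun x => um ^+ 2 * phi x ^+ 2 + phi x ^+ 4 in
  Y_fun um eta ut phi = Y_fun um eta V phi + Z_fun um eta V U ut phi /\
  c * (um * (\int[mu]_x (h x ^+ 2)) + (\int[mu]_x (derive1 ut x * N x))
       + `|kappa * Y_fun um eta ut phi| ^+ 2) <=
  (\int[mu]_x ((alpha um eta - V x) * h x ^+ 2))
  + (\int[mu]_x (derive1 V x * (B_fun um eta f (V x) (phi x)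
       + 2^-1 * (derive1 f (V x) - 2 * derive1 f um) * phi x ^+ 2)))
  + 5 / um * Y_fun um eta V phi ^+ 2
  + (\int[mu]_x (derive1 U x * (B_fun um eta f (U x) (phi x) - 2^-1 * derive1 f (U x) * phi x ^+ 2)))
  - (\int[mu]_x ((U x - um) * h x ^+ 2))
  + kappa * (Y_fun um eta V phi + Z_fun um eta V U ut phi) ^+ 2
  - 5 / um * Y_fun um eta V phi ^+ 2
  + (\int[mu]_x (derive1 V x * (A_fun um eta f (ut x) (phi x) - A_fun um eta f (V x) (phi x))))].
Proof.
move=> um0 kk; have [rho /andP[rho0 rho1] shock] := shock_estimate R.
(* The budget [200 * (eta + eps0) <= rho] is shared equally between [eta] and [eps0]. *)
exists (rho / 400) => [|eta /andP[eta0 eta1]]; first by move: rho0; clear; lra.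
have etas : 0 < eta <= 1 by rewrite eta0 /=; move: eta1 rho1; clear; lra.
pose k0 := 5 / um; have k00 : 0 < k0 by rewrite divr_gt0.
pose th := (kappa - k0) / 2; pose Kz := k0 + 2 * k0 ^+ 2 / (kappa - k0).
have kk0 : 0 < kappa - k0 by rewrite subr_gt0.
have th0 : 0 < th by rewrite divr_gt0.
have Kz0 : 0 <= Kz.
  by apply: addr_ge0; [exact: ltW|apply: divr_ge0; [apply: mulr_ge0 => //; exact: sqr_ge0|exact: ltW]].
(* The shock margin [1 / 800] is cut into eight shares [b], which pay for the increment of [A_fun],
   for [Z], for the change of weight before the squared gradient, and for [c]. *)
pose b : R := (80 * 80)^-1; have b0 : 0 < b by rewrite invr_gt0 mulr_gt0.
(* Half of the rarefaction margin [eta / 90]: one half pays for [Z], the other remains in [c]. *)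
have e180 : 0 < eta / 180 by rewrite divr_gt0.
have [d1 d10 hd1] := small_param 16 b0.
have [d2 d20 hd2] := small_param (Kz * 8 * um) b0.
have [d3 d30 hd3] := small_param (Kz * 256 * um) e180.
have [q1 q10 hq1] := small_param 204 b0.
have [q2 q20 hq2] := small_param 204 e180.
pose eps0 := Num.min (rho / 400) (Num.min (1 / 20) (Num.min q1 q2)).
pose delta0 := Num.min b (Num.min (1 / 2) (Num.min d1 (Num.min d2 d3))).
(* The bound [th / kappa ^+ 2] is there because [square_split] leaves [th] times the square of the
   functional, whereas the conclusion has the square of [kappa] times it. *)
pose c := Num.min b (Num.min (eta / 180) (th / kappa ^+ 2)).
have kap : 0 < kappa by exact: lt_trans kk.
have [Ea Eb Ec Ed] : [/\ eps0 <= rho / 400, eps0 <= 1 / 20, eps0 <= q1 & eps0 <= q2].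
  by split; rewrite /eps0 !ge_min lexx ?orbT.
have [Da Db Dc [Dd De]] : [/\ delta0 <= b, delta0 <= 1 / 2, delta0 <= d1 & delta0 <= d2 /\ delta0 <= d3].
  by split; [| | |split]; rewrite /delta0 !ge_min lexx ?orbT.
have [Ca Cb Cc] : [/\ c <= b, c <= eta / 180 & c <= th / kappa ^+ 2].
  by split; rewrite /c !ge_min lexx ?orbT.
have r400 : 0 < rho / 400 by move: rho0; clear; lra.
have ep0 : 0 < eps0 by rewrite !lt_min r400 divr_gt0 //= q10.
have de0 : 0 < delta0 by rewrite !lt_min b0 divr_gt0 //= d10 d20.
have c0 : 0 < c by rewrite !lt_min b0 e180 divr_gt0 // exprn_gt0.
exists eps0, delta0, c; split => //; split => //.
move=> f V U phi h ul up fl hul pV Vb hV Vl Vr pU up0 upd hphi ut N.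
have dd : 0 <= (up - um) / um <= delta0 by rewrite upd divr_ge0 // ltW.
set dl := (up - um) / um in dd upd.
have upE : up - um = dl * um by rewrite /dl divfK // gt_eqF.
have dl0 : 0 <= dl by case/andP: dd.
have dl12 : dl <= 1 / 2 by apply: le_trans Db.
have small : 200 * (eta + eps0) <= rho by move: eta1 Ea; clear; lra.
have SH := shock um eta eps0 ul f V phi h um0 (ltW eta0) fl small hul pV Vb hV Vl Vr hphi.
have [K K0 phiK] := h1_bounded hphi; have [acp mh ip ih] := hphi.
have cp := ac_continuous acp.
have cV := ac_continuous (profile_ac pV); have cU := ac_continuous (profile_ac pU).
have [dV cdV [KV VK] _] := pV; have [dU cdU [KU UK] Ub] := pU.
have V0 x : 0 <= derive1 V x by have /andP[] := VK x.
have U0 x : 0 <= derive1 U x by have /andP[] := UK x.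
have dut (x : R) : is_derive x 1 ut (derive1 V x + derive1 U x).
  by apply: (is_derive_eq (dfunB (dfunD (dV x) (dU x)) (dfuncst x um))); rewrite subr0.
have dutE x : derive1 ut x = derive1 V x + derive1 U x.
  by rewrite derive1E; have [_ ->] := dut x.
have ulb : - (5 / 2 * um) <= ul.
  have h2 : 5 * eps0 * um <= 1 / 2 * um.
    by rewrite ler_pM2r //; move: Ea rho1; clear; lra.
  by move: hul h2 => /ler_normlP[]; clear; lra.
have Vb' x : - (5 / 2 * um) <= V x <= um.
  by have /andP[v1 v2] := Vb x; rewrite (ltW v2) andbT (le_trans ulb) // ltW.
have Us x : 0 <= U x - um <= dl * um.
  by have /andP[u1 u2] := Ub x; rewrite subr_ge0 u1 /= -upE lerD2r.
have e01 : 0 <= eta <= 1 by rewrite (ltW eta0); case/andP: etas.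
have /andP[al1 al2] := alpha_bound um0 e01; rewrite -/(alpha um eta) in al1 al2.
have dlum : dl * um <= 1 / 2 * um by rewrite ler_pM2r.
have utE x : ut x = V x + (U x - um) by rewrite /ut addrA.
have utb x : - (3 * um) <= ut x <= 3 / 2 * um.
  rewrite utE; have /andP[v1 v2] := Vb' x; have /andP[u1 u2] := Us x.
  by move: v1 v2 u1 u2 dlum um0; clear => *; apply/andP; split; lra.
have cut : continuous ut := fun_contB (fun_contD cV cU) (@fun_cont_cst R um).
have cN : continuous N by apply: fun_contD (fun_contX cp); apply: fun_contM (@fun_cont_cst R _) (fun_contX cp).
have N0 x : 0 <= N x.
  by apply: addr_ge0; [apply: mulr_ge0; exact: sqr_ge0|rewrite (exprM (phi x) 2 2); exact: sqr_ge0].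
have iV := (profile_integ pV).1; have iU := (profile_integ pU).1.
(* every weight below is dominated by [N], which is bounded *)
have NK x : `|N x| <= um ^+ 2 * K ^+ 2 + K ^+ 4.
  rewrite ger0_norm //; have p2 n : (phi x ^+ n) <= K ^+ n.
    by apply: le_trans (ler_norm _) _; rewrite normrX lerXn2r ?nnegrE // ltW.
  by apply: lerD => //; apply: ler_wpM2l => //; exact: sqr_ge0.
pose dom (g : R -> R) := exists C, forall x, `|g x| <= C * N x.
have wint (P : R -> R) (lo hi : R) (g : R -> R) : profile lo hi P -> continuous g -> dom g ->
    mu.-integrable setT (EFin \o (fun x => derive1 P x * g x)).
  move=> pP cg [C gC]; apply: (@integ_weight _ _ _ (`|C| * (um ^+ 2 * K ^+ 2 + K ^+ 4)) _ _ pP).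
    exact: continuous_meas.
  move=> x; apply: le_trans (gC x) _; apply: le_trans (ler_norm _) _.
  by rewrite normrM; apply: ler_wpM2l.
have domN : dom N by exists 1 => x; rewrite mul1r ger0_norm.
have u2 : 0 < um ^+ 2 by rewrite exprn_gt0.
have dom2 (g : R -> R) (Cg : R) : (forall x, `|g x| <= Cg) -> dom (fun x => g x * phi x ^+ 2).
  move=> gC; exists (Cg / um ^+ 2) => x.
  have C0 : 0 <= Cg := le_trans (normr_ge0 _) (gC x).
  rewrite normrM (ger0_norm (sqr_ge0 (phi x))) -mulrA.
  apply: ler_pM => //; first exact: sqr_ge0.
  rewrite ler_pdivlMl // lerDl (exprM (phi x) 2 2); exact: sqr_ge0.
have cfl : continuous f by move=> v; exact: is_derive_cont (flux_d1 fl v).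
have cf1 : continuous (derive1 f) by move=> v; exact: is_derive_cont (flux_d2 fl v).
have [CB CB0 hCB] := B_fun_bounded um0 fl erefl e01.
have domB (v : R -> R) : (forall x, `|v x| <= 3 * um) -> dom (fun x => B_fun um eta f (v x) (phi x)).
  move=> vb; exists (CB * (1 + (um ^+ 2)^-1)) => x; apply: le_trans (hCB _ _ (vb x)) _.
  rewrite -mulrA; apply: ler_wpM2l => //; rewrite /N.
  have p2 : 0 <= phi x ^+ 2 := sqr_ge0 _; have p4 : 0 <= phi x ^+ 4 by rewrite (exprM (phi x) 2 2) sqr_ge0.
  rewrite mulrDl mul1r mulrDr mulKf ?gt_eqF //.
  have h1 : 0 <= um ^+ 2 * phi x ^+ 2 by apply: mulr_ge0 => //; exact: ltW.
  have h2 : 0 <= (um ^+ 2)^-1 * phi x ^+ 4 by apply: mulr_ge0 => //; rewrite invr_ge0 ltW.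
  by move: h1 h2; clear; lra.
have f1b (v : R -> R) (C : R) : (forall x, `|v x| <= C) -> continuous v -> exists C', forall x, `|derive1 f (v x)| <= C'.
  move=> vC cv; have [C' _ hC'] := continuous_bounded_itv (- C) C cf1.
  by exists C' => x; apply: hC'; rewrite in_itv /= -ler_norml.
have Vn x : `|V x| <= 3 * um.
  by have /andP[] := Vb' x; move: um0; clear => *; apply/ler_normlP; split; lra.
have Un x : `|U x| <= 3 * um.
  by have /andP[] := Us x; move: um0 dlum; clear => *; apply/ler_normlP; split; lra.
have utn x : `|ut x| <= 3 * um.
  by have /andP[] := utb x; move: um0; clear => *; apply/ler_normlP; split; lra.
have domD (g1 g2 : R -> R) : dom g1 -> dom g2 -> dom (fun x => g1 x + g2 x).
  move=> [C1 h1] [C2 h2]; exists (C1 + C2) => x.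
  by apply: le_trans (ler_normD _ _) _; rewrite mulrDl; apply: lerD.
have domZ (k : R) (g : R -> R) : dom g -> dom (fun x => k * g x).
  move=> [C1 h1]; exists (`|k| * C1) => x; rewrite normrM -mulrA; exact: ler_wpM2l.
have [C1 hC1] := f1b V _ Vn cV; have [C2 hC2] := f1b U _ Un cU; have [C3 hC3] := f1b ut _ utn cut.
pose IS := \int[mu]_x (derive1 V x * N x); pose IR := \int[mu]_x (derive1 U x * N x).
pose IH := \int[mu]_x (h x ^+ 2).
have iVN := wint _ _ _ _ pV cN domN; have iUN := wint _ _ _ _ pU cN domN.
have IS0 : 0 <= IS by apply: Rintegral_ge0 => x _; exact: mulr_ge0.
have IR0 : 0 <= IR by apply: Rintegral_ge0 => x _; exact: mulr_ge0.
have IH0 : 0 <= IH by apply: Rintegral_ge0 => x _; exact: sqr_ge0.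
have DR : eta / 90 * IR <= \int[mu]_x (derive1 U x * (B_fun um eta f (U x) (phi x) - 2^-1 * derive1 f (U x) * phi x ^+ 2)).
  rewrite /IR -RintegralZl //; apply: le_Rintegral => //; first exact: integZ.
    apply: wint pU _ _.
      apply: fun_contB; first exact: B_fun_continuous.
      by apply: fun_contM (fun_contX cp); apply: fun_contM (@fun_cont_cst R _) (fun_cont_comp cf1 cU).
    have [C hC] := domB U Un; have [C' hC'] := dom2 (fun x => derive1 f (U x)) C2 hC2.
    exists (C + 2^-1 * C') => x; apply: le_trans (ler_normB _ _) _; rewrite mulrDl; apply: lerD => //.
    by rewrite -mulrA normrM (ger0_norm (_ : 0 <= 2^-1)) // -mulrA ler_wpM2l.
  move=> x _; rewrite mulrCA; apply: ler_wpM2l => //.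
  apply: rarefaction_pointwise fl _ _ _ => //.
    by have /andP[u1 u2'] := Us x; move: u1 u2' dlum; clear => *; apply/andP; split; lra.
  have : 204 * eps0 <= eta / 180 by apply: hq2; rewrite Ed ltW.
  by clear -eta0; move: eta0; clear; lra.
have Dh : - (dl * um * IH) <= - (\int[mu]_x ((U x - um) * h x ^+ 2)).
  rewrite lerN2 /IH -RintegralZl //; apply: le_Rintegral => //; last first.
  - by move=> x _; apply: ler_wpM2r; [exact: sqr_ge0|case/andP: (Us x)].
  - exact: integZ.
  rewrite (_ : (fun x => _) = fun x => h x ^+ 2 * (U x - um)); last by apply/funext => x; exact: mulrC.
  apply: (@integM _ _ (dl * um)) => //; first exact: continuous_meas measurableT (fun_contB cU (@fun_cont_cst R um)).
  by move=> x _; have /andP[u1 u2'] := Us x; rewrite ger0_norm.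
have DA : - ((16 * dl + 204 * eps0) * IS) <=
    \int[mu]_x (derive1 V x * (A_fun um eta f (ut x) (phi x) - A_fun um eta f (V x) (phi x))).
  rewrite -mulNr /IS -RintegralZl //; apply: le_Rintegral => //; first exact: integZ.
    apply: wint pV _ _.
      have cA (v : R -> R) : continuous v -> continuous (fun x => A_fun um eta f (v x) (phi x)).
        move=> cv; apply: fun_contD; first exact: B_fun_continuous.
        by apply: fun_contM (fun_contX cp); apply: fun_contM (@fun_cont_cst R _) (fun_cont_comp cf1 cv).
      exact: fun_contB (cA _ cut) (cA _ cV).
    exists (16 * dl + 204 * eps0) => x; rewrite utE; exact: (A_fun_diff (phi x) um0 fl e01 (Vb' x) (Us x) dl12).
  move=> x _; rewrite mulrCA; apply: ler_wpM2l => //.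
  have := A_fun_diff (phi x) um0 fl e01 (Vb' x) (Us x) dl12; rewrite -utE mulNr.
  by move=> /ler_normlP[h1 _]; rewrite lerNl.
pose g1 (x : R) : R := (U x - um) * phi x; pose g2 (x : R) : R := (alpha um eta - ut x) * phi x + 2^-1 * phi x ^+ 2.
pose g0 (x : R) : R := (alpha um eta - V x) * phi x + 2^-1 * phi x ^+ 2.
have cg1 : continuous g1 by apply: fun_contM cp; exact: fun_contB cU (@fun_cont_cst R um).
have cgv (v : R -> R) : continuous v -> continuous (fun x => (alpha um eta - v x) * phi x + 2^-1 * phi x ^+ 2).
  by move=> cv; apply: fun_contD; [exact: fun_contM (fun_contB (@fun_cont_cst R _) cv) cp|exact: fun_contM (@fun_cont_cst R _) (fun_contX cp)].
have cg2 : continuous g2 := cgv _ cut; have cg0 : continuous g0 := cgv _ cV.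
have bnd (P : R -> R) (lo hi : R) (g : R -> R) (C : R) : profile lo hi P -> continuous g -> (forall x, `|g x| <= C) ->
    mu.-integrable setT (EFin \o (fun x => derive1 P x * g x)).
  by move=> pP cg gC; apply: integ_weight pP _ gC; exact: continuous_meas.
have g1b x : `|g1 x| <= 1 / 2 * um * K.
  rewrite normrM; apply: ler_pM => //; have /andP[u1 u2'] := Us x.
  by rewrite ger0_norm // (le_trans u2').
have aln : `|alpha um eta| <= 5 * um.
  by move: al1 al2 um0; clear => *; apply/ler_normlP; split; lra.
have gvb (v : R -> R) : (forall x, `|v x| <= 3 * um) -> forall x,
    `|(alpha um eta - v x) * phi x + 2^-1 * phi x ^+ 2| <= 8 * um * K + 2^-1 * K ^+ 2.
  move=> vb x; apply: le_trans (ler_normD _ _) _; apply: lerD.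
    rewrite normrM; apply: ler_pM => //; apply: le_trans (ler_normB _ _) _.
    by move: aln (vb x); clear; lra.
  rewrite normrM (gtr0_norm (_ : 0 < 2^-1)) // ler_wpM2l // normrX lerXn2r ?nnegrE //; exact: ltW.
have iVg1 := bnd _ _ _ _ _ pV cg1 g1b.
have iVg0 := bnd _ _ _ _ _ pV cg0 (gvb _ Vn); have iUg2 := bnd _ _ _ _ _ pU cg2 (gvb _ utn).
have ZE : Z_fun um eta V U ut phi = - (\int[mu]_x (derive1 V x * g1 x)) + \int[mu]_x (derive1 U x * g2 x).
  rewrite /Z_fun; congr (- _ + _); apply: eq_Rintegral => x _; rewrite /g1; ring.
(* An exact identity: replacing [V] by [ut] lowers the weight by [U - um], which is the first term
   of [Z_fun], and adds [derive1 U] to the derivative, which is the second. *)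
have YE : Y_fun um eta ut phi = Y_fun um eta V phi + Z_fun um eta V U ut phi.
  rewrite ZE addrA -RintegralB // -RintegralD //; last exact: integB.
  by apply: eq_Rintegral => x _; rewrite dutE /g0 /g1 /g2 utE; ring.
split; first exact: YE.
(* Here the integrand is small pointwise, since [U - um <= dl * um]. *)
have Z1 : (\int[mu]_x (derive1 V x * g1 x)) ^+ 2 <= 4 * um * dl ^+ 2 * IS.
  have ult : um - ul <= 4 * um by move: ulb um0; clear; lra.
  have cs := weighted_cauchy_schwarz (mulr_gt0 (ltr0n R 4) um0) V0 iV (le_trans (profile_integ pV).2 ult) iVg1.
  have gg x : g1 x ^+ 2 <= dl ^+ 2 * N x.
    rewrite exprMn /N mulrDr mulrA; apply: ler_wpDr; first by rewrite mulr_ge0 ?sqr_ge0 // (exprM (phi x) 2 2) sqr_ge0.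
    apply: ler_wpM2r; first exact: sqr_ge0.
    by rewrite -exprMn lerXn2r ?nnegrE //; have /andP[] := Us x => // *; apply: mulr_ge0 => //; exact: ltW.
  have ig : mu.-integrable setT (EFin \o (fun x => derive1 V x * g1 x ^+ 2)).
    apply: wint pV (fun_contX cg1) _; exists (dl ^+ 2) => x; rewrite ger0_norm ?sqr_ge0 //.
  apply: le_trans (cs ig) _; rewrite -mulrA ler_wpM2l //; first by apply: mulr_ge0 => //; exact: ltW.
  rewrite /IS -RintegralZl //; apply: le_Rintegral => //; first exact: integZ.
  by move=> x _; rewrite [leRHS]mulrCA; apply: ler_wpM2l.
(* Here the integrand is not small; smallness comes from the total mass of [derive1 U], at most
   [up - um]. *)
have Z2 : (\int[mu]_x (derive1 U x * g2 x)) ^+ 2 <= dl * um * (128 * IR).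
  have cs := weighted_cauchy_schwarz up0 U0 iU (profile_integ pU).2 iUg2; rewrite -upE.
  have gg x : g2 x ^+ 2 <= 128 * N x.
    have a8 : `|alpha um eta - ut x| <= 8 * um.
      by apply: le_trans (ler_normB _ _) _; move: aln (utn x); clear; lra.
    have a64 : (alpha um eta - ut x) ^+ 2 <= 64 * um ^+ 2.
      have -> : 64 * um ^+ 2 = (8 * um) ^+ 2 by ring.
      rewrite -real_normK ?num_real // lerXn2r ?nnegrE // mulr_ge0 //; exact: ltW.
    have p2 : 0 <= phi x ^+ 2 := sqr_ge0 _.
    have p4 : 0 <= phi x ^+ 4 by rewrite (exprM (phi x) 2 2) sqr_ge0.
    have hs : 0 <= ((alpha um eta - ut x) * phi x - 2^-1 * phi x ^+ 2) ^+ 2 := sqr_ge0 _.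
    have := ler_wpM2r p2 a64; rewrite /N -(mulrA 64).
    have -> : g2 x ^+ 2 = 2 * ((alpha um eta - ut x) ^+ 2 * phi x ^+ 2) + 2^-1 * phi x ^+ 4
       - ((alpha um eta - ut x) * phi x - 2^-1 * phi x ^+ 2) ^+ 2 by rewrite /g2; field.
    move: p4 hs; clear; move: ((_ - 2^-1 * _) ^+ 2) (um ^+ 2 * _) ((_ - _) ^+ 2 * _) (phi x ^+ 4) => a b0 c0 d0; lra.
  have ig : mu.-integrable setT (EFin \o (fun x => derive1 U x * g2 x ^+ 2)).
    by apply: wint pU (fun_contX cg2) _; exists 128 => x; rewrite ger0_norm ?sqr_ge0.
  apply: le_trans (cs ig) _; apply: ler_wpM2l; first exact: (ltW up0).
  rewrite /IR -RintegralZl //; apply: le_Rintegral => //; first exact: integZ.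
  by move=> x _; rewrite [leRHS]mulrCA; apply: ler_wpM2l.
have ND : \int[mu]_x (derive1 ut x * N x) = IS + IR.
  by rewrite -RintegralD //; apply: eq_Rintegral => x _; rewrite dutE mulrDl.
rewrite ND -/IH YE.
set Y := Y_fun um eta V phi in SH *; set Z := Z_fun um eta V U ut phi in ZE *.
have ZZ : Z ^+ 2 <= 8 * um * dl ^+ 2 * IS + dl * um * (256 * IR).
  rewrite ZE; move: Z1 Z2; set a := \int[mu]_x (derive1 V x * g1 x); set e := \int[mu]_x (derive1 U x * g2 x).
  move=> ha he.
  have hs : 0 <= (a + e) ^+ 2 := sqr_ge0 _.
  have -> : (- a + e) ^+ 2 = 2 * a ^+ 2 + 2 * e ^+ 2 - (a + e) ^+ 2 by ring.
  have -> : 8 * um * dl ^+ 2 * IS = 2 * (4 * um * dl ^+ 2 * IS) by ring.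
  have -> : dl * um * (256 * IR) = 2 * (dl * um * (128 * IR)) by ring.
  move: ha he hs; move: (_ * IS) (_ * (128 * IR)) (a ^+ 2) (e ^+ 2) ((a + e) ^+ 2); clear => *; lra.
have bE : 800^-1 = 8 * b by rewrite /b; field.
rewrite -/IH -/IS bE in SH; rewrite -/k0 in SH *.
clear Z1 Z2 ZE YE ND; clearbody IS IR IH Y Z dl b.
have SQ := square_split Y Z k00 kk; rewrite -/th -/Kz in SQ.
have hdl (q : R) : delta0 <= q -> 0 <= dl <= q by move=> h0; rewrite dl0 (le_trans upd).
have r0 := hdl _ Da; have r1 := hd1 _ (hdl _ Dc); have r2 := hd2 _ (hdl _ Dd); have r3 := hd3 _ (hdl _ De).
have s1 : 204 * eps0 <= b by apply: hq1; rewrite Ec ltW.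
have KZ : Kz * Z ^+ 2 <= b * IS + eta / 180 * IR.
  apply: le_trans (ler_wpM2l Kz0 ZZ) _; rewrite mulrDr; apply: lerD.
    have -> : Kz * (8 * um * dl ^+ 2 * IS) = Kz * 8 * um * dl * (dl * IS) by ring.
    have t1 : dl * IS <= 1 * IS by apply: ler_wpM2r => //; apply: le_trans dl12 _; clear; lra.
    have t0 : 0 <= dl * IS by exact: mulr_ge0.
    rewrite mul1r in t1; apply: ler_pM => //.
    by apply: mulr_ge0 => //; apply: mulr_ge0; [exact: mulr_ge0|exact: ltW].
  have -> : Kz * (dl * um * (256 * IR)) = Kz * 256 * um * dl * IR by ring.
  exact: ler_wpM2r.
have cT : c * `|kappa * (Y + Z)| ^+ 2 <= th * (Y + Z) ^+ 2.
  rewrite real_normK ?num_real // exprMn mulrA; apply: ler_wpM2r; first exact: sqr_ge0.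
  by rewrite -ler_pdivlMr // exprn_gt0.
have cH : c * (um * IH) <= b * (um * IH).
  by apply: ler_wpM2r => //; apply: mulr_ge0 => //; exact: ltW.
have cS : c * IS <= b * IS by exact: ler_wpM2r.
have cR : c * IR <= eta / 180 * IR by exact: ler_wpM2r.
have dH : dl * (um * IH) <= b * (um * IH).
  by apply: ler_wpM2r; [apply: mulr_ge0 => //; exact: ltW|case/andP: r0].
have dS : (16 * dl + 204 * eps0) * IS <= b * IS + b * IS.
  by rewrite -mulrDl; apply: ler_wpM2r => //; exact: lerD.
have uH0 : 0 <= um * IH by apply: mulr_ge0 => //; exact: ltW.
have e90 : eta / 90 * IR = 2 * (eta / 180 * IR) by field.
have bS0 : 0 <= b * IS by rewrite mulr_ge0 // ltW.
have bH0 : 0 <= b * (um * IH) by rewrite mulr_ge0 // ltW.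
rewrite e90 in DR; rewrite -mulrA in Dh.
have E8 : 8 * b * (um * IH + IS) = 8 * (b * (um * IH)) + 8 * (b * IS) by ring.
rewrite E8 in SH;
have -> : c * (um * IH + (IS + IR) + `|kappa * (Y + Z)| ^+ 2) = c * (um * IH) + c * IS + c * IR + c * `|kappa * (Y + Z)| ^+ 2 by ring.
move: SH DR Dh DA SQ KZ cT cH cS cR dH dS bS0 bH0; clear.
move: (c * (um * IH)) (c * IS) (c * IR) (c * _) (b * (um * IH)) (b * IS) (eta / 180 * IR).
move: (_ * IS) (dl * (um * IH)) (Kz * Z ^+ 2) (th * _) (kappa * _) (k0 * _).
do 5 (move: (\int[mu]_x _)).
move=> *; lra.
Qed.

(** * The perturbation *)

Lemma h1_add (R : realType) (a da b db : R -> R) : h1 a da -> h1 b db ->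
  h1 (fun x => a x + b x) (fun x => da x + db x).
Proof.
move=> [aca ma ia ida] [acb mb ib idb].
have sq (f g : R -> R) : measurable_fun (setT : set (measurableTypeR R)) f ->
    measurable_fun (setT : set (measurableTypeR R)) g ->
    mu.-integrable setT (EFin \o (fun x => f x ^+ 2)) -> mu.-integrable setT (EFin \o (fun x => g x ^+ 2)) ->
    mu.-integrable setT (EFin \o (fun x => (f x + g x) ^+ 2)).
  move=> mf mg i1 i2; apply: integ_le (integZ 2 measurableT (integD measurableT i1 i2)) => //.
    by apply: measurable_funX; exact: measurable_funD.
  move=> x _; rewrite ger0_norm ?sqr_ge0 //.
  have h : 0 <= (f x - g x) ^+ 2 := sqr_ge0 _.
  have -> : (f x + g x) ^+ 2 = 2 * (f x ^+ 2 + g x ^+ 2) - (f x - g x) ^+ 2 by ring.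
  by rewrite lerBlDr lerDl.
split; [exact: ac_D|exact: measurable_funD| |exact: sq].
by apply: sq => //; apply: continuous_meas => //; [exact: ac_continuous aca|exact: ac_continuous acb].
Qed.

Lemma h1_shift (R : realType) (a da : R -> R) s : h1 a da ->
  h1 (fun x => a (x + s)) (fun x => da (x + s)).
Proof.
move=> [aca ma ia ida]; split; first exact: ac_shift.
- exact: (measurableT_comp ma (meas_shift s)).
- exact: (integ_shift s ia).1.
- exact: (integ_shift s ida).1.
Qed.

Lemma bounded_sq_integ (R : realType) (g : R -> R) (K : R) : mu.-integrable setT (EFin \o g) ->
  (forall x, `|g x| <= K) -> mu.-integrable setT (EFin \o (fun x => g x ^+ 2)).
Proof.
move=> ig gK; rewrite (_ : (fun x => _) = fun x => g x * g x); last by apply/funext => x; rewrite expr2.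
by apply: (@integM _ _ K) => //; exact: integ_meas ig.
Qed.

(** A profile need not be square integrable. The difference with a translate is bounded and
    integrable, hence square integrable, and so is its derivative. *)
Lemma profile_shift_h1 (R : realType) (lo hi s : R) (P Q : R -> R) : profile lo hi P -> profile lo hi Q ->
  mu.-integrable setT (EFin \o (fun x => P (x + s) - Q x)) ->
  h1 (fun x => P (x + s) - Q x) (fun x => derive1 P (x + s) - derive1 Q x).
Proof.
move=> pP pQ iPQ; have [_ cdP [KP hP] bP] := pP; have [_ cdQ [KQ hQ] bQ] := pQ.
have acPQ := ac_B (ac_shift s (profile_ac pP)) (profile_ac pQ).
have id : mu.-integrable setT (EFin \o (fun x => derive1 P (x + s) - derive1 Q x)).
  by apply: integB => //; [exact: (integ_shift s (profile_integ pP).1).1|exact: (profile_integ pQ).1].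
split => //; first exact: integ_meas id.
- apply: (@bounded_sq_integ _ _ (hi - lo)) => // x.
  have /andP[h1 h2] := bP (x + s); have /andP[h3 h4] := bQ x.
  by move: h1 h2 h3 h4; clear => *; apply/ler_normlP; split; lra.
- apply: (@bounded_sq_integ _ _ (KP + KQ)) => // x.
  have /andP[h1 h2] := hP (x + s); have /andP[h3 h4] := hQ x.
  by move: h1 h2 h3 h4; clear => *; apply/ler_normlP; split; lra.
Qed.

Lemma profile_self_diff (R : realType) (lo hi s : R) (P : R -> R) : profile lo hi P ->
  mu.-integrable setT (EFin \o (fun x => P (x + s) - P x)).
Proof.
move=> pP; have acP := profile_ac pP; have cP := ac_continuous acP; have [_ _ [KP hP] bP] := pP.
have mono : {homo P : x y / x <= y}.
  move=> x y xy; rewrite -subr_ge0 acP.2 //; apply: Rintegral_ge0 => z _; by have /andP[] := hP z.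
have Pb x : `|P x| <= `|lo| + `|hi|.
  have /andP[h1 h2] := bP x; have /ler_normlP[h3 h4] := lexx `|lo|.
  have /ler_normlP[h5 h6] := lexx `|hi|.
  by move: h1 h2 h3 h4 h5 h6; clear => *; apply/ler_normlP; split; lra.
apply: integ_le (mono_diff_integ cP mono Pb (normr_ge0 s)) => //.
  apply: continuous_meas => //; apply: fun_contB => //; apply: fun_cont_comp => // x.
  by apply: cvgD; [exact: cvg_id|exact: cvg_cst].
move=> x _; have /ler_normlP[s1 s2] := lexx `|s|.
have h1 : P (x - `|s|) <= P (x + s) by apply: mono; move: s1; clear; lra.
have h2 : P (x + s) <= P (x + `|s|) by apply: mono; move: s2; clear; lra.
have h3 : P (x - `|s|) <= P x by apply: mono; move: (normr_ge0 s); clear; lra.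
have h4 : P x <= P (x + `|s|) by apply: mono; move: (normr_ge0 s); clear; lra.
by move: h1 h2 h3 h4; clear => *; apply/ler_normlP; split; lra.
Qed.

Lemma H1_representative (R : realType) (g : R -> R) : H1 g -> exists W h,
  [/\ h1 W h, measurable_fun (setT : set (measurableTypeR R)) g & {ae mu, forall x, g x = W x}].
Proof.
move=> [gL [h gh hL]]; have [mg ig] := L2_integ gL; have [mh ih] := L2_integ hL.
have [W acW gW] := weak_derivative_ac gh; exists W, h; split => //; split => //.
have mW : measurable_fun (setT : set (measurableTypeR R)) W.
  exact: continuous_meas measurableT (ac_continuous acW).
apply: L2_weaken ig; [|exact: measurable_funX|exact: measurable_funX].
apply: filterS gW; first exact: (ae_filter_ringOfSetsType mu).
by move=> x ->.
Qed.

Lemma weak_derivative_ae (R : realType) (g U h : R -> R) : weak_derivative U h ->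
  measurable_fun (setT : set (measurableTypeR R)) g -> continuous U ->
  {ae mu, forall x, g x = U x} -> weak_derivative g h.
Proof.
move=> [lU lh Uh] mg cU gU.
have mU : measurable_fun (setT : set (measurableTypeR R)) U := continuous_meas measurableT cU.
split => // [|psi tpsi].
  apply: integ_loc => // a b.
  have mab : measurable (`[a, b] : set (measurableTypeR R)) := measurable_itv _.
  apply/(integrable_mkcond _ mab); rewrite restrict_EFin.
  have iU : mu.-integrable `[a, b] (EFin \o U) by exact: continuous_integ.
  move: iU => /(integrable_mkcond _ mab); rewrite restrict_EFin => iU.
  apply: L2_weaken iU; last 2 first.
  - by apply/(measurable_restrictT _ mab); apply: (measurable_funS _ _ mU).
  - by apply/(measurable_restrictT _ mab); apply: (measurable_funS _ _ mg).
  apply: filterS gU; first exact: (ae_filter_ringOfSetsType mu).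
  by move=> x e; rewrite !patchE e.
have [_ cd _] := test_function_ac tpsi; rewrite -(Uh psi tpsi).
have md := continuous_meas (measurableT : measurable (setT : set (measurableTypeR R))) cd.
apply: ae_eq_Rintegral => //; [exact: measurable_funM|exact: measurable_funM|].
apply: filterS gU; first exact: (ae_filter_ringOfSetsType mu).
by move=> x ->.
Qed.

(** A primitive of the arbitrary choice [wderive g] agrees with [U] almost everywhere, hence
    everywhere by continuity, and two densities of the same function agree almost everywhere. *)
Lemma wderive_ae (R : realType) (g U h : R -> R) : h1 U h ->
  measurable_fun (setT : set (measurableTypeR R)) g -> {ae mu, forall x, g x = U x} ->
  measurable_fun (setT : set (measurableTypeR R)) (wderive g) /\
  {ae mu, forall x, wderive g x = h x}.
Proof.
move=> [acU mh _ _] mg gU; have cU := ac_continuous acU.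
have gh := weak_derivative_ae (ac_weak mh acU) mg cU gU.
have gw : weak_derivative g (wderive g).
  by rewrite /wderive; apply: (@xgetPex _ (cst 0) [set h | weak_derivative g h]); exists h.
have [_ [mw _ _] _] := gw; split=> //.
have [W acW gW] := weak_derivative_ac gw.
have UW : U = W.
  apply: continuous_ae_eq cU (ac_continuous acW) _.
  apply: (@filterS2 _ _ (ae_filter_ringOfSetsType mu) _ _ _ _ gU gW) => x <- <-. by [].
by apply: ac_unique acW _ => //; rewrite -UW.
Qed.

(** The perturbation itself is only measurable, being a continuous function up to a null set; hence
    this counterpart of [B_fun_continuous]. *)
Lemma B_fun_measurable (R : realType) (um eta : R) (f V phi : R -> R) :
  continuous f -> continuous (derive1 f) -> continuous V ->
  measurable_fun (setT : set (measurableTypeR R)) phi ->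
  measurable_fun (setT : set (measurableTypeR R)) (fun x => B_fun um eta f (V x) (phi x)).
Proof.
move=> cf cf1 cV mp.
have ci : continuous (int0 f).
  by apply: ac_continuous (ac_int0 _) => a b; exact: continuous_integ.
rewrite /B_fun.
rewrite (_ : (fun x => _) = (fun x => (alpha um eta - V x + phi x) * (f (V x + phi x) - f (V x))
  - (int0 f (V x + phi x) - int0 f (V x) - f (V x) * phi x)
  - (alpha um eta - V x) * derive1 f (V x) * phi x)); last first.
  by apply/funext => x; rewrite int0_shift.
have mc (g : R -> R) : continuous g -> measurable_fun (setT : set (measurableTypeR R)) g.
  exact: continuous_meas.
have ms := measurable_funD (mc _ cV) mp.
have mfV := mc _ (fun_cont_comp cf cV); have ma := mc _ (fun_contB (@fun_cont_cst R (alpha um eta)) cV).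
have comp (g : R -> R) : continuous g -> measurable_fun (setT : set (measurableTypeR R)) (fun x => g (V x + phi x)).
  by move=> cg; exact: (measurableT_comp (mc _ cg) ms).
apply: measurable_funB; last first.
  by apply: measurable_funM => //; apply: measurable_funM => //; exact: mc _ (fun_cont_comp cf1 cV).
apply: measurable_funB.
  apply: measurable_funM; first exact: measurable_funD.
  by apply: measurable_funB => //; exact: comp.
apply: measurable_funB; last exact: measurable_funM.
by apply: measurable_funB; [exact: comp|exact: mc _ (fun_cont_comp ci cV)].
Qed.

Theorem proposition4p1 (R : realType) (um kappa : R)
    (um_gt0 : 0 < um) (kappa_gt : 5%:R / um < kappa) :
  exists2 eta0 : R, 0 < eta0 &
  forall eta : R, 0 < eta < eta0 ->
  exists eps0 delta0 c : R, [/\ 0 < eps0, 0 < delta0, 0 < c &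
  forall (T : R) (f : R -> R) (deltaR ul : R) (uS : R -> R)
    (w u : R -> R -> R) (X dX : R -> R),
  let up := um + deltaR in
  let sigma := shock_speed um f ul in
  let uR := rarefaction um up f sigma w in
  let utilde := composite um uS uR in
  let phi := perturbation sigma utilde u X in
  0 < T ->
  Cn 3 f ->
  (eps_flux um f <= eps0%:E)%E ->
  0 < deltaR / um <= delta0 ->
  is_left_state um f ul ->
  is_shock_profile um f ul uS ->
  is_burgers_wave (derive1 f um) (derive1 f up) w ->
  strong_solution T f (utilde 0) u ->
  C1_on T X dX ->
  X 0 = 0 ->
  (forall t : R, 0 <= t <= T -> dX t = kappa * Y_fun um eta (utilde t) (phi t)) ->
  forall t : R, 0 <= t <= T ->
    c * (um * (\int[lebesgue_measure]_x (wderive (phi t) x ^+ 2))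
         + (\int[lebesgue_measure]_x
             (derive1 (utilde t) x * (um ^+ 2 * phi t x ^+ 2 + phi t x ^+ 4)))
         + `|dX t| ^+ 2)
    <= G_fun um kappa eta f uS (uR t) (utilde t) (phi t)].
Proof.
have [eta0 eta00 CE] := composite_estimate um_gt0 kappa_gt.
exists eta0 => // eta he; have [eps0 [delta0 [c [ep0 de0 c0 eum [de2 est]]]]] := CE eta he.
exists eps0, delta0, c; split => //.
move=> T f deltaR ul uS w u X dX up sigma uR utilde phi T0 cf fe /andP[dR0 dR1] ls sp bw ss _ _ dXE t tT.
have /andP[t0 _] := tT.
have fl := flux_of_eps um_gt0 cf fe.
have [dV cdV Veq Ful Vb] := shock_profile_facts um_gt0 fl ls sp.
have ulb : - (5 / 2 * um) < ul < - (3 / 2 * um).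
  by have [/andP[h1 h2] _] := ls; move: h1 h2; clear => *; apply/andP; split; lra.
have [hul hV] := shock_rhs_cubic um_gt0 fl ulb Ful.
have hV' x : `|derive1 uS x - (um - uS x) ^+ 2 * (uS x - ul)|
    <= 20 * eps0 * ((um - uS x) ^+ 2 * (uS x - ul)).
  by rewrite Veq; apply: hV; have /andP[/ltW-> /ltW->] := Vb x.
have [_ _ Vl Vr _] := sp.
have ep3 : eps0 <= 1 / 3 by move: eum; clear; lra.
have pV : profile ul um uS.
  split => //; last by move=> x; have /andP[/ltW-> /ltW->] := Vb x.
  (* The factor 2 bounds [1 + 20 * eps0], as [eps0 <= 1 / 20]. *)
  exists (2 * (um - ul) ^+ 3) => x; have /andP[v1 v2] := Vb x.
  have s0 : 0 <= (um - uS x) ^+ 2 * (uS x - ul) by apply: mulr_ge0; [exact: sqr_ge0|rewrite subr_ge0 ltW].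
  have s1 : (um - uS x) ^+ 2 * (uS x - ul) <= (um - ul) ^+ 2 * (um - ul).
    apply: ler_pM; [exact: sqr_ge0|by rewrite subr_ge0 ltW| |by rewrite lerD2r ltW].
    by rewrite lerXn2r ?nnegrE ?subr_ge0 ?(ltW v2) ?(ltW (lt_trans v1 v2)) // lerD2l lerN2 ltW.
  have s2 := ler_wpM2r s0 eum.
  have e3 : (um - ul) ^+ 3 = (um - ul) ^+ 2 * (um - ul) by rewrite exprSr.
  have := hV' x; rewrite -mulrA e3; move: s0 s1 s2; clear.
  move: (_ ^+ 2 * (uS x - ul)) (_ * (um - ul)) (eps0 * _) => a b d s0 s1 s2 /ler_normlP[h1 h2].
  by apply/andP; split; lra.
have deltaR0 : 0 < deltaR by have := mulr_gt0 dR0 um_gt0; rewrite divfK // gt_eqF.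
have upE : up - um = deltaR by rewrite /up; ring.
have uup : um < up by rewrite -subr_gt0 upE.
have up2 : up <= 2 * um.
  have h1 : deltaR / um <= 1 / 2 by exact: le_trans de2.
  by rewrite ler_pdivrMr // in h1; rewrite /up; move: h1 um_gt0; clear; lra.
have [pU iU] := rarefaction_facts sigma um_gt0 uup up2 cf fl ep3 bw.
have [[CH _] _ _] := ss.
have tT' : t \in `[0, T] by rewrite in_itv.
have [W [g [hW mv vW]]] := H1_representative (CH t tT').
pose s := sigma * t - X t.
have hE1 := profile_shift_h1 pV pV (profile_self_diff s pV).
have hE2 := profile_shift_h1 (pU 0 (lexx 0)) (pU t t0) (iU t s t0).
have := h1_add (h1_shift s hW) (h1_add hE1 hE2).
set Phi := (X in h1 X _); set H := (X in h1 _ X) => hphi.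
(* The definition of strong solution places [u - utilde 0] in [H1], whereas [phi] subtracts the
   profile at time [t] in a moving frame. The discrepancy consists of one difference of translates
   for each of the two waves. *)
have phiE x : phi t x = (u t (x + s) - utilde 0 (x + s))
    + ((uS (x + s) - uS x) + (uR 0 (x + s) - uR t x)).
  have xs : x + sigma * t - X t = x + s by rewrite /s addrA.
  by rewrite /phi /perturbation xs /utilde /composite; ring.
have aeP : {ae mu, forall x, phi t x = Phi x}.
  apply: filterS (ae_shift s vW); first exact: (ae_filter_ringOfSetsType mu).
  by move=> x e; rewrite phiE e.
have mT : measurable (setT : set (measurableTypeR R)) := measurableT.
have mphi : measurable_fun (setT : set (measurableTypeR R)) (phi t).
  have [ac1 _ _ _] := hE1; have [ac2 _ _ _] := hE2.
  rewrite (funext phiE); apply: measurable_funD; first exact: (measurableT_comp mv (meas_shift s)).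
  apply: continuous_meas => //; apply: ac_continuous; exact: ac_D ac1 ac2.
have [acPhi mH _ _] := hphi; have mPhi := continuous_meas mT (ac_continuous acPhi).
have [mw wH] := wderive_ae hphi mphi aeP.
have [||YE fin] := est f uS (uR t) Phi H ul up fl hul pV Vb hV' Vl Vr (pU t t0) _ _ hphi.
- by rewrite upE.
- by rewrite upE.
(* All functionals are integrals, so [phi t] and its weak derivative may be replaced by [Phi] and
   [H], equal to them almost everywhere; the price is measurability of each integrand on both
   sides. *)
have sw (F : R -> R -> R) : (forall z, measurable_fun (setT : set (measurableTypeR R)) z ->
      measurable_fun (setT : set (measurableTypeR R)) (fun x => F x (z x))) ->
    \int[mu]_x F x (phi t x) = \int[mu]_x F x (Phi x).
  move=> mF; apply: ae_eq_Rintegral; [exact: mT|exact: mF|exact: mF|].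
  by apply: filterS aeP; [exact: (ae_filter_ringOfSetsType mu)|move=> x ->].
have swd (F : R -> R -> R) : (forall z, measurable_fun (setT : set (measurableTypeR R)) z ->
      measurable_fun (setT : set (measurableTypeR R)) (fun x => F x (z x))) ->
    \int[mu]_x F x (wderive (phi t) x) = \int[mu]_x F x (H x).
  move=> mF; apply: ae_eq_Rintegral; [exact: mT|exact: mF|exact: mF|].
  by apply: filterS wH; [exact: (ae_filter_ringOfSetsType mu)|move=> x ->].
have cV := ac_continuous (profile_ac pV); have cU := ac_continuous (profile_ac (pU t t0)).
have cut : continuous (utilde t) := fun_contB (fun_contD cV cU) (@fun_cont_cst R um).
have mc (v : R -> R) : continuous v -> measurable_fun (setT : set (measurableTypeR R)) v.
  exact: continuous_meas.
have cdU : continuous (derive1 (uR t)) by have [] := pU t t0.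
have cdut : continuous (derive1 (utilde t)).
  have d (x : R) : is_derive x 1 (utilde t) (derive1 uS x + derive1 (uR t) x).
    have [dU _ _ _] := pU t t0.
    by apply: (is_derive_eq (dfunB (dfunD (dV x) (dU x)) (dfuncst x um))); rewrite subr0.
  rewrite (_ : derive1 (utilde t) = fun x => derive1 uS x + derive1 (uR t) x); first exact: fun_contD.
  by apply/funext => x; rewrite derive1E; have [_ ->] := d x.
have cfl : continuous f by move=> v; exact: is_derive_cont (flux_d1 fl v).
have cf1 : continuous (derive1 f) by move=> v; exact: is_derive_cont (flux_d2 fl v).
have mcst k : measurable_fun (setT : set (measurableTypeR R)) (fun=> k : R) by exact: measurable_cst.
have mYw (v z : R -> R) : continuous v -> measurable_fun (setT : set (measurableTypeR R)) z ->
    measurable_fun (setT : set (measurableTypeR R))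
      (fun x => (alpha um eta - v x) * z x + 2%:R^-1 * z x ^+ 2).
  move=> cv mz; apply: measurable_funD; apply: measurable_funM => //.
    exact: mc _ (fun_contB (@fun_cont_cst R _) cv).
  exact: measurable_funX.
have YSE : Y_fun um eta uS (phi t) = Y_fun um eta uS Phi.
  apply: (sw (fun x z => derive1 uS x * ((alpha um eta - uS x) * z + 2%:R^-1 * z ^+ 2))) => z mz.
  by apply: measurable_funM; [exact: mc|exact: mYw].
have YTE : Y_fun um eta (utilde t) (phi t) = Y_fun um eta (utilde t) Phi.
  apply: (sw (fun x z => derive1 (utilde t) x * ((alpha um eta - utilde t x) * z + 2%:R^-1 * z ^+ 2))) => z mz.
  by apply: measurable_funM; [exact: mc|exact: mYw].
have ZE : Z_fun um eta uS (uR t) (utilde t) (phi t) = Z_fun um eta uS (uR t) (utilde t) Phi.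
  rewrite /Z_fun; congr (- _ + _).
    apply: (sw (fun x z => (uR t x - um) * derive1 uS x * z)) => z mz.
    by apply: measurable_funM => //; exact: mc _ (fun_contM (fun_contB cU (@fun_cont_cst R um)) cdV).
  apply: (sw (fun x z => derive1 (uR t) x * ((alpha um eta - utilde t x) * z + 2%:R^-1 * z ^+ 2))) => z mz.
  by apply: measurable_funM; [exact: mc|exact: mYw].
have mq (q z : R -> R) : continuous q -> measurable_fun (setT : set (measurableTypeR R)) z ->
    measurable_fun (setT : set (measurableTypeR R)) (fun x => q x * z x ^+ 2).
  by move=> cq mz; apply: measurable_funM; [exact: mc|exact: measurable_funX].
have mA (v z : R -> R) : continuous v -> measurable_fun (setT : set (measurableTypeR R)) z ->
    measurable_fun (setT : set (measurableTypeR R)) (fun x => A_fun um eta f (v x) (z x)).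
  move=> cv mz; apply: measurable_funD; first exact: B_fun_measurable.
  by apply: mq => //; apply: fun_contM (@fun_cont_cst R _) (fun_cont_comp cf1 cv).
rewrite /G_fun /D_S /D_R (dXE t tT) YTE YSE ZE.
rewrite (swd (fun x z => z ^+ 2)); last by move=> z mz; exact: measurable_funX.
rewrite (sw (fun x z => derive1 (utilde t) x * (um ^+ 2 * z ^+ 2 + z ^+ 4))); last first.
  move=> z mz; apply: measurable_funM; first exact: mc.
  by apply: measurable_funD; [apply: (mq (fun=> um ^+ 2)) => //; exact: fun_cont_cst|exact: measurable_funX].
rewrite (swd (fun x z => (alpha um eta - uS x) * z ^+ 2)); last first.
  by move=> z mz; apply: mq => //; exact: fun_contB (@fun_cont_cst R _) cV.
rewrite (sw (fun x z => derive1 uS x * (B_fun um eta f (uS x) z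
    + 2%:R^-1 * (derive1 f (uS x) - 2%:R * derive1 f um) * z ^+ 2))); last first.
  move=> z mz; apply: measurable_funM; first exact: mc.
  apply: measurable_funD; first exact: B_fun_measurable.
  by apply: mq => //; apply: fun_contM (@fun_cont_cst R _) _; apply: fun_contB (fun_cont_comp cf1 cV) (@fun_cont_cst R _).
rewrite (sw (fun x z => derive1 (uR t) x * (B_fun um eta f (uR t x) z
    - 2%:R^-1 * derive1 f (uR t x) * z ^+ 2))); last first.
  move=> z mz; apply: measurable_funM; first exact: mc.
  apply: measurable_funB; first exact: B_fun_measurable.
  by apply: mq => //; apply: fun_contM (@fun_cont_cst R _) (fun_cont_comp cf1 cU).
rewrite (swd (fun x z => (uR t x - um) * z ^+ 2)); last first.
  by move=> z mz; apply: mq => //; exact: fun_contB cU (@fun_cont_cst R um).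
rewrite (sw (fun x z => derive1 uS x * (A_fun um eta f (utilde t x) z - A_fun um eta f (uS x) z))); last first.
  move=> z mz; apply: measurable_funM; first exact: mc.
  by apply: measurable_funB; exact: mA.
exact: fin.
Qed.
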